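(* Suppose that $\dot x=f(x,\lambda)$ is a monotone system for each $\lambda\in[\lambda_-,\lambda_+]$. Let $\Lambda$ be a parameter shift from $\lambda_-$ to $\lambda_+$, let $(p(s),\Lambda(s))$ be a path and $(q(s),\Lambda(s))$ a stable path, and denote $p_\pm=\lim_{s\to\pm\infty}p(s)$ and $q_\pm=\lim_{s\to\pm\infty}q(s)$. Suppose that for all $s$ the matrix $\partial_xf(p(s),\Lambda(s))$ has a positive eigenvalue with an associated eigenvector all of whose components are positive, and that the same holds in the limits, i.e. for $\partial_xf(p_\pm,\lambda_\pm)$. (1) If $q(s)\ll p(s)$ (resp. $q(s)\gg p(s)$) for all $s\in\mathbb{R}$, including in the limits (i.e. $q_\pm\ll p_\pm$, resp. $q_\pm\gg p_\pm$), and there are $u<v$ such that $q(u)\gg p(v)$ (resp. $q(u)\ll p(v)$), then there is a parameter shift $\tilde\Lambda$ such that there is R-tipping away from $q_-$ for $\tilde\Lambda$. (2) If $q(s)\ll p(s)$ (resp. $q(s)\gg p(s)$) for all $s\in\mathbb{R}$, including in the limits (i.e. $q_\pm\ll p_\pm$, resp. $q_\pm\gg p_\pm$), and $q_-\gg p_+$ (resp. $q_-\ll p_+$), then there is R-tipping away from $q_-$ for $\Lambda$ and all large enough $r>0$; that is, for all sufficiently large $r>0$ the pullback attractor to $q_-$ does not converge to $q_+$ as $t\to\infty$.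
   Context: Setting. $U\subset\mathbb{R}^n$ is open and $f\in C^2(U\times\mathbb{R},\mathbb{R}^n)$. For fixed $\lambda$ consider the autonomous system $\dot x=f(x,\lambda)$. Let $\lambda_-<\lambda_+$. A parameter shift (from $\lambda_-$ to $\lambda_+$) is a function $\Lambda\in C^2(\mathbb{R},(\lambda_-,\lambda_+))$ with $\lim_{s\to\pm\infty}\Lambda(s)=\lambda_\pm$ and $\lim_{s\to\pm\infty}\Lambda'(s)=0$. For $r>0$ consider the non-autonomous system $\dot x=f(x,\Lambda(rt))$, equivalently the augmented system $\dot x=f(x,\Lambda(s))$, $\dot s=r$ with $s=rt$. Order notation: for $x,y\in\mathbb{R}^n$, $x\le y$ means $x_i\le y_i$ for all $i$; $x\ll y$ means $x_i<y_i$ for all $i$; $x\ge y$, $x\gg y$ are the reversed relations. Monotone system: $\dot x=g(x)$ on $U$ is monotone if $\frac{\partial g_i}{\partial x_j}(x)\ge0$ for all $i\ne j$ and all $x\in U$. Monotone systems are understood to have the order-preservation property: if $x\le y$ in $U$ and $t\ge0$, then $x\cdot t\le y\cdot t$ (as long as both are defined), where $x\cdot t$ is the solution at time $t$ starting from $x$. Attracting equilibrium: an equilibrium of $\dot x=f(x,\lambda)$ at which all eigenvalues of $\partial_xf$ have negative real part. Path: $(p(s),\Lambda(s))$, $s\in\mathbb{R}$, with $p$ continuous, $p(s)\in U$ an equilibrium of $\dot x=f(x,\Lambda(s))$ for every $s$, and limits $p_\pm=\lim_{s\to\pm\infty}p(s)$ existing in $U$. Stable path: a path $(q(s),\Lambda(s))$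 such that each $q(s)$ is an attracting equilibrium of $\dot x=f(x,\Lambda(s))$ and $q_\pm$ are attracting equilibria of $\dot x=f(x,\lambda_\pm)$. Pullback attractor: for a parameter shift and each $r>0$ there is a unique trajectory $x^r(t)$ of the corresponding non-autonomous system with $x^r(t)\to q_-$ as $t\to-\infty$; it is called the pullback attractor to $q_-$. R-tipping: there is R-tipping away from $q_-$ for a parameter shift if for some $r>0$ the corresponding pullback attractor $x^r$ to $q_-$ does not satisfy $x^r(t)\to q_+$ as $t\to\infty$. *)

(* Defs.v *)
From HB Require Import structures.
From mathcomp Require Import all_boot all_order all_algebra.
From mathcomp Require Import all_classical all_reals all_analysis.
From mathcomp Require Import complex.

Set Implicit Arguments.
Unset Strict Implicit.
Unset Printing Implicit Defensive.

Import Order.TTheory GRing.Theory Num.Theory.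
Import numFieldNormedType.Exports.

Local Open Scope classical_set_scope.
Local Open Scope ring_scope.

(* Meant for A open and V, W finite-dimensional, where it is the usual notion
   of a C^k map: differentiable, with all directional derivatives C^(k-1). *)
Fixpoint Ck (R : realType) (V W : normedModType R) (k : nat) (A : set V)
    (f : V -> W) {struct k} : Prop :=
  match k with
  | 0%N => forall x, A x -> {for x, continuous f}
  | k'.+1 => (forall x, A x -> differentiable f x)
             /\ forall v : V, Ck k' A ('D_v f)
  end.

Definition vec_le (R : realType) (n : nat) (x y : 'rV[R]_n) : Prop :=
  forall i, x 0 i <= y 0 i.

Definition vec_ll (R : realType) (n : nat) (x y : 'rV[R]_n) : Prop :=
  forall i, x 0 i < y 0 i.

(* [I] is meant to be an open interval of times. *)
Definition trajectory (R : realType) (n : nat) (U : set 'rV[R]_n)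
    (g : R -> 'rV[R]_n -> 'rV[R]_n) (I : set R) (x : R -> 'rV[R]_n) : Prop :=
  forall t, I t -> U (x t) /\ is_derive t (1 : R) x (g t (x t)).

(* Points are row vectors, so the library's [jacobian g x] is the transpose of
   the usual Jacobian matrix: its (j, i) entry is the derivative of g_i with
   respect to x_j, and it acts on vectors from the right.  Hence the (right)
   eigenvectors of the usual Jacobian matrix are the row vectors w with
   w *m jacobian g x = mu *: w, as in the library's [eigenvalue]. *)
Definition dfdx (R : realType) (n : nat) (f : 'rV[R]_n * R -> 'rV[R]_n)
    (x : 'rV[R]_n) (l : R) : 'M[R]_n :=
  jacobian (fun y => f (y, l)) x.

(* On an arbitrary open U (with no convexity assumed) the sign condition does
   not imply order preservation, so the latter is part of the notion. *)
Definition monotone_system (R : realType) (n : nat) (U : set 'rV[R]_n)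
    (g : 'rV[R]_n -> 'rV[R]_n) : Prop :=
  (forall x i j, U x -> i != j -> 0 <= jacobian g x j i) /\
  (forall (a b : R) (x y : R -> 'rV[R]_n), a < 0 -> 0 < b ->
     trajectory U (fun=> g) `]a, b[ x ->
     trajectory U (fun=> g) `]a, b[ y ->
     vec_le (x 0) (y 0) ->
     forall t, 0 <= t < b -> vec_le (x t) (y t)).

Definition equilibrium (R : realType) (n : nat) (U : set 'rV[R]_n)
    (f : 'rV[R]_n * R -> 'rV[R]_n) (x : 'rV[R]_n) (l : R) : Prop :=
  U x /\ f (x, l) = 0.

Definition attracting_equilibrium (R : realType) (n : nat)
    (U : set 'rV[R]_n) (f : 'rV[R]_n * R -> 'rV[R]_n)
    (x : 'rV[R]_n) (l : R) : Prop :=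
  equilibrium U f x l /\
  forall z : R[i], eigenvalue (map_mx (real_complex R) (dfdx f x l)) z ->
    complex.Re z < 0.

Definition pos_eigenpair (R : realType) (n : nat) (A : 'M[R]_n) : Prop :=
  exists (mu : R) (w : 'rV[R]_n),
    [/\ 0 < mu, w != 0, w *m A = mu *: w & vec_ll 0 w].

Definition parameter_shift (R : realType) (lm lp : R) (L : R -> R) : Prop :=
  [/\ Ck 2 setT L,
      forall s, lm < L s < lp,
      L s @[s --> -oo] --> lm /\ L s @[s --> +oo] --> lp &
      derive1 L s @[s --> -oo] --> 0 /\ derive1 L s @[s --> +oo] --> 0].

(* [pm] and [pp] are the limits p_- and p_+. *)
Definition is_path (R : realType) (n : nat) (U : set 'rV[R]_n)
    (f : 'rV[R]_n * R -> 'rV[R]_n) (L : R -> R)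
    (p : R -> 'rV[R]_n) (pm pp : 'rV[R]_n) : Prop :=
  [/\ continuous p,
      forall s, equilibrium U f (p s) (L s),
      p s @[s --> -oo] --> pm /\ U pm &
      p s @[s --> +oo] --> pp /\ U pp].

Definition stable_path (R : realType) (n : nat) (U : set 'rV[R]_n)
    (f : 'rV[R]_n * R -> 'rV[R]_n) (lm lp : R) (L : R -> R)
    (q : R -> 'rV[R]_n) (qm qp : 'rV[R]_n) : Prop :=
  [/\ is_path U f L q qm qp,
      forall s, attracting_equilibrium U f (q s) (L s),
      attracting_equilibrium U f qm lm &
      attracting_equilibrium U f qp lp].

Definition shifted_field (R : realType) (n : nat)
    (f : 'rV[R]_n * R -> 'rV[R]_n) (L : R -> R) (r : R)
    (t : R) (x : 'rV[R]_n) : 'rV[R]_n :=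
  f (x, L (r * t)).

(* A trajectory need not exist for all times (it may blow up or leave U), so
   the pullback attractor comes with its maximal interval of existence
   ]-oo, T[, where T = +oo if it is global. *)
Definition pullback_attractor (R : realType) (n : nat) (U : set 'rV[R]_n)
    (f : 'rV[R]_n * R -> 'rV[R]_n) (L : R -> R) (r : R) (qm : 'rV[R]_n)
    (T : \bar R) (x : R -> 'rV[R]_n) : Prop :=
  [/\ (-oo < T)%E,
      trajectory U (shifted_field f L r) [set t | (t%:E < T)%E] x,
      x t @[t --> -oo] --> qm &
      forall (T' : \bar R) (y : R -> 'rV[R]_n),
        trajectory U (shifted_field f L r) [set t | (t%:E < T')%E] y ->
        (forall t, (t%:E < T)%E -> (t%:E < T')%E -> y t = x t) ->
        (T' <= T)%E].

(* The pullback attractor to [qm] at rate [r] fails to converge to [qp]; this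
   includes the case where it ceases to exist in finite time. *)
Definition tips_at (R : realType) (n : nat) (U : set 'rV[R]_n)
    (f : 'rV[R]_n * R -> 'rV[R]_n) (L : R -> R) (qm qp : 'rV[R]_n)
    (r : R) : Prop :=
  exists (T : \bar R) (x : R -> 'rV[R]_n),
    pullback_attractor U f L r qm T x /\
    ~ (T = +oo%E /\ x t @[t --> +oo] --> qp).

Definition R_tipping (R : realType) (n : nat) (U : set 'rV[R]_n)
    (f : 'rV[R]_n * R -> 'rV[R]_n) (L : R -> R) (qm qp : 'rV[R]_n) : Prop :=
  exists2 r : R, 0 < r & tips_at U f L qm qp r.

(* Main.v *)
Require Import Defs.
From HB Require Import structures.
From mathcomp Require Import all_boot all_order all_algebra.
From mathcomp Require Import all_classical all_reals all_analysis.
From mathcomp Require Import complex ring lra.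

Set Implicit Arguments.
Unset Strict Implicit.
Unset Printing Implicit Defensive.

Import Order.TTheory GRing.Theory Num.Theory.
Import numFieldNormedType.Exports.

Local Open Scope classical_set_scope.
Local Open Scope ring_scope.

(** Order preservation yields Kamke's condition: if [x <= y] and
    [x_i = y_i] then [f_i x <= f_i y].  Hence a solution starting above a curve
    [b] with [b' << f b] stays above it.  At an equilibrium whose Jacobian has a
    positive eigenvector [w] with positive eigenvalue, the points [p + th w]
    with [th > 0] small are such barriers; at an attracting equilibrium, since a
    stable Metzler matrix [A] admits [w >> 0] with [A w << 0], so are the points
    [q - th w].  Say [q << p].  For large [r] the parameter moves from near
    [lambda_-] to near [lambda_+] before the solution has left a neighbourhood
    of [q_- >> p_+], and afterwards the solution remains above [p_+ + th w], so
    it cannot tend to [q_+ << p_+].  For part (1), follow [Lambda] slowly up to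
    time [u], jump quickly to [Lambda(v)], and follow [Lambda] slowly again: the
    solution is above [q] up to a small error before the jump, hence above [p]
    after it, and then stays above [p] for good.  The case [p << q] follows by
    [x |-> -x].  The pullback attractor is the limit of the solutions starting
    at [q_-] at the times [-k], which contract exponentially in the norm
    weighted by [w]. *)

(** * Real derivatives and comparison *)

(** Order preservation is assumed only for frozen parameters, whereas every comparison takes place
    while the parameter moves; this is why it is first turned into a pointwise inequality. The
    vectors [w] are given separately at each point of a path and need not depend continuously on it.
    A barrier is therefore used only near one point, and what is carried along the path is stated
    without [w], through constant margins ([tracks_below], [stays_above]), and propagated over
    compact intervals by connectedness. The margins differ in kind: attraction to [q] brings the
    error below any prescribed bound, while repulsion from [p] lets any positive margin grow back to
    a fixed size. In the time [s] of the parameter the equation reads [y' = N f(y, L s)] with [N]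
    the inverse of the rate, so slow passage means large [N]. The barrier arguments use derivatives
    of [f] only through the difference inequalities [contracting] and [expanding], which carry over
    directly to [- x]. *)

Lemma near_ball_real (R : realType) (t : R) (P : R -> Prop) :
  (\forall s \near t, P s) <->
  (exists2 d : R, 0 < d & forall s, `|s - t| < d -> P s).
Proof.
split=> [/nbhs_ballP[d d0 H]|[d d0 H]];
  first by exists d => // s st; apply: H; rewrite -ball_normE/= distrC.
by apply/nbhs_ballP; exists d => // s; rewrite -ball_normE/= distrC => /H.
Qed.

Lemma is_derive_epsP (R : realType) (x : R -> R) (t d : R) :
  is_derive t (1 : R) x d <->
  (forall e : R, 0 < e -> exists2 r : R, 0 < r &
     forall h, `|h| < r -> `|x (t + h) - x t - h * d| <= e * `|h|).
Proof.
have E h : (x \o shift t) (h *: (1 : R)) - x t = x (t + h) - x t.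
  by rewrite /= /GRing.scale /= mulr1 [h + t]addrC.
split.
- move=> [] /cvg_ex[/= l Hl] dE.
  have ld : l = d by rewrite -dE; apply/esym/cvg_lim.
  move=> e e0; move/cvgrPdist_le : Hl => /(_ _ e0) /nbhs_ballP[r /= r0 H].
  exists r => // h hr; have [->|h0] := eqVneq h 0.
    by rewrite addr0 subrr mul0r subrr normr0 mulr0.
  have := H h; rewrite -ball_normE /= sub0r normrN => /(_ hr h0).
  rewrite E ld distrC => H1.
  have -> : x (t + h) - x t - h * d = h * (h^-1 *: (x (t + h) - x t) - d).
    by rewrite mulrBr /GRing.scale /= mulVKf.
  by rewrite normrM mulrC ler_wpM2r.
- move=> H; suff Hl : h^-1 *: ((x \o shift t) (h *: (1 : R)) - x t) @[h --> 0^'] --> d.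
    split; first by apply/cvg_ex; exists d.
    exact/cvg_lim.
  apply/cvgrPdist_le => e e0; have [r r0 Hr] := H e e0.
  apply/nbhs_ballP; exists r => //= h; rewrite -ball_normE /= sub0r normrN => hr h0.
  have := Hr h hr; rewrite E => H1.
  rewrite distrC.
  have -> : h^-1 *: (x (t + h) - x t) - d = h^-1 * (x (t + h) - x t - h * d).
    by rewrite mulrBr /GRing.scale /= mulKf.
  by rewrite normrM normfV mulrC ler_pdivrMr ?normr_gt0.
Qed.

Lemma is_derive_rowP (R : realType) (n : nat) (x : R -> 'rV[R]_n) (t : R)
    (v : 'rV[R]_n) :
  is_derive t (1 : R) x v <->
  forall i, is_derive t (1 : R) (fun s => x s 0 i) (v 0 i).
Proof.
split=> [[dx dE] i|H].
  have /(derivable_mxP x t 1)/(_ 0 i) di := dx.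
  by split=> //; rewrite -dE derive_mx// mxE.
have dx : derivable x t 1.
  by apply/derivable_mxP => i j; rewrite (ord1 i); have [] := H j.
split=> //; rewrite derive_mx//; apply/rowP => j.
by rewrite mxE; have [] := H j.
Qed.

Lemma is_derive_cont (R : realType) (V : normedModType R) (x : R -> V) (t : R)
    (v : V) :
  is_derive t (1 : R) x v -> {for t, continuous x}.
Proof. by move=> [/derivable1_diffP /differentiable_continuous]. Qed.

Lemma mvt_closed (R : realType) (f g : R -> R) (a b : R) : a <= b ->
  (forall s, a <= s <= b -> is_derive s (1 : R) f (g s)) ->
  exists2 c, a <= c <= b & f b - f a = g c * (b - a).
Proof.
move=> ab H; have [||c] := @MVT_segment _ f g a b ab.
- move=> s; rewrite in_itv/= => /andP[sa sb]; apply: H; lra.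
- apply: continuous_in_subspaceT => s /set_mem; rewrite /= in_itv/= => sab.
  exact: is_derive_cont (H s sab).
by rewrite in_itv/= => cab E; exists c.
Qed.

(* The touching condition is only tested at the first time one of the
   [phi i] vanishes, so all the [phi j] may be assumed nonnegative there. *)
Lemma stays_positive (R : realType) (I : finType) (phi dphi : I -> R -> R)
    (a b : R) :
  (forall i s, a <= s <= b -> is_derive s (1 : R) (phi i) (dphi i s)) ->
  (forall i, 0 < phi i a) ->
  (forall i s, a < s <= b -> (forall j, 0 <= phi j s) -> phi i s = 0 ->
     0 < dphi i s) ->
  forall s, a <= s <= b -> forall i, 0 < phi i s.
Proof.
move=> D pa T; apply: contrapT => /existsNP[s1 /not_implyP[s1ab /existsNP[i1 /negP]]].
rewrite -leNgt => phi1.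
pose S := [set s | a <= s <= b /\ exists i, phi i s <= 0].
have S1 : S s1 by split=> //; exists i1.
have infS : has_inf S.
  by split; [exists s1|exists a => s [/andP[]]].
pose t := inf S.
have at_ : a <= t by apply: lb_le_inf; [exists s1|move=> s [/andP[]]].
have tb : t <= b by rewrite (le_trans (ge_inf infS.2 S1))//; case/andP: s1ab.
have tab : a <= t <= b by rewrite at_.
have pos s i : a <= s < t -> 0 < phi i s.
  move=> /andP[as_ st]; rewrite ltNge; apply/negP => le0.
  have : S s by split; [rewrite as_ /=; lra|exists i].
  by move/(ge_inf infS.2); rewrite leNgt st.
have [i phit] : exists i, phi i t <= 0.
  apply: contrapT => /forallNP N.
  have : \forall s \near t, forall i, 0 < phi i s.
    apply: (@filter_forall R I (fun i s => 0 < phi i s) (nbhs t)) => i.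
    have p0 : 0 < phi i t by rewrite ltNge; apply/negP.
    by have /cvgr_gt/(_ _ p0) := is_derive_cont (D i t tab).
  move=> /near_ball_real[d d0 Hd].
  have [s [sab [i si]] std] := inf_adherent d0 infS.
  have ts : t <= s by apply: (ge_inf infS.2); split=> //; exists i.
  have : 0 < phi i s by apply: Hd; rewrite ger0_norm ?subr_ge0// ltrBlDr addrC.
  by rewrite ltNge si.
have alt : a < t.
  rewrite lt_neqAle at_ andbT; apply/eqP => aE; move: phit; rewrite -aE leNgt.
  by rewrite pa.
have nn j : 0 <= phi j t.
  rewrite leNgt; apply/negP => neg.
  have /cvgr_lt/(_ _ neg)/near_ball_real[d d0 Hd] := is_derive_cont (D j t tab).
  pose s := Num.max a (t - d / 2).
  have sa : a <= s by rewrite /s le_max lexx.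
  have st : s < t by rewrite /s gt_max alt/=; lra.
  have sd : t - d / 2 <= s by rewrite /s le_max lexx orbT.
  have : phi j s < 0 by apply: Hd; rewrite ltr_norml; lra.
  by rewrite ltNge ltW// pos// sa.
have phi0 : phi i t = 0 by apply/eqP; rewrite eq_le phit nn.
have d0 := T i t (introT andP (conj alt tb)) nn phi0.
(* With an error of at most half the slope, [phi i (t - h) <= - h * dphi i t / 2 < 0], against
   positivity before [t]. *)
have /is_derive_epsP/(_ _ (divr_gt0 d0 (ltr0Sn _ 1)))[r r0 Hr] := D i t tab.
pose h := Num.min (r / 2) (t - a).
have h0 : 0 < h by rewrite /h lt_min; apply/andP; split; lra.
have hr : h <= r / 2 by rewrite /h ge_min lexx.
have hta : h <= t - a by rewrite /h ge_min lexx orbT.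
have := Hr (- h); rewrite normrN gtr0_norm// phi0 subr0 => Hh.
have {Hh} : `|phi i (t - h) - - h * dphi i t| <= dphi i t / 2 * h by apply: Hh; lra.
have : 0 < phi i (t - h) by apply: pos; lra.
move: (dphi i t) d0 h0 => d d0 h0 ph; apply/negP; rewrite -ltNge ltr_normr.
have dh : 0 < d * h by rewrite mulr_gt0.
apply/orP; left; lra.
Qed.

(* Connectedness of [a, b] in the form used to propagate bounds along a path. *)
Lemma propagation (R : realType) (P : R -> Prop) (a b : R) : a <= b -> P a ->
  (forall s, a <= s <= b -> exists2 r, 0 < r &
     forall s1 s2, a <= s1 -> s1 < s2 -> s2 <= b -> `|s1 - s| < r ->
       `|s2 - s| < r -> P s1 -> P s2) ->
  P b.
Proof.
move=> ab Pa H; pose S := [set s | a <= s <= b /\ P s].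
have Sa : S a by split=> //; rewrite lexx.
have supS : has_sup S by split; [exists a|exists b => s [/andP[]]].
pose t := sup S.
have ta : a <= t by apply: (ub_le_sup supS.2).
have tb : t <= b by apply: ge_sup; [exists a|move=> s [/andP[]]].
have [r r0 Hr] := H t (introT andP (conj ta tb)).
have [s1 [/andP[as1 s1b] Ps1] ts1] := sup_adherent r0 supS.
have s1t : s1 <= t by apply: (ub_le_sup supS.2); split=> //; rewrite as1.
move: (s1b); rewrite le_eqVlt => /orP[/eqP<-//|s1b'].
pose s2 := Num.min b (t + r / 2).
have s2b : s2 <= b by rewrite /s2 ge_min lexx.
have s2t : s2 <= t + r / 2 by rewrite /s2 ge_min lexx orbT.
have s12 : s1 < s2 by rewrite /s2 lt_min s1b'/=; lra.
have ts2 : t <= s2 by rewrite /s2 le_min tb/=; lra.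
have P2 : P s2.
  have ts1' : t - r < s1 := ts1.
  by apply: (Hr s1 s2) => //; rewrite ltr_norml; lra.
have S2 : S s2 by split=> //; rewrite s2b; lra.
have s2t' : s2 <= t by apply: (ub_le_sup supS.2).
have -> : b = s2; last by [].
move: s2t'; rewrite {1}/s2 ge_min => /orP[bt|]; last by lra.
by rewrite /s2; apply/esym/min_idPl; lra.
Qed.

(** The intervals of radius [r k] around [u k] pairwise intersect, so the supremum of their lower
    ends lies in all of them; the limit comes with the explicit error [r k] at every index. *)
Lemma nested_limit (R : realType) (u r : nat -> R) (k0 : nat) :
  (forall k m, (k0 <= k)%N -> (k <= m)%N -> `|u k - u m| <= r k) ->
  exists l, forall k, (k0 <= k)%N -> `|l - u k| <= r k.
Proof.
move=> H; pose S := [set x | exists2 k, (k0 <= k)%N & x = u k - r k].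
have ub k : (k0 <= k)%N -> ubound S (u k + r k).
  move=> k0k x [j k0j ->]; have [kj|/ltnW jk] := leqP k j.
    have := H k j k0k kj; have := H j j k0j (leqnn _).
    by rewrite subrr normr0 !ler_norml; lra.
  have := H j k k0j jk; have := H k k k0k (leqnn _).
  by rewrite subrr normr0 !ler_norml; lra.
have hs : has_sup S by split; [exists (u k0 - r k0), k0|exists (u k0 + r k0); exact: ub].
exists (sup S) => k k0k.
have lo : u k - r k <= sup S by apply: (ub_le_sup hs.2); exists k.
have hi : sup S <= u k + r k by apply: ge_sup; [exact: hs.1|exact: ub].
by rewrite ler_norml; lra.
Qed.

Lemma finite_pos_lower_bound (R : realType) (I : finType) (z : I -> R) :
  (forall i, 0 < z i) -> exists2 g, 0 < g & forall i, g < z i.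
Proof.
move=> H; have : \forall g \near (0 : R)^'+, forall i, g < z i.
  apply: (@filter_forall R I (fun i g => g < z i) (0 : R)^'+) => i.
  exact: nbhs_right_lt.
move=> Hg; have : \forall g \near (0 : R)^'+, 0 < g /\ forall i, g < z i.
  by near=> g; split; near: g => //; exact: nbhs_right_gt.
by move=> /filter_ex[g [g0 gz]]; exists g.
Unshelve. all: by end_near. Qed.

Lemma finite_upper_bound (R : realType) (I : finType) (z : I -> R) :
  exists2 g, 0 < g & forall i, z i < g.
Proof.
exists (\sum_i `|z i| + 1) => [|i].
  by rewrite ltr_wpDl// sumr_ge0.
rewrite (bigD1 i)//= (le_lt_trans (ler_norm _))// -addrA ltrDl ltr_wpDl//.
by rewrite sumr_ge0.
Qed.

(** * Existence of solutions *)

Lemma derive_zero_eq (R : realType) (f : R -> R) (a b : R) : a <= b ->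
  (forall s, a <= s <= b -> is_derive s (1 : R) f 0) -> f b = f a.
Proof.
move=> ab H; have [c _ /eqP] := mvt_closed ab (g := fun=> 0) H.
by rewrite mul0r subr_eq0 => /eqP.
Qed.

Lemma antiderivative_on_interval (R : realType) (g : R -> R) (N : nat) :
  continuous g ->
  exists2 G : R -> R, G 0 = 0 &
    forall t, `|t| < N.+1%:R -> is_derive t (1 : R) G (g t).
Proof.
move=> cg; pose a : R := - N.+1%:R; pose b : R := N.+1%:R.
pose F x := (\int[lebesgue_measure]_(t in [set` `[a, x]]) (g t))%R : R.
have F' t : `|t| < N.+1%:R -> is_derive t (1 : R) F (g t).
  rewrite ltr_norml => /andP[at_ tb].
  have ig : lebesgue_measure.-integrable `[a, b] (EFin \o g).
    apply: continuous_compact_integrable; first exact: segment_compact.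
    exact: continuous_subspaceT.
  have [dF E] := continuous_FTC1_closed tb ig at_ (cg t).
  by split=> //; rewrite -derive1E.
exists (fun x => F x - F 0) => [|t tN]; first by rewrite subrr.
have := F' t tN => H.
by apply: is_derive_eq; rewrite subr0.
Qed.

(** The antiderivatives on growing intervals all vanish at 0, hence agree on overlaps and glue to
    one function on the line. *)
Lemma antiderivative_exists (R : realType) (g : R -> R) :
  continuous g ->
  exists G : R -> R, forall t, is_derive t (1 : R) G (g t).
Proof.
move=> cg.
have /choice[G HG] : forall N, exists G : R -> R, G 0 = 0 /\
    forall t, `|t| < N.+1%:R -> is_derive t (1 : R) G (g t).
  by move=> N; have [G G0 G'] := antiderivative_on_interval N cg; exists G.
have agree N M t : `|t| < N.+1%:R -> `|t| < M.+1%:R -> G N t = G M t.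
  move=> tN tM.
  have D s : `|s| <= `|t| -> is_derive s (1 : R) (fun x => G N x - G M x) 0.
    move=> st; have H1 := (HG N).2 s (le_lt_trans st tN).
    have H2 := (HG M).2 s (le_lt_trans st tM).
    by apply: is_derive_eq; rewrite subrr.
  apply/eqP; rewrite -subr_eq0; apply/eqP.
  have E0 : G N 0 - G M 0 = 0 by rewrite (HG N).1 (HG M).1 subrr.
  rewrite -[RHS]E0; have [t0|t0] := leP 0 t.
    apply: (derive_zero_eq (f := fun x => G N x - G M x) t0) => s s0t.
    by apply: D; rewrite !ger0_norm//; lra.
  apply/esym/(derive_zero_eq (f := fun x => G N x - G M x) (ltW t0)) => s s0t.
  by apply: D; rewrite !ler0_norm//; lra.
have tr (t : R) : `|t| < (Num.trunc `|t|).+1%:R by apply: truncnS_gt.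
exists (fun t => G (Num.trunc `|t|) t) => t.
pose N := (Num.trunc `|t|).+1.
have tN : `|t| < N%:R := tr t.
have tN1 : `|t| < N.+1%:R by rewrite (lt_trans tN)// ltr_nat.
have H := (HG N).2 t tN1.
apply: (near_eq_is_derive _ H).
apply/near_ball_real; exists 1 => // s s1; apply: agree => //.
have := ler_normD (s - t) t; rewrite subrK -natr1 => H1; lra.
Qed.

(** The mean value theorem for [z k] turns closeness of the derivatives into a bound on its
    increment around [t], which passes to [x] in the limit. *)
Lemma derive_limit (R : realType) (z g : nat -> R -> R) (rho : nat -> R)
    (x G : R -> R) (k0 : nat) (a b t : R) :
  a < t < b ->
  (forall k s, (k0 <= k)%N -> a < s < b -> is_derive s (1 : R) (z k) (g k s)) ->
  (forall k s, (k0 <= k)%N -> a < s < b -> `|z k s - x s| <= rho k) ->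
  (forall k s, (k0 <= k)%N -> a < s < b -> `|g k s - G s| <= rho k) ->
  (forall e, 0 < e -> exists2 k, (k0 <= k)%N & rho k < e) ->
  {for t, continuous G} ->
  is_derive t (1 : R) x (G t).
Proof.
move=> tab dz zx gG rho0 cG; apply/is_derive_epsP => e e0.
have e20 : 0 < e / 2 by lra.
move/cvgrPdist_lt : cG => /(_ _ e20)/near_ball_real[d d0 Hd].
pose r := Num.min d (Num.min (t - a) (b - t)).
have r0 : 0 < r by rewrite /r !lt_min; apply/and3P; split; lra.
exists r => // h hr.
have [hd [hta htb]] : `|h| < d /\ `|h| < t - a /\ `|h| < b - t.
  by move: hr; rewrite /r !lt_min => /and3P[].
have bnd k : (k0 <= k)%N ->
    `|z k (t + h) - z k t - h * G t| <= `|h| * (rho k + e / 2).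
  move=> k0k.
  have near_t c : `|c - t| <= `|h| -> a < c < b /\ `|g k c - G t| <= rho k + e / 2.
    move=> ch; have cab : a < c < b by move: ch hta htb; rewrite ler_norml => *; lra.
    split=> //; rewrite -(subrKA (G c)) (le_trans (ler_normD _ _))//.
    rewrite lerD// ?gG//; apply/ltW; rewrite distrC; apply: Hd.
    exact: le_lt_trans ch hd.
  have [c ch E] : exists2 c, `|c - t| <= `|h| & z k (t + h) - z k t = g k c * h.
    have [h0|h0] := leP 0 h.
      have [|s s_in|c cth E] := @mvt_closed R (z k) (g k) t (t + h).
      - by lra.
      - apply: dz => //; apply: (near_t s _).1; rewrite !ger0_norm; lra.
      exists c; first by rewrite !ger0_norm; lra.
      by rewrite E; congr (_ * _); lra.
    have [|s s_in|c cth E] := @mvt_closed R (z k) (g k) (t + h) t.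
    - by lra.
    - apply: dz => //; apply: (near_t s _).1; rewrite !ler0_norm; lra.
    exists c; first by rewrite !ler0_norm; lra.
    by rewrite -[LHS]opprB E; lra.
  rewrite E mulrC -mulrBr normrM ler_wpM2l//.
  exact: (near_t c ch).2.
apply/ler_addgt0Pr => eps eps0.
pose e1 := Num.min (e / 2) (eps / 2).
have e10 : 0 < e1 by rewrite /e1 lt_min; apply/andP; split; lra.
have [k k0k rk] := rho0 _ e10.
have [rk1 rk2] : rho k < e / 2 /\ rho k < eps / 2.
  by move: rk; rewrite /e1 lt_min => /andP.
have th : a < t + h < b by move: hta htb; rewrite !ltr_norml => *; lra.
have A : `|h| * (rho k + e / 2) <= e * `|h| by rewrite mulrC ler_wpM2r//; lra.
have := le_trans (bnd k k0k) A.
have := zx k (t + h) k0k th; have := zx k t k0k tab.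
by rewrite !ler_norml => *; lra.
Qed.

Lemma coord_le_norm (R : realType) (n : nat) (x : 'rV[R]_n) (i : 'I_n) :
  `|x 0 i| <= `|x|.
Proof.
rewrite [leRHS]/Num.Def.normr/= mx_normrE.
exact: (le_bigmax _ (fun k : 'I_1 * 'I_n => `|x k.1 k.2|) (0, i)).
Qed.

Lemma norm_le_coord (R : realType) (n : nat) (x : 'rV[R]_n) (e : R) :
  0 <= e -> (forall i, `|x 0 i| <= e) -> `|x| <= e.
Proof.
move=> e0 H; rewrite /Num.Def.normr/= mx_normrE; apply: bigmax_le => // -[j i] _.
by rewrite /= (ord1 j).
Qed.

Lemma coord_cont (R : realType) (n : nat) (T : topologicalType)
    (x : T -> 'rV[R]_n) (t : T) (i : 'I_n) :
  {for t, continuous x} -> {for t, continuous (fun s => x s 0 i)}.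
Proof.
by move=> cx; exact: (continuous_comp cx (@coord_continuous R 1 n 0 i (x t))).
Qed.

Lemma limit_continuous (R : realType) (V : normedModType R)
    (z : nat -> R -> V) (rho : nat -> R) (x : R -> V) (k0 : nat) (a b t : R) :
  a < t < b ->
  (forall k s, (k0 <= k)%N -> a < s < b -> `|z k s - x s| <= rho k) ->
  (forall e, 0 < e -> exists2 k, (k0 <= k)%N & rho k < e) ->
  (forall k, (k0 <= k)%N -> {for t, continuous (z k)}) ->
  {for t, continuous x}.
Proof.
move=> tab zx rho0 cz; apply/cvgrPdist_lt => e e0.
have e30 : 0 < e / 3 by lra.
have [k k0k rk] := rho0 _ e30.
have /cvgrPdist_lt/(_ _ e30)/near_ball_real[d d0 Hd] := cz k k0k.
apply/near_ball_real; exists (Num.min d (Num.min (t - a) (b - t))).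
  by rewrite !lt_min; apply/and3P; split; lra.
move=> s; rewrite !lt_min => /and3P[sd sa sb].
have sab : a < s < b by move: sa sb; rewrite !ltr_norml => *; lra.
rewrite -(subrKA (z k t)) (le_lt_trans (ler_normD _ _))//.
have H1 := zx k t k0k tab; have H2 := zx k s k0k sab; have H3 := Hd s sd.
have H4 : `|z k t - x s| <= `|z k t - z k s| + `|z k s - x s|.
  by rewrite -[z k t - x s](subrKA (z k s)) ler_normD.
rewrite distrC in H1; lra.
Qed.

(** Both [G - f] and [G + f] are nondecreasing and vanish at [t0]. The absolute value of [G] covers
    both sides of [t0]. *)
Lemma growth_bound (R : realType) (f df G dG : R -> R) (t0 t : R) :
  (forall s, is_derive s (1 : R) f (df s)) ->
  (forall s, is_derive s (1 : R) G (dG s)) ->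
  (forall s, `|df s| <= dG s) -> f t0 = 0 -> G t0 = 0 -> `|f t| <= `|G t|.
Proof.
move=> Df DG H f0 G0.
have Dm s : is_derive s (1 : R) (fun s => G s - f s) (dG s - df s).
  by have := Df s; have := DG s => ? ?; apply: is_derive_eq.
have Dp s : is_derive s (1 : R) (fun s => G s + f s) (dG s + df s).
  by have := Df s; have := DG s => ? ?; apply: is_derive_eq.
have Hs s : 0 <= dG s - df s /\ 0 <= dG s + df s.
  by have := H s; rewrite ler_norml => *; split; lra.
have [tt|/ltW tt] := leP t0 t.
  have [c _] := mvt_closed tt (fun s _ => Dm s).
  have [d _] := mvt_closed tt (fun s _ => Dp s).
  have [_ h2] := Hs d; have [h1 _] := Hs c.
  have tt0 : 0 <= t - t0 by lra.
  have := mulr_ge0 h1 tt0; have := mulr_ge0 h2 tt0.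
  rewrite f0 G0 => *; rewrite ler_norml (_ : `|G t| = G t) ?ger0_norm; lra.
have [c _] := mvt_closed tt (fun s _ => Dm s).
have [d _] := mvt_closed tt (fun s _ => Dp s).
have [_ h2] := Hs d; have [h1 _] := Hs c.
have tt0 : 0 <= t0 - t by lra.
have := mulr_ge0 h1 tt0; have := mulr_ge0 h2 tt0.
rewrite f0 G0 => *; rewrite ler_norml (_ : `|G t| = - G t) ?ler0_norm; lra.
Qed.

Lemma half_pow_small (R : realType) (B e : R) (k0 : nat) : 0 < e ->
  exists2 k, (k0 <= k)%N & B / 2 ^+ k < e.
Proof.
move=> e0; pose k := maxn k0 (Num.trunc (`|B| / e)).+1.
exists k; first by rewrite leq_maxl.
have p0 : 0 < (2 : R) ^+ k by rewrite exprn_gt0.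
rewrite ltr_pdivrMr// (le_lt_trans (ler_norm _))// mulrC -ltr_pdivrMr//.
have kb : `|B| / e < k%:R.
  by rewrite (lt_le_trans (truncnS_gt _))// ler_nat leq_maxr.
by rewrite (lt_trans kb)// -natrX ltr_nat ltn_expl.
Qed.

Lemma antiderivative_row (R : realType) (n : nat) (g : R -> 'rV[R]_n)
    (t0 : R) (x0 : 'rV[R]_n) : continuous g ->
  exists x : R -> 'rV[R]_n, x t0 = x0 /\ forall t, is_derive t (1 : R) x (g t).
Proof.
move=> cg.
have [G HG] := choice (fun i => antiderivative_exists (fun t => coord_cont (i := i) (cg t))).
exists (fun t => \row_i (G i t - G i t0 + x0 0 i)); split.
  by apply/rowP => i; rewrite !mxE subrr add0r.
move=> t; apply/is_derive_rowP => i.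
under eq_fun do rewrite mxE.
by have := HG i t => H; apply: is_derive_eq; rewrite subr0 addr0.
Qed.

(* With the weight [E = 2 cosh (2 K (s - t0))] one Picard step of a [K]-Lipschitz
   field halves distances, on the whole real line. *)
Lemma cosh_sinh_weights (R : realType) (K t0 : R) : 0 < K ->
  exists S E : R -> R,
  [/\ forall s, is_derive s (1 : R) S (K * E s), S t0 = 0,
      forall s, `|S s| <= E s / 2,
      forall s, K * `|s - t0| <= E s &
      continuous E].
Proof.
move=> K0; pose u s := expR (2 * K * (s - t0)); pose v s := expR (- (2 * K * (s - t0))).
have du s : is_derive s (1 : R) u (2 * K * u s).
  apply: (is_derive_eq (is_derive1_comp _ _)).
  by rewrite /GRing.scale /= subr0 mulr1 mulrC.
have dv s : is_derive s (1 : R) v (- (2 * K * v s)).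
  apply: (is_derive_eq (is_derive1_comp _ _)).
  by rewrite /GRing.scale /= subr0 mulr1 mulrC mulNr.
exists (fun s => (u s - v s) / 2), (fun s => u s + v s); split.
- move=> s; have := du s; have := dv s => H1 H2.
  apply: is_derive_eq; rewrite /GRing.scale /=; lra.
- by rewrite /u /v subrr mulr0 oppr0 subrr mul0r.
- move=> s; have : 0 < u s by exact: expR_gt0.
  have : 0 < v s by exact: expR_gt0.
  by rewrite ler_norml => *; lra.
- move=> s; have := expR_ge1Dx (2 * K * (s - t0)); have := expR_ge1Dx (- (2 * K * (s - t0))).
  have : 0 < u s by exact: expR_gt0.
  have : 0 < v s by exact: expR_gt0.
  rewrite -/(u s) -/(v s) => v0 u0 h1 h2.
  have [st|st] := leP 0 (s - t0).
    have := mulr_ge0 (ltW K0) st; rewrite ger0_norm//; lra.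
  have := mulr_gt0 K0 (_ : 0 < t0 - s); rewrite ltr0_norm//.
  rewrite !mulrBr; lra.
- move=> s; apply: cvgD; exact: is_derive_cont.
Qed.

(** Picard iteration on the whole line, convergent in a weighted norm that halves distances at each
    step. Continuity of [F] is asked along continuous curves, the form needed to integrate the
    iterates. *)
Lemma picard_lindelof (R : realType) (n : nat) (F : R -> 'rV[R]_n -> 'rV[R]_n)
    (K M t0 : R) (x0 : 'rV[R]_n) : 0 < K ->
  (forall x : R -> 'rV[R]_n, continuous x -> continuous (fun t => F t (x t))) ->
  (forall t x y, `|F t x - F t y| <= K * `|x - y|) ->
  (forall t x, `|F t x| <= M) ->
  exists x : R -> 'rV[R]_n, x t0 = x0 /\ forall t, is_derive t (1 : R) x (F t (x t)).
Proof.
move=> K0 Fc FL FM.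
have M0 : 0 <= M := le_trans (normr_ge0 _) (FM t0 x0).
have /choice[Phi HPhi] : forall x : R -> 'rV[R]_n, exists y : R -> 'rV[R]_n,
    continuous x -> y t0 = x0 /\ forall t, is_derive t (1 : R) y (F t (x t)).
  move=> x; have [cx|ncx] := pselect (continuous x); last by exists x.
  by have [y Hy] := antiderivative_row t0 x0 (Fc x cx); exists y.
pose X k := iter k Phi (cst x0).
have cX k : continuous (X k).
  elim: k => [|k IH]; first by move=> t; exact: cvg_cst.
  by move=> t; exact: is_derive_cont ((HPhi _ IH).2 t).
have X0 k : X k t0 = x0 by case: k => [//|k]; exact: (HPhi _ (cX k)).1.
have X' k t : is_derive t (1 : R) (X k.+1) (F t (X k t)).
  exact: (HPhi _ (cX k)).2.
have [S [E [S' S0 SE Eb cE]]] := cosh_sinh_weights t0 K0.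
have E0 s : 0 <= E s by apply: le_trans (Eb s); rewrite mulr_ge0// ltW.
(* From the first step: [|X 1 t - x0| <= M * |t - t0|], and the weight satisfies
   [K * |t - t0| <= E t]. *)
pose C := M / K.
have C0 : 0 <= C by rewrite divr_ge0// ltW.
have step k t : `|X k.+1 t - X k t| <= C / 2 ^+ k * E t.
  elim: k t => [t|k IH t].
    rewrite expr0 divr1; apply: norm_le_coord => [|i]; first by rewrite mulr_ge0.
    have D s : is_derive s (1 : R) (fun s => X 1%N s 0 i - x0 0 i) (F s x0 0 i).
      have /is_derive_rowP/(_ i) H := X' 0%N s.
      by apply: is_derive_eq; rewrite subr0.
    have DM s : is_derive s (1 : R) (fun s => M * (s - t0)) M.
      by apply: is_derive_eq; rewrite /GRing.scale /= oppr0 addr0 mulr1.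
    have H1 : `|X 1%N t 0 i - x0 0 i| <= `|M * (t - t0)|.
      apply: (growth_bound (t0 := t0) t D DM); rewrite ?X0 ?subrr ?mulr0//.
      by move=> s; exact: le_trans (coord_le_norm _ _) (FM _ _).
    rewrite !mxE; apply: le_trans H1 _.
    rewrite normrM (ger0_norm M0) -[M](@divfK _ K) ?gt_eqF// -/C -mulrA ler_wpM2l//.
  have CE s : 0 <= C / 2 ^+ k * E s by rewrite mulr_ge0// divr_ge0// exprn_ge0.
  apply: norm_le_coord => [|i]; first by rewrite mulr_ge0// divr_ge0// exprn_ge0.
  have D s : is_derive s (1 : R) (fun s => (X k.+2 s - X k.+1 s) 0 i)
      ((F s (X k.+1 s) - F s (X k s)) 0 i).
    have /is_derive_rowP/(_ i) := X' k.+1 s.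
    have /is_derive_rowP/(_ i) := X' k s.
    move=> H1 H2; under eq_fun do rewrite !mxE.
    by apply: is_derive_eq; rewrite !mxE.
  have DS s : is_derive s (1 : R) (fun s => C / 2 ^+ k * S s) (C / 2 ^+ k * (K * E s)).
    by have := S' s => H; apply: is_derive_eq.
  have H1 : `|(X k.+2 t - X k.+1 t) 0 i| <= `|C / 2 ^+ k * S t|.
    apply: (growth_bound (t0 := t0) t D DS); rewrite ?mxE ?X0 ?subrr ?S0 ?mulr0// => s.
    apply: le_trans (coord_le_norm _ _) _; apply: le_trans (FL _ _ _) _.
    by rewrite mulrCA ler_wpM2l// ltW.
  apply: le_trans H1 _; rewrite normrM ger0_norm; last by rewrite divr_ge0// exprn_ge0.
  have p : (2 : R) ^+ k != 0 by rewrite expf_neq0.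
  have -> : C / 2 ^+ k.+1 * E t = C / 2 ^+ k * (E t / 2) by rewrite exprS; field; rewrite p.
  by rewrite ler_wpM2l// divr_ge0// exprn_ge0.
(* The geometric series of the steps from [k] on sums to [2 * C * E t / 2 ^ k]. *)
pose D t := 2 * C * E t.
have D0 t : 0 <= D t by rewrite /D mulr_ge0// mulr_ge0.
have tele k m t : (k <= m)%N -> `|X k t - X m t| <= D t / 2 ^+ k - D t / 2 ^+ m.
  elim: m => [|m IH]; first by rewrite leqn0 => /eqP->; rewrite !subrr normr0.
  rewrite leq_eqVlt => /orP[/eqP->|]; first by rewrite !subrr normr0.
  rewrite ltnS => /IH H; rewrite -(subrKA (X m t)) (le_trans (ler_normD _ _))//.
  have H2 := step m t; rewrite distrC in H2.
  have -> : D t / 2 ^+ m.+1 = D t / 2 ^+ m - C / 2 ^+ m * E t.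
    have p : (2 : R) ^+ m != 0 by rewrite expf_neq0.
    by rewrite exprS /D; field; rewrite p.
  by have := lerD H H2; lra.
have dist k m t : (k <= m)%N -> `|X k t - X m t| <= D t / 2 ^+ k.
  by move=> km; rewrite (le_trans (tele _ _ _ km))// gerBl divr_ge0// exprn_ge0.
have /choice[x Hx] : forall t, exists x : 'rV[R]_n, forall k, `|X k t - x| <= D t / 2 ^+ k.
  move=> t.
  have /choice[x Hx] : forall i, exists l, forall k, (0 <= k)%N ->
      `|l - X k t 0 i| <= D t / 2 ^+ k.
    move=> i; apply: nested_limit => k m _ km.
    have := dist k m t km; apply: le_trans; apply: le_trans (coord_le_norm _ i).
    by rewrite !mxE.
  exists (\row_i x i) => k; apply: norm_le_coord => [|i].
    by rewrite divr_ge0// exprn_ge0.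
  by rewrite !mxE distrC; exact: Hx.
have cD : continuous D by move=> t; apply: cvgM; [exact: cvg_cst|exact: cE].
have loc t : exists2 B, 0 < B & exists2 d : R, 0 < d & forall s, t - d < s < t + d -> D s <= B.
  exists (D t + 1); first by rewrite ltr_wpDl.
  have /cvgrPdist_lt/(_ _ ltr01)/near_ball_real[d d0 Hd] := cD t.
  exists d => // s std; have := Hd s; rewrite !ltr_norml => /(_ _); lra.
have sub k t B s d : t - d < s < t + d -> (forall s, t - d < s < t + d -> D s <= B) ->
    `|X k s - x s| <= B / 2 ^+ k.
  move=> sd H; apply: le_trans (Hx s k) _.
  by rewrite ler_wpM2r ?invr_ge0 ?exprn_ge0// H.
have cx : continuous x.
  move=> t; have [B B0 [d d0 Hd]] := loc t.
  apply: (limit_continuous (z := X) (rho := fun k => B / 2 ^+ k) (k0 := 0%N)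
    (a := t - d) (b := t + d)).
  - by lra.
  - by move=> k s _ sd; exact: sub sd Hd.
  - by move=> e e0; exact: half_pow_small.
  - by move=> k _; exact: cX.
exists x; split.
  apply/eqP; rewrite eq_sym -subr_eq0 -normr_eq0 eq_le normr_ge0 andbT.
  apply/ler_addgt0Pr => e e0; rewrite add0r.
  have [k _ /ltW] := half_pow_small (D t0) 0%N e0.
  by apply: le_trans; have := Hx t0 k; rewrite X0.
move=> t; apply/is_derive_rowP => i.
have [B B0 [d d0 Hd]] := loc t.
pose B' := (1 + K) * B.
apply: (derive_limit (z := fun k s => X k.+1 s 0 i) (g := fun k s => F s (X k s) 0 i)
  (G := fun s => F s (x s) 0 i) (rho := fun k => B' / 2 ^+ k) (k0 := 0%N)
  (a := t - d) (b := t + d)).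
- by lra.
- by move=> k s _ _; have /is_derive_rowP/(_ i) := X' k s.
- move=> k s _ sd.
  have H1 : `|X k.+1 s 0 i - x s 0 i| <= `|X k.+1 s - x s|.
    by rewrite (le_trans _ (coord_le_norm _ i))// !mxE.
  apply: (le_trans H1); apply: (le_trans (sub k.+1 t B s d sd Hd)).
  have p0 : 0 < (2 : R) ^+ k by rewrite exprn_gt0.
  rewrite exprS invfM mulrA ler_wpM2r ?invr_ge0 ?ltW//.
  rewrite /B'; have := mulr_gt0 K0 B0; rewrite mulrDl; lra.
- move=> k s _ sd.
  have H1 : `|F s (X k s) 0 i - F s (x s) 0 i| <= `|F s (X k s) - F s (x s)|.
    by rewrite (le_trans _ (coord_le_norm _ i))// !mxE.
  apply: (le_trans H1); apply: (le_trans (FL _ _ _)).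
  have := sub k t B s d sd Hd => H2.
  apply: (le_trans (ler_wpM2l (ltW K0) H2)).
  rewrite mulrA ler_wpM2r ?invr_ge0 ?exprn_ge0//.
  by rewrite /B' mulrDl mul1r ler_wpDl// ltW.
- by move=> e e0; exact: half_pow_small.
- by apply: coord_cont; exact: Fc.
Qed.

(** * Differential inequalities from the Jacobian *)

Lemma near_ball_pair (R : realType) (n : nat) (x : 'rV[R]_n) (l : R)
    (P : 'rV[R]_n * R -> Prop) :
  (\forall z \near (x, l), P z) ->
  exists2 d : R, 0 < d &
    forall y m, `|y - x| < d -> `|m - l| < d -> P (y, m).
Proof.
move=> /nbhs_ballP[d /= d0 H]; exists d => // y m yx ml; apply: H.
by split; rewrite -ball_normE /= distrC.
Qed.

Lemma near_ball_row (R : realType) (n : nat) (x : 'rV[R]_n)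
    (P : 'rV[R]_n -> Prop) :
  (\forall z \near x, P z) ->
  exists2 d : R, 0 < d & forall y, `|y - x| < d -> P y.
Proof.
move=> /nbhs_ballP[d /= d0 H]; exists d => // y yx; apply: H.
by rewrite -ball_normE /= distrC.
Qed.

Lemma open_ball_sub (R : realType) (n : nat) (U : set 'rV[R]_n) (x : 'rV[R]_n) :
  open U -> U x -> exists2 d : R, 0 < d & forall y, `|y - x| < d -> U y.
Proof. by move=> oU Ux; apply: near_ball_row; exact: open_nbhs_nbhs. Qed.

Lemma is_derive_along (R : realType) (V W : normedModType R) (f : V -> W)
    (a v : V) (t : R) : derivable f (a + t *: v) v ->
  is_derive t (1 : R) (fun s => f (a + s *: v)) ('D_v f (a + t *: v)).
Proof.
set z := a + t *: v => df; set g := fun s : R => _.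
have E : (fun h : R => h^-1 *: ((g \o shift t) (h *: (1 : R)) - g t)) =
         (fun h : R => h^-1 *: ((f \o shift z) (h *: v) - f z)).
  apply/funext => h; rewrite /g /= /z; congr (_ *: (f _ - _)).
  have -> : h *: (1 : R) = h by rewrite /GRing.scale /= mulr1.
  by rewrite scalerDl addrCA.
by split; rewrite /derivable /derive E.
Qed.

Lemma segment_ball (R : realType) (V : normedModType R) (x y c : V) (d t : R) :
  0 <= t <= 1 -> `|x - c| < d -> `|y - c| < d -> `|x + t *: (y - x) - c| < d.
Proof.
move=> t01 xd yd.
have -> : x + t *: (y - x) - c = (1 - t) *: (x - c) + t *: (y - c).
  have -> : y - x = (y - c) - (x - c) by rewrite opprB addrA subrK.
  by rewrite scalerBr scalerBl scale1r addrAC [_ *: _ - _ *: _]addrC addrA.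
apply: le_lt_trans (ler_normD _ _) _.
have /andP[tge0 tle1] := t01.
have t1ge0 : 0 <= 1 - t by lra.
rewrite !normrZ (ger0_norm tge0) (ger0_norm t1ge0).
have [->|tn0] := eqVneq t 0; first by rewrite subr0 mul1r mul0r addr0.
have t0 : 0 < t by rewrite lt_neqAle eq_sym tn0.
have h1 : t * `|y - c| < t * d by rewrite ltr_pM2l.
have h2 : (1 - t) * `|x - c| <= (1 - t) * d by rewrite ler_wpM2l// ltW.
by lra.
Qed.

Definition C1_field (R : realType) (n : nat) (U : set 'rV[R]_n)
    (f : 'rV[R]_n * R -> 'rV[R]_n) : Prop :=
  forall x l, U x -> differentiable f (x, l) /\
    forall v, {for (x, l), continuous ('D_v f)}.

Lemma Ck2_C1_field (R : realType) (n : nat) (U : set 'rV[R]_n)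
    (f : 'rV[R]_n * R -> 'rV[R]_n) :
  Ck 2 (U `*` [set: R]) f -> C1_field U f.
Proof.
move=> [df D1] x l Ux; split; first exact: df.
by move=> v; have [dv _] := D1 v; apply: differentiable_continuous; exact: dv.
Qed.

Lemma field_continuous (R : realType) (n : nat) (U : set 'rV[R]_n)
    (f : 'rV[R]_n * R -> 'rV[R]_n) x l :
  C1_field U f -> U x -> {for (x, l), continuous f}.
Proof. by move=> C1 /(C1 _ l)[/differentiable_continuous]. Qed.

Lemma field_mvt (R : realType) (n : nat) (U : set 'rV[R]_n)
    (f : 'rV[R]_n * R -> 'rV[R]_n) (c x y : 'rV[R]_n) (d l : R) (i : 'I_n) :
  C1_field U f -> (forall z, `|z - c| < d -> U z) ->
  `|x - c| < d -> `|y - c| < d ->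
  exists2 z, `|z - c| < d &
    f (y, l) 0 i - f (x, l) 0 i = 'd f (z, l) (y - x, 0) 0 i.
Proof.
move=> C1 bU xd yd.
have Us (t : R) : 0 <= t <= 1 -> U (x + t *: (y - x)).
  by move=> t01; apply: bU; exact: segment_ball.
have path t : (x + t *: (y - x), l) = (x, l) + t *: (y - x, 0 : R).
  by congr (_, _); rewrite /= scaler0 addr0.
have D (t : R) : 0 <= t <= 1 -> is_derive t (1 : R)
    (fun t => f (x + t *: (y - x), l) 0 i)
    ('d f (x + t *: (y - x), l) (y - x, 0) 0 i).
  move=> t01; have [df _] := C1 _ l (Us t t01).
  have H : derivable f ((x, l) + t *: (y - x, 0 : R)) (y - x, 0).
    by rewrite -path; exact: diff_derivable.
  have /is_derive_rowP/(_ i) := is_derive_along H.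
  have -> : (fun s => f ((x, l) + s *: (y - x, 0 : R)) 0 i) =
      (fun s => f (x + s *: (y - x), l) 0 i).
    by apply/funext => s; rewrite -path.
  by rewrite -path deriveE.
have [t t01] := mvt_closed ler01 D.
rewrite scale0r addr0 scale1r [x + (y - x)]addrC subrK subr0 mulr1 => E.
by exists (x + t *: (y - x)) => //; exact: segment_ball.
Qed.

(** The integrated form of [w *m dfdx f >> 0] near [(x0, l0)], with [c] a lower bound for the
    coordinates of that row. At an eigenvector the row is [mu *: w]. *)
Definition expanding (R : realType) (n : nat) (f : 'rV[R]_n * R -> 'rV[R]_n)
    (x0 : 'rV[R]_n) (l0 : R) (w : 'rV[R]_n) (c d : R) : Prop :=
  forall x th l i, 0 <= th -> `|x - x0| < d -> `|x + th *: w - x0| < d ->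
    `|l - l0| < d -> f (x, l) 0 i + c * th <= f (x + th *: w, l) 0 i.

Definition contracting (R : realType) (n : nat) (f : 'rV[R]_n * R -> 'rV[R]_n)
    (x0 : 'rV[R]_n) (l0 : R) (w : 'rV[R]_n) (c d : R) : Prop :=
  forall x th l i, 0 <= th -> `|x - x0| < d -> `|x + th *: w - x0| < d ->
    `|l - l0| < d -> f (x + th *: w, l) 0 i + c * th <= f (x, l) 0 i.

Lemma derive_dfdx (R : realType) (n : nat) (f : 'rV[R]_n * R -> 'rV[R]_n)
    (x w : 'rV[R]_n) (l : R) : differentiable f (x, l) ->
  'd f (x, l) (w, 0) = w *m dfdx f x l.
Proof.
move=> df; have dg : differentiable (fun y => f (y, l)) x.
  have d1 : differentiable (@id 'rV[R]_n) x by [].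
  have d2 : differentiable (@cst 'rV[R]_n R l) x by [].
  exact: (differentiable_comp (differentiable_pair d1 d2) df).
rewrite -deriveE// /dfdx -deriveEjacobian// /derive.
suff -> : (fun h : R => h^-1 *: ((f \o shift (x, l)) (h *: (w, 0)) - f (x, l))) =
    (fun h : R => h^-1 *: (((fun y => f (y, l)) \o shift x) (h *: w) - f (x, l))) by [].
apply/funext => h /=.
by congr (_ *: (f _ - _)); congr (_, _); rewrite /= scaler0 add0r.
Qed.

Lemma expanding_at (R : realType) (n : nat) (U : set 'rV[R]_n)
    (f : 'rV[R]_n * R -> 'rV[R]_n) (x0 w : 'rV[R]_n) (l0 : R) :
  open U -> C1_field U f -> U x0 -> vec_ll 0 (w *m dfdx f x0 l0) ->
  exists c d, [/\ 0 < c, 0 < d & expanding f x0 l0 w c d].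
Proof.
move=> oU C1 Ux0 pos; have [df cD] := C1 _ l0 Ux0.
have pos' i : 0 < (w *m dfdx f x0 l0) 0 i by have := pos i; rewrite mxE.
have [c c0 Hc] := finite_pos_lower_bound pos'.
have : \forall z \near (x0, l0), forall i, c < 'D_(w, 0) f z 0 i.
  apply: (@filter_forall _ _ (fun i z => c < 'D_(w, 0) f z 0 i) (nbhs (x0, l0))) => i.
  have cDi := coord_cont (i := i) (cD (w, 0)).
  have lt : c < 'D_(w, 0) f (x0, l0) 0 i by rewrite deriveE// derive_dfdx.
  by have /cvgr_gt/(_ _ lt) := cDi.
move=> /near_ball_pair[d1 d10 H1]; have [d2 d20 H2] := open_ball_sub oU Ux0.
exists c, (Num.min d1 d2); split=> //; first by rewrite lt_min d10.
move=> x th l i th0 xd yd ld.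
have bU z : `|z - x0| < Num.min d1 d2 -> U z.
  by rewrite lt_min => /andP[_ /H2].
have [z zd E] := field_mvt l i C1 bU xd yd.
rewrite -lerBrDl E [x + _]addrC addrK.
have -> : (th *: w, 0 : R) = th *: (w, 0 : R) by congr (_, _); rewrite /= scaler0.
have [dfz _] := C1 z l (bU z zd).
rewrite linearZ mxE mulrC ler_wpM2l// ltW// -deriveE//.
by apply: H1; [move: zd|move: ld]; rewrite lt_min => /andP[].
Qed.

Lemma contracting_at (R : realType) (n : nat) (U : set 'rV[R]_n)
    (f : 'rV[R]_n * R -> 'rV[R]_n) (x0 w : 'rV[R]_n) (l0 : R) :
  open U -> C1_field U f -> U x0 -> vec_ll (w *m dfdx f x0 l0) 0 ->
  exists c d, [/\ 0 < c, 0 < d & contracting f x0 l0 w c d].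
Proof.
move=> oU C1 Ux0 neg; have [df0 _] := C1 _ l0 Ux0.
have C1' : C1_field U (fun z => - f z).
  move=> x l Ux; have [df cD] := C1 x l Ux; split; first exact: differentiableN.
  move=> v; have cN : {for (x, l), continuous (fun z => - 'D_v f z)} by apply: cvgN; exact: cD.
  (* The derivative of [- f] is minus that of [f] wherever [f] is differentiable, that is on a
     neighbourhood, which is enough to transfer continuity at the point. *)
  have near_eq : \forall z \near (x, l), - 'D_v f z = 'D_v (fun z => - f z) z.
    have [d d0 bU] := open_ball_sub oU Ux; apply/nbhs_ballP; exists d => //= -[y m] [yd _].
    have Uy : U y by apply: bU; move: yd; rewrite /= -ball_normE /= distrC.
    by rewrite deriveN//; apply: diff_derivable; have [] := C1 y m Uy.
  have E0 : 'D_v (fun z => - f z) (x, l) = - 'D_v f (x, l).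
    by rewrite deriveN//; exact: diff_derivable.
  rewrite /prop_for /continuous_at E0; exact: cvg_trans (near_eq_cvg near_eq) cN.
have [||c [d [c0 d0 H]]] := @expanding_at R n U (fun z => - f z) x0 w l0 oU C1'.
- by [].
- have [df' _] := C1' _ l0 Ux0.
  move=> i; rewrite -derive_dfdx// mxE diffN// -[X in _ < X]/((- 'd f (x0, l0) (w, 0)) 0 i).
  by rewrite derive_dfdx// mxE oppr_gt0; have := neg i; rewrite [in X in _ < X]mxE.
exists c, d; split=> // x th l i th0 xd yd ld.
by have := H x th l i th0 xd yd ld; rewrite !mxE; lra.
Qed.

(** Each partial derivative is bounded near [(x0, l0)] by its size there plus 1; summing over the
    coordinate directions bounds the differential, uniformly in the parameter [l]. *)
Lemma field_lipschitz (R : realType) (n : nat) (U : set 'rV[R]_n)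
    (f : 'rV[R]_n * R -> 'rV[R]_n) (x0 : 'rV[R]_n) (l0 : R) :
  open U -> C1_field U f -> U x0 ->
  exists K d, [/\ 0 < K, 0 < d & forall x y l,
    `|x - x0| < d -> `|y - x0| < d -> `|l - l0| < d ->
    `|f (x, l) - f (y, l)| <= K * `|x - y|].
Proof.
move=> oU C1 Ux0; have [df cD] := C1 _ l0 Ux0.
pose B (j : 'I_n) := `|'D_(delta_mx 0 j, 0) f (x0, l0)| + 1.
have : \forall z \near (x0, l0), forall j : 'I_n, `|'D_(delta_mx 0 j, 0) f z| < B j.
  apply: (@filter_forall _ _
    (fun (j : 'I_n) z => `|'D_(delta_mx 0 j, 0) f z| < B j) (nbhs (x0, l0))) => j.
  have lt : `|'D_(delta_mx 0 j, 0) f (x0, l0)| < B j by rewrite /B ltrDl.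
  exact: (cvgr_lt _ (cvg_norm (cD (delta_mx 0 j, 0))) _ lt).
move=> /near_ball_pair[d1 d10 H1]; have [d2 d20 H2] := open_ball_sub oU Ux0.
exists (\sum_j B j + 1), (Num.min d1 d2); split.
- by rewrite ltr_wpDl// sumr_ge0// => j _; rewrite addr_ge0.
- by rewrite lt_min d10.
move=> x y l xd yd ld; have K0 : 0 <= \sum_j B j.
  by rewrite sumr_ge0// => j _; rewrite addr_ge0.
apply: norm_le_coord => [|i]; first by rewrite mulr_ge0// addr_ge0.
have bU z : `|z - x0| < Num.min d1 d2 -> U z.
  by rewrite lt_min => /andP[_ /H2].
have [z zd E] := field_mvt l i C1 bU yd xd.
rewrite !mxE E; set v := x - y.
have [dfz _] := C1 z l (bU z zd).
have -> : (v, 0 : R) = \sum_j v 0 j *: (delta_mx 0 j, 0 : R).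
  have pairD : {morph (fun u : 'rV[R]_n => (u, 0 : R)) : u u' / u + u' >-> u + u'}.
    by move=> u u'; congr (_, _); rewrite /= addr0.
  rewrite {1}(row_sum_delta v) (big_morph _ pairD erefl); apply: eq_bigr => j _.
  by congr (_, _); rewrite /= scaler0.
rewrite linear_sum summxE (le_trans (ler_norm_sum _ _ _))//.
apply: (@le_trans _ _ ((\sum_j B j) * `|v|)); last first.
  by rewrite ler_wpM2r// lerDl.
rewrite mulr_suml ler_sum// => j _; rewrite linearZ mxE normrM mulrC ler_pM//.
- rewrite (le_trans (coord_le_norm _ _))// ltW// -deriveE//.
  by apply: H1; [move: zd|move: ld]; rewrite lt_min => /andP[].
- exact: coord_le_norm.
Qed.

(** * Stable Metzler matrices *)

Lemma row_mul_bound (R : realType) (n : nat) (G : 'M[R]_n) :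
  exists2 C : R, 0 < C & forall x : 'rV[R]_n, `|x *m G| <= C * `|x|.
Proof.
have [C C0 HC] := finite_upper_bound (fun i => \sum_j `|G j i|).
exists C => // x; apply: norm_le_coord => [|i]; first by rewrite mulr_ge0// ltW.
rewrite mxE (le_trans (ler_norm_sum _ _ _))//.
apply: (@le_trans _ _ ((\sum_j `|G j i|) * `|x|)); last by rewrite ler_wpM2r// ltW.
rewrite mulr_suml ler_sum// => j _; rewrite normrM mulrC ler_wpM2l//.
exact: coord_le_norm.
Qed.

Definition off_diag_ge0 (R : realType) (n : nat) (A : 'M[R]_n) : Prop :=
  forall i j, i != j -> 0 <= A i j.

Lemma shift_mulE (R : realType) (n : nat) (A : 'M[R]_n) (w : 'rV[R]_n) (t : R) i :
  (w *m (t%:M - A)) 0 i = t * w 0 i - (w *m A) 0 i.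
Proof. by rewrite mulmxBr mul_mx_scalar !mxE. Qed.

Lemma off_diag_mul_le0 (R : realType) (n : nat) (A : 'M[R]_n) (t : R)
    (y : 'rV[R]_n) (i : 'I_n) :
  off_diag_ge0 A -> (forall j, 0 <= y 0 j) -> y 0 i = 0 ->
  (y *m (t%:M - A)) 0 i <= 0.
Proof.
move=> mA y0 yi; rewrite shift_mulE yi mulr0 sub0r oppr_le0 mxE sumr_ge0// => j _.
have [->|ji] := eqVneq j i; first by rewrite yi mul0r.
by rewrite mulr_ge0// mA.
Qed.

(** The minimum principle for M-matrices. If the smallest ratio [m] of [x] to [w] were negative,
    [x - m *: w] would be nonnegative with a zero at [i], where its image under [t - A] would be
    both nonpositive and positive. *)
Lemma shift_inverse_nonneg (R : realType) (n : nat) (A : 'M[R]_n) (t : R)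
    (w x : 'rV[R]_n) :
  off_diag_ge0 A -> (forall i, 0 < w 0 i) ->
  (forall i, 0 < (w *m (t%:M - A)) 0 i) ->
  (forall i, 0 <= (x *m (t%:M - A)) 0 i) -> forall i, 0 <= x 0 i.
Proof.
move=> mA w0 wB xB i0; rewrite leNgt; apply/negP => xi0.
have [i _ Hi] := @Order.TotalTheory.arg_minP _ _ _ i0 xpredT (fun i => x 0 i / w 0 i) isT.
pose m := x 0 i / w 0 i.
have m0 : m < 0.
  by apply: (le_lt_trans (Hi i0 isT)); rewrite pmulr_llt0// invr_gt0.
pose y := x - m *: w.
have y0 j : 0 <= y 0 j.
  by rewrite !mxE subr_ge0 -ler_pdivlMr//; exact: Hi.
have yi : y 0 i = 0 by rewrite !mxE divfK ?subrr// gt_eqF.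
have := off_diag_mul_le0 (i := i) t mA y0 yi.
rewrite mulmxBl -scalemxAl; move: (wB i) (xB i).
set a := w *m _; set b := x *m _ => a0 b0; rewrite leNgt => /negP; apply.
have ma : m * a 0 i < 0 by rewrite nmulr_rlt0.
by clearbody a b; rewrite !mxE; lra.
Qed.

(* Let [u t] be the row with [u t *m (t%:M - A) = 1].  The set of [t >= 0] for
   which [u t] is positive is nonempty and open; it is closed because the
   resolvent identity bounds [u t] when [t] approaches the infimum. *)
Lemma metzler_stable (R : realType) (n : nat) (A : 'M[R]_n) :
  off_diag_ge0 A -> (forall t, 0 <= t -> ~~ eigenvalue A t) ->
  exists2 w : 'rV[R]_n, vec_ll 0 w & vec_ll (w *m A) 0.
Proof.
move=> mA nA; pose B (t : R) : 'M[R]_n := t%:M - A.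
pose one : 'rV[R]_n := const_mx 1.
have Bu t : 0 <= t -> B t \in unitmx.
  move=> t0; rewrite -row_free_unit -kermx_eq0; apply/negP => /negP/rowV0Pn[v].
  move=> /sub_kermxP vB v0; move/negP: (nA t t0); apply; apply/eigenvalueP.
  exists v => //; move: vB; rewrite mulmxBr mul_mx_scalar => /eqP.
  by rewrite subr_eq0 => /eqP.
have mulB t s (x : 'rV[R]_n) : x *m B s = x *m B t - (t - s) *: x.
  rewrite !mulmxBr !mul_mx_scalar scalerBl opprB [RHS]addrAC.
  by rewrite [_ + (_ - _)]addrC subrK.
pose u t := one *m invmx (B t).
have uB t : 0 <= t -> u t *m B t = one by move=> t0; rewrite mulmxKV// Bu.
clearbody u.
(* By the minimum principle, for [t >= 0] this amounts to [u t] being positive. *)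
pose good t := exists2 w : 'rV[R]_n, (forall i, 0 < w 0 i) &
  (forall i, 0 < (w *m B t) 0 i).
have good_u t : 0 <= t -> good t -> forall i, 0 < u t 0 i.
  move=> t0 [w w0 wB] i.
  have u0 : forall j, 0 <= u t 0 j.
    apply: (shift_inverse_nonneg mA w0 wB) => j.
    by rewrite -/(B t) uB// mxE.
  rewrite lt_neqAle u0 andbT eq_sym; apply/eqP => ui.
  have := off_diag_mul_le0 (i := i) t mA u0 ui.
  by rewrite -/(B t) uB// mxE ler10.
(* The witness is [u t] itself, whose image under [s - A] is [1 - (t - s) u t]. *)
have u_good t s : 0 <= t -> good t -> (t - s) * `|u t| < 1 -> good s.
  move=> t0 gt_ ts; have ut := good_u t t0 gt_.
  exists (u t) => // i.
  rewrite (mulB t s) uB// !mxE subr_gt0.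
  have [ts0|ts0] := leP (t - s) 0.
    exact: le_lt_trans (mulr_le0_ge0 ts0 (ltW (ut i))) ltr01.
  apply: (le_lt_trans _ ts); rewrite (ler_wpM2l (ltW ts0))//.
  by rewrite (le_trans (ler_norm _))// coord_le_norm.
suff [w w0 wB] : good 0.
  exists w => i; first by rewrite mxE.
  by rewrite [ltRHS]mxE; have := wB i; rewrite /B shift_mulE mul0r sub0r oppr_gt0.
pose S := [set t | 0 <= t /\ good t].
have [T T0 HT] := finite_upper_bound (fun i => (one *m A) 0 i).
have ST : S T.
  split; first exact: ltW.
  exists one => i; first by rewrite mxE.
  by rewrite shift_mulE mxE mulr1 subr_gt0; exact: HT.
have infS : has_inf S by split; [exists T|exists 0 => t []].
pose t1 := inf S.
have t10 : 0 <= t1 by apply: lb_le_inf; [exists T|move=> t []].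
have [C C0 HC] := row_mul_bound (invmx (B t1)).
(* [h * C <= 1/2] gives [|u t| <= 2 |u t1|] for [t] within [h] of the infimum; the second bound then
   gives [(t - s) |u t| <= 4 h |u t1| < 1]. *)
pose h := Num.min (2^-1 / C) (8^-1 / (`|u t1| + 1)).
have u1 : 0 < `|u t1| + 1 by rewrite ltr_wpDl.
have h0 : 0 < h by rewrite /h lt_min !divr_gt0.
have hC : h * C <= 2^-1.
  by rewrite -ler_pdivlMr// /h ge_min lexx.
have hu : h * (`|u t1| + 1) <= 8^-1.
  by rewrite -ler_pdivlMr// /h ge_min lexx orbT.
have [t [t0 gt_] tt1] := inf_adherent h0 infS.
have t1t : t1 <= t by apply: (ge_inf infS.2).
have resolvent : u t = u t1 - (t - t1) *: (u t *m invmx (B t1)).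
  rewrite -[LHS](mulmxK (Bu t1 t10)).
  rewrite (mulB t t1) uB// mulmxBl -scalemxAl.
  by rewrite -(uB t1 t10) mulmxK// Bu.
have ut : `|u t| <= 2 * `|u t1|.
  have : `|u t| <= `|u t1| + (t - t1) * (C * `|u t|).
    rewrite {1}resolvent (le_trans (ler_normB _ _))// lerD2l normrZ.
    by rewrite ger0_norm ?subr_ge0// ler_wpM2l ?subr_ge0.
  have : (t - t1) * (C * `|u t|) <= 2^-1 * `|u t|.
    rewrite mulrA ler_wpM2r// (le_trans _ hC)// ler_wpM2r ?ltW//.
    by rewrite ltrBlDl.
  lra.
(* A good point [h] below the infimum, cut off at 0: only the cut-off is consistent, so [s] is 0. *)
pose s := Num.max 0 (t1 - h).
have s0 : 0 <= s by rewrite /s le_max lexx.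
have st : t1 - h <= s by rewrite /s le_max lexx orbT.
have gs : good s.
  apply: (u_good t) => //.
  apply: (@le_lt_trans _ _ (2 * h * (2 * `|u t1|))).
    have [ts|ts] := leP 0 (t - s).
      by apply: ler_pM => //; have tt : t < t1 + h := tt1; lra.
    by apply: (@le_trans _ _ 0); rewrite ?mulr_ge0// ?mulr_le0_ge0// ltW.
  have -> : 2 * h * (2 * `|u t1|) = 4 * (h * `|u t1|) by ring.
  by move: hu; rewrite mulrDr mulr1; have := h0; lra.
have t1s : t1 <= s by apply: (ge_inf infS.2).
suff -> : 0 = s by [].
by apply/eqP; move: t1s; rewrite eq_le s0 /s le_max => /orP[t1n|]; [rewrite ge_max lexx; lra|lra].
Qed.

(** * Kamke's condition *)

(** The coordinatewise projection onto a cube; since rows carry the maximum norm, the cube is the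
    closed ball of radius [d], and the projection is 1-Lipschitz. *)
Definition clamp (R : realType) (n : nat) (c : 'rV[R]_n) (d : R)
    (x : 'rV[R]_n) : 'rV[R]_n :=
  \row_i Num.max (c 0 i - d) (Num.min (c 0 i + d) (x 0 i)).

Lemma clamp_dist (R : realType) (n : nat) (c : 'rV[R]_n) (d : R) x :
  0 <= d -> `|clamp c d x - c| <= d.
Proof.
move=> d0; apply: norm_le_coord => // i; rewrite !mxE ler_norml.
have h1 : c 0 i - d <= Num.max (c 0 i - d) (Num.min (c 0 i + d) (x 0 i)).
  by rewrite le_max lexx.
have h2 : Num.max (c 0 i - d) (Num.min (c 0 i + d) (x 0 i)) <= c 0 i + d.
  by rewrite ge_max ge_min lexx /=; lra.
lra.
Qed.

Lemma clamp_id (R : realType) (n : nat) (c : 'rV[R]_n) (d : R) x :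
  `|x - c| <= d -> clamp c d x = x.
Proof.
move=> xd; apply/rowP => i; rewrite !mxE.
have : `|x 0 i - c 0 i| <= d.
  by apply: le_trans xd; have := coord_le_norm (x - c) i; rewrite !mxE.
rewrite ler_norml => xi.
have -> : Num.min (c 0 i + d) (x 0 i) = x 0 i by apply/min_idPr; lra.
by apply/max_idPr; lra.
Qed.

Lemma clamp1_lipschitz (R : realType) (a b u v : R) :
  `|Num.max a (Num.min b u) - Num.max a (Num.min b v)| <= `|u - v|.
Proof.
wlog uv : u v / u <= v => [H|].
  have [/H//|/ltW vu] := leP u v.
  by rewrite distrC [leRHS]distrC H.
have m1 : Num.min b u <= Num.min b v by rewrite le_min !ge_min lexx uv !orbT.
have m2 : Num.min b v - Num.min b u <= v - u.
  by case: (leP b v) => h1; case: (leP b u) => h2; lra.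
rewrite ler0_norm; last first.
  by rewrite subr_le0 ge_max !le_max lexx m1 !orbT.
rewrite ler0_norm ?subr_le0//; move: m1 m2; set p := Num.min _ _; set q := Num.min _ _.
by move=> m1 m2; case: (leP a p) => h1; case: (leP a q) => h2; lra.
Qed.

Lemma clamp_lipschitz (R : realType) (n : nat) (c : 'rV[R]_n) (d : R) x y :
  `|clamp c d x - clamp c d y| <= `|x - y|.
Proof.
apply: norm_le_coord => // i; rewrite !mxE.
apply: le_trans (clamp1_lipschitz _ _ _ _) _.
by have := coord_le_norm (x - y) i; rewrite !mxE.
Qed.

(* Clamping makes the field globally Lipschitz, so solutions exist for all
   times; they solve the original equation as long as they stay in the ball. *)
Lemma clamped_solution (R : realType) (n : nat) (U : set 'rV[R]_n)
    (f : 'rV[R]_n * R -> 'rV[R]_n) (c : 'rV[R]_n) (d K M : R) (l : R -> R)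
    (t0 : R) (x0 : 'rV[R]_n) :
  C1_field U f -> 0 <= d -> 0 < K -> (forall z, `|z - c| <= d -> U z) ->
  continuous l ->
  (forall x y t, `|x - c| <= d -> `|y - c| <= d ->
     `|f (x, l t) - f (y, l t)| <= K * `|x - y|) ->
  (forall t, `|f (c, l t)| <= M) ->
  exists x : R -> 'rV[R]_n, x t0 = x0 /\
    forall t, is_derive t (1 : R) x (f (clamp c d (x t), l t)).
Proof.
move=> C1 d0 K0 bU cl fL fM.
pose F t x := f (clamp c d x, l t).
apply: (@picard_lindelof R n F K (K * d + M) t0 x0 K0).
- move=> x cx t; have Ux : U (clamp c d (x t)) by apply: bU; exact: clamp_dist.
  have cf := field_continuous (l := l t) C1 Ux.
  have cc : {for t, continuous (fun s => clamp c d (x s))}.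
    apply/cvgrPdist_lt => e e0; have /cvgrPdist_lt/(_ _ e0) := cx t.
    apply: filterS => s; exact: le_lt_trans (clamp_lipschitz _ _ _ _).
  have cp : (fun s => (clamp c d (x s), l s)) s @[s --> t] --> (clamp c d (x t), l t).
    exact: (cvg_pair cc (cl t)).
  exact: (cvg_comp (fun s => (clamp c d (x s), l s)) f cp cf).
- move=> t x y; apply: le_trans (fL _ _ t _ _) _; try exact: clamp_dist.
  by rewrite ler_wpM2l ?clamp_lipschitz// ltW.
- move=> t x; rewrite -[F t x](subrK (f (c, l t))).
  apply: le_trans (ler_normD _ _) _; rewrite lerD//.
  apply: le_trans (fL _ c t _ _) _; rewrite ?subrr ?normr0 ?clamp_dist//.
  by rewrite ler_wpM2l ?clamp_dist// ltW.
Qed.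

Definition kamke (R : realType) (n : nat) (U : set 'rV[R]_n)
    (f : 'rV[R]_n * R -> 'rV[R]_n) (lm lp : R) : Prop :=
  forall x y l i, lm <= l <= lp -> U x -> U y -> vec_le x y ->
    x 0 i = y 0 i -> f (x, l) 0 i <= f (y, l) 0 i.

Lemma local_autonomous_solution (R : realType) (n : nat) (U : set 'rV[R]_n)
    (f : 'rV[R]_n * R -> 'rV[R]_n) (x0 : 'rV[R]_n) (l : R) :
  open U -> C1_field U f -> U x0 ->
  exists2 a : R, 0 < a & exists x : R -> 'rV[R]_n, x 0 = x0 /\
    forall t, `|t| < a -> U (x t) /\ is_derive t (1 : R) x (f (x t, l)).
Proof.
move=> oU C1 Ux0; have [K [d1 [K0 d10 fL]]] := field_lipschitz l oU C1 Ux0.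
have [d2 d20 bU] := open_ball_sub oU Ux0.
pose d := Num.min d1 d2 / 2.
have m1 : Num.min d1 d2 <= d1 by rewrite ge_min lexx.
have m2 : Num.min d1 d2 <= d2 by rewrite ge_min lexx orbT.
have d0 : 0 < d by rewrite divr_gt0// lt_min d10.
have dd1 : d < d1 by move: d0; rewrite /d; lra.
have dd2 : d < d2 by move: d0; rewrite /d; lra.
have bU' z : `|z - x0| <= d -> U z by move=> h; apply: bU; exact: le_lt_trans dd2.
have [|||x [x00 x']] :=
  @clamped_solution R n U f x0 d K `|f (x0, l)| (cst l) 0 x0 C1 (ltW d0) K0 bU'.
- by move=> t; exact: cvg_cst.
- move=> x y t xd yd; apply: fL; rewrite ?subrr ?normr0//; exact: le_lt_trans dd1.
- by [].
have /cvgrPdist_lt/(_ _ d0)/near_ball_real[a a0 Ha] := is_derive_cont (x' 0).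
exists a => //; exists x; split=> // t ta.
have xd : `|x t - x0| <= d.
  by rewrite distrC -x00 ltW// Ha// subr0.
by split; [exact: bU'|have := x' t; rewrite clamp_id].
Qed.

(* [U] need not be convex, so the sign of the Jacobian does not give this; it
   comes from the derivative at time 0 of two ordered solutions. *)
Lemma monotone_kamke (R : realType) (n : nat) (U : set 'rV[R]_n)
    (f : 'rV[R]_n * R -> 'rV[R]_n) (lm lp : R) :
  open U -> C1_field U f ->
  (forall l, lm <= l <= lp -> monotone_system U (fun x => f (x, l))) ->
  kamke U f lm lp.
Proof.
move=> oU C1 mono x y l i ll Ux Uy xy xyi.
have [a a0 [X [X0 HX]]] := local_autonomous_solution l oU C1 Ux.
have [b b0 [Y [Y0 HY]]] := local_autonomous_solution l oU C1 Uy.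
pose r := Num.min a b.
have r0 : 0 < r by rewrite lt_min a0.
have ra : r <= a by rewrite ge_min lexx.
have rb : r <= b by rewrite ge_min lexx orbT.
clearbody r.
have [_ /(_ (- r) r X Y)] := mono l ll.
have mr : - r < 0 by lra.
move=> /(_ mr r0) H.
have {}H : forall t, 0 <= t < r -> vec_le (X t) (Y t).
  apply: H; last by rewrite X0 Y0.
  - move=> t; rewrite /= in_itv /= => tr; apply: HX; rewrite ltr_norml; lra.
  - move=> t; rewrite /= in_itv /= => tr; apply: HY; rewrite ltr_norml; lra.
rewrite leNgt; apply/negP => fl.
have a0' : `|0 : R| < a by rewrite normr0.
have b0' : `|0 : R| < b by rewrite normr0.
have /is_derive_rowP/(_ i) DX := (HX 0 a0').2.
have /is_derive_rowP/(_ i) DY := (HY 0 b0').2.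
rewrite X0 in DX; rewrite Y0 in DY.
(* A quarter of the supposed gap between the speeds: the two expansions lose [2 * e * h] against a
   gap of [4 * e * h]. *)
pose e := (f (x, l) 0 i - f (y, l) 0 i) / 4.
have e0 : 0 < e by rewrite /e; lra.
have /is_derive_epsP/(_ _ e0)[r1 r10 H1] := DX.
have /is_derive_epsP/(_ _ e0)[r2 r20 H2] := DY.
pose h := Num.min r (Num.min r1 r2) / 2.
have h0 : 0 < h by rewrite divr_gt0// !lt_min r0 r10.
have m0 : Num.min r (Num.min r1 r2) <= r by rewrite ge_min lexx.
have m1 : Num.min r (Num.min r1 r2) <= r1 by rewrite !ge_min lexx orbT.
have m2 : Num.min r (Num.min r1 r2) <= r2 by rewrite !ge_min lexx !orbT.
have hr : h < r by move: h0; rewrite /h; lra.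
have hr1 : h < r1 by move: h0; rewrite /h; lra.
have hr2 : h < r2 by move: h0; rewrite /h; lra.
have := H1 h; have := H2 h; rewrite add0r X0 Y0 gtr0_norm// => /(_ hr2) G2 /(_ hr1) G1.
have hm : 0 <= h < r by rewrite ltW.
have G := H h hm i.
move: G1 G2; rewrite !ler_norml => G1 G2.
have : 0 < h * e by rewrite mulr_gt0.
by move: G1 G2 G; rewrite xyi /e; lra.
Qed.

(** * The pullback attractor *)

Lemma exp_small (R : realType) (A e c t : R) (k0 : nat) : 0 < c -> 0 < e ->
  exists2 k, (k0 <= k)%N & A * expR (- (c * (t + k%:R))) < e.
Proof.
move=> c0 e0; pose X := (`|A| / e) / c + `|t|.
exists (maxn k0 (Num.trunc X).+1); first by rewrite leq_maxl.
set k := maxn _ _; have kX : X < k%:R.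
  by rewrite (lt_le_trans (truncnS_gt _))// ler_nat leq_maxr.
have tk : `|A| / e / c < t + k%:R.
  by have := ler_norm (- t); rewrite normrN; move: kX; rewrite /X; lra.
have ck : `|A| / e < c * (t + k%:R) by rewrite [ltRHS]mulrC -ltr_pdivrMr.
have ek : `|A| / e < expR (c * (t + k%:R)).
  by have := expR_ge1Dx (c * (t + k%:R)); lra.
rewrite expRN -/(_ / _) ltr_pdivrMr ?expR_gt0// (le_lt_trans (ler_norm _))//.
by rewrite [ltRHS]mulrC -ltr_pdivrMr.
Qed.

Lemma row_scale_bound (R : realType) (n : nat) (z c w : 'rV[R]_n) (th W : R) :
  0 <= th -> 0 < W -> (forall i, 0 < w 0 i) -> (forall i, w 0 i < W) ->
  (forall i, `|z 0 i - c 0 i| <= th * w 0 i) -> `|z - c| <= th * W.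
Proof.
move=> th0 W0 w0 wW H; apply: norm_le_coord => [|i]; first by rewrite mulr_ge0// ltW.
by rewrite !mxE (le_trans (H i))// ler_wpM2l// ltW.
Qed.

(** At a coordinate where [z2] touches the upper face of the box around [z1], Kamke's condition
    passes from [z2] to the corner [z1 + D *: w], and contraction from the corner to [z1]. *)
Lemma contracting_touch (R : realType) (n : nat) (U : set 'rV[R]_n)
    (f : 'rV[R]_n * R -> 'rV[R]_n) (lm lp l c d0 D : R) (q w z1 z2 : 'rV[R]_n) i :
  kamke U f lm lp -> contracting f q lm w c d0 -> lm <= l <= lp ->
  `|l - lm| < d0 -> 0 <= D -> `|z1 - q| < d0 -> `|z1 + D *: w - q| < d0 ->
  U (z1 + D *: w) -> U z2 ->
  (forall j, z2 0 j <= z1 0 j + D * w 0 j) -> z2 0 i = z1 0 i + D * w 0 i ->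
  f (z2, l) 0 i + c * D <= f (z1, l) 0 i.
Proof.
move=> K C ll ld D0 z1d zd Uz Uz2 le_z E.
have h1 : f (z2, l) 0 i <= f (z1 + D *: w, l) 0 i.
  by apply: K => // [j|]; rewrite !mxE.
have := C z1 D l i D0 z1d zd ld; lra.
Qed.

(** The [2n] functions [D * w_j - z_j] and [D * w_j + z_j], indexed by coordinate and sign, stay
    positive; the last hypothesis is the touching condition on the faces of the moving box. *)
Lemma weighted_box (R : realType) (n : nat) (z dz : R -> 'rV[R]_n)
    (D dD : R -> R) (w : 'rV[R]_n) (a b : R) :
  (forall s, a <= s <= b -> is_derive s (1 : R) z (dz s)) ->
  (forall s, is_derive s (1 : R) D (dD s)) ->
  (forall i, `|z a 0 i| < D a * w 0 i) ->
  (forall s i, a < s <= b -> (forall j, `|z s 0 j| <= D s * w 0 j) ->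
     (z s 0 i = D s * w 0 i -> dz s 0 i < dD s * w 0 i) /\
     (z s 0 i = - (D s * w 0 i) -> - (dD s * w 0 i) < dz s 0 i)) ->
  forall s, a <= s <= b -> forall i, `|z s 0 i| < D s * w 0 i.
Proof.
move=> Dz DD za T s sab.
pose sg (b : bool) : R := if b then 1 else -1.
pose phi (j : 'I_n * bool) s := D s * w 0 j.1 + sg j.2 * z s 0 j.1.
pose dphi (j : 'I_n * bool) s := dD s * w 0 j.1 + sg j.2 * dz s 0 j.1.
have phi0 j : 0 < phi j a.
  by have := za j.1; rewrite /phi /sg ltr_norml; case: j.2 => /andP[]; lra.
have Dphi j s' : a <= s' <= b -> is_derive s' (1 : R) (phi j) (dphi j s').
  move=> sab'; have /is_derive_rowP/(_ j.1) H := Dz s' sab'; have H1 := DD s'.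
  by apply: is_derive_eq; rewrite /dphi /GRing.scale /=; ring.
have Hpos : forall j s', a < s' <= b -> (forall j, 0 <= phi j s') ->
    phi j s' = 0 -> 0 < dphi j s'.
  move=> [i b'] s' sab' nn E.
  have bd j : `|z s' 0 j| <= D s' * w 0 j.
    have := nn (j, true); have := nn (j, false); rewrite /phi /sg /= ler_norml.
    by clear; lra.
  have [T1 T2] := T s' i sab' bd.
  move: E; rewrite /phi /dphi /sg; case: b' => /= E.
    have H : - (dD s' * w 0 i) < dz s' 0 i by apply: T2; move: E; clear; lra.
    by move: H; clear; lra.
  have H : dz s' 0 i < dD s' * w 0 i by apply: T1; move: E; clear; lra.
  by move: H; clear; lra.
have H := stays_positive Dphi phi0 Hpos sab.
move=> i; have := H (i, true); have := H (i, false).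
by rewrite /phi /sg /= ltr_norml; clear; lra.
Qed.

Lemma field_comp_continuous (R : realType) (n : nat) (U : set 'rV[R]_n)
    (f : 'rV[R]_n * R -> 'rV[R]_n) (x : R -> 'rV[R]_n) (l : R -> R) (t : R) :
  C1_field U f -> U (x t) -> {for t, continuous x} -> {for t, continuous l} ->
  {for t, continuous (fun s => f (x s, l s))}.
Proof.
move=> C1 Ux cx cl.
have cp : (fun s => (x s, l s)) s @[s --> t] --> (x t, l t).
  exact: (cvg_pair cx cl).
have cf := field_continuous (l := l t) C1 Ux.
exact: (cvg_comp (fun s => (x s, l s)) f cp cf).
Qed.

(** Solutions started at the times [- k] are exponentially close after a long run, so they converge
    as [k] grows, locally uniformly in time. The approximation clause serves to pass bounds on [y k]
    to the limit. *)
Lemma pullback_limit (R : realType) (n : nat) (U : set 'rV[R]_n)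
    (f : 'rV[R]_n * R -> 'rV[R]_n) (q : 'rV[R]_n) (d K A c S : R) (l : R -> R)
    (y : nat -> R -> 'rV[R]_n) :
  C1_field U f -> 0 <= d -> (forall z, `|z - q| <= d -> U z) -> 0 < K ->
  0 < A -> 0 < c -> continuous l ->
  (forall x y t, t <= S -> `|x - q| <= d -> `|y - q| <= d ->
     `|f (x, l t) - f (y, l t)| <= K * `|x - y|) ->
  (forall k t, - k%:R <= t <= S -> `|y k t - q| <= d /\
     is_derive t (1 : R) (y k) (f (y k t, l t))) ->
  (forall k m t i, (k <= m)%N -> - k%:R <= t <= S ->
     `|y k t 0 i - y m t 0 i| <= A * expR (- (c * (t + k%:R)))) ->
  exists2 x, trajectory U (fun t z => f (z, l t)) [set t | t < S] x &
    forall t i e, t <= S -> 0 < e -> exists2 k : nat, - k%:R <= t &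
      `|x t 0 i - y k t 0 i| < e.
Proof.
move=> C1 d0 bU K0 A0 c0 cl fL Hy cauchy.
have trunc_le (r : R) k : ((Num.trunc r).+1 <= k)%N -> r < k%:R.
  by move=> rk; rewrite (lt_le_trans (truncnS_gt _))// ler_nat.
have kt (k : nat) (t : R) : `|t| < k%:R -> - k%:R <= t by rewrite ltr_norml => /andP[/ltW].
have /choice[x Hx] : forall t, exists x : 'rV[R]_n, t <= S -> forall k, `|t| < k%:R ->
    forall i, `|x 0 i - y k t 0 i| <= A * expR (- (c * (t + k%:R))).
  move=> t; have [tS|] := leP t S; last by exists 0.
  have /choice[x Hx] : forall i, exists x, forall k, ((Num.trunc `|t|).+1 <= k)%N ->
      `|x - y k t 0 i| <= A * expR (- (c * (t + k%:R))).
    move=> i; apply: nested_limit => k m kk km; apply: cauchy => //.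
    by rewrite kt// trunc_le.
  exists (\row_i x i) => _ k tk i; rewrite mxE; apply: Hx.
  by rewrite -(ltr_nat R) (le_lt_trans _ tk)// truncn_le.
have app t i e : t <= S -> 0 < e -> exists2 k : nat, - k%:R <= t &
    `|x t 0 i - y k t 0 i| < e.
  move=> tS e0; have [k kk ke] := exp_small A t (Num.trunc `|t|).+1 c0 e0.
  have tk := trunc_le _ _ kk.
  by exists k; [exact: kt|exact: le_lt_trans (Hx t tS k tk i) ke].
have xd t : t <= S -> `|x t - q| <= d.
  move=> tS; apply/ler_addgt0Pr => e e0; apply: norm_le_coord => [|i].
    by rewrite addr_ge0// ltW.
  have [k kS /ltW H] := app t i e tS e0.
  have [H1 _] := Hy k t (introT andP (conj kS tS)).
  rewrite !mxE -(subrKA (y k t 0 i)) addrC (le_trans (ler_normD _ _))// lerD//.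
  by apply: le_trans H1; have := coord_le_norm (y k t - q) i; rewrite !mxE.
exists x => // t /= tS; have Ux : U (x t) by apply/bU/xd/ltW.
split=> //.
pose E k s : R := A * expR (- (c * (s + k%:R))).
have E0 k s : 0 <= E k s by rewrite mulr_ge0// ?expR_ge0// ltW.
(* The exponential decreases in time, so its value at the left end [t - 1] of the window bounds it
   throughout; [1 + K] serves both for the curves and for the fields along them. *)
pose rho k := (A * (1 + K)) * expR (- (c * (t - 1 + k%:R))).
pose k0 := (Num.trunc (`|t| + 1 + `|S|)).+1.
have tin : t - 1 < t < S by rewrite tS andbT gtrBl.
have kprop k s : (k0 <= k)%N -> t - 1 < s < S -> `|s| < k%:R.
  move=> /trunc_le kk; move: kk (ler_norm (- t)) (ler_norm S) (normr_ge0 t) (normr_ge0 S).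
  by rewrite normrN ltr_norml; clear; lra.
have rho0 e : 0 < e -> exists2 k, (k0 <= k)%N & rho k < e.
  by move=> e0; exact: exp_small.
have E_rho k s : t - 1 < s < S -> E k s * (1 + K) <= rho k.
  move=> /andP[ts _]; rewrite /rho /E mulrAC ler_wpM2l//.
    by rewrite mulr_ge0// ?addr_ge0// ltW.
  by rewrite ler_expR lerN2 (ler_wpM2l (ltW c0))// lerD2r ltW.
have xy k s : (k0 <= k)%N -> t - 1 < s < S -> `|y k s - x s| <= E k s.
  move=> k0k ts; apply: norm_le_coord => // i; rewrite !mxE distrC.
  by apply: Hx; [case/andP: ts => _ /ltW|exact: kprop ts].
have yx k s : (k0 <= k)%N -> t - 1 < s < S -> `|y k s - x s| <= rho k.
  move=> k0k ts; apply: le_trans (xy k s k0k ts) _; apply: le_trans (E_rho k s ts).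
  by rewrite ler_peMr// lerDl ltW.
have Hy' k s : (k0 <= k)%N -> t - 1 < s < S -> `|y k s - q| <= d /\
     is_derive s (1 : R) (y k) (f (y k s, l s)).
  move=> k0k ts; apply: Hy; rewrite (kt _ _ (kprop k s k0k ts))/=.
  by case/andP: ts => _ /ltW.
have cx : {for t, continuous x}.
  apply: (limit_continuous tin yx rho0) => k k0k.
  by have [_ /is_derive_cont] := Hy' k t k0k tin.
apply/is_derive_rowP => i.
apply: (derive_limit (z := fun k s => y k s 0 i) (G := fun s => f (x s, l s) 0 i)
  (g := fun k s => f (y k s, l s) 0 i) tin _ _ _ rho0).
- by move=> k s k0k ts; have [_ /is_derive_rowP] := Hy' k s k0k ts.
- move=> k s k0k ts; apply: le_trans (yx k s k0k ts).
  by have := coord_le_norm (y k s - x s) i; rewrite !mxE.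
- move=> k s k0k ts; have [yd _] := Hy' k s k0k ts.
  have sS : s <= S by case/andP: ts => _ /ltW.
  have h : `|f (y k s, l s) 0 i - f (x s, l s) 0 i| <= `|f (y k s, l s) - f (x s, l s)|.
    by have := coord_le_norm (f (y k s, l s) - f (x s, l s)) i; rewrite !mxE.
  apply: le_trans h _; apply: le_trans (fL _ _ _ sS yd (xd s sS)) _.
  apply: le_trans (E_rho k s ts); rewrite mulrC.
  by apply: ler_pM => //; [exact: ltW|exact: xy|rewrite lerDr].
- exact: (coord_cont (field_comp_continuous C1 Ux cx (cl t))).
Qed.

(** In a box around [q] with side lengths proportional to [w], contraction beats the residual
    [f (q, l t)], which is small in the past; the solutions started at [q] remain in the box and
    approach one another. *)
Lemma pullback_local (R : realType) (n : nat) (U : set 'rV[R]_n)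
    (f : 'rV[R]_n * R -> 'rV[R]_n) (lm lp c d0 : R) (l : R -> R)
    (q w : 'rV[R]_n) :
  open U -> C1_field U f -> kamke U f lm lp -> U q -> f (q, lm) = 0 ->
  vec_ll 0 w -> 0 < c -> 0 < d0 -> contracting f q lm w c d0 ->
  continuous l -> (forall t, lm <= l t <= lp) ->
  (forall e, 0 < e -> exists S, forall t, t <= S -> `|l t - lm| < e) ->
  exists S x, trajectory U (fun t z => f (z, l t)) [set t | t < S] x /\
    forall e, 0 < e -> exists T, forall t, t <= T -> `|x t - q| < e.
Proof.
move=> oU C1 Kam Uq fq w0 c0 d00 Con cl lb lt_lim.
have {}w0 i : 0 < w 0 i by have := w0 i; rewrite mxE.
have [K [d1 [K0 d10 fL]]] := field_lipschitz lm oU C1 Uq.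
have [d2 d20 bU] := open_ball_sub oU Uq.
have [W W0 wW] := finite_upper_bound (fun i => w 0 i).
have [d d_gt0 [dd0 dd1 dd2]] : exists2 d, 0 < d & [/\ d < d0, d < d1 & d < d2].
  have : \forall d \near (0 : R)^'+, [/\ 0 < d, d < d0, d < d1 & d < d2].
    by near=> d; split; near: d; [exact: nbhs_right_gt|exact: nbhs_right_lt..].
  by move=> /filter_ex[d [? ? ? ?]]; exists d.
(* A box of size [th0] lies in the ball of radius [d / 4], and a shift by at most [2 * th0] along
   [w] from there stays in the ball of radius [d]. *)
pose th0 := d / (4 * W).
have th00 : 0 < th0 by rewrite /th0 divr_gt0// mulr_gt0.
have th0W : th0 * W = d / 4 by rewrite /th0; field; rewrite gt_eqF.
clearbody th0.
have small (th : R) : 0 < th -> exists T, forall t, t <= T ->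
    `|l t - lm| < d /\ `|f (q, l t)| < c * th.
  move=> t_gt0; have ct0 : 0 < c * th by rewrite mulr_gt0.
  have /cvgrPdist_lt/(_ _ ct0)/near_ball_pair[e e0 He] := field_continuous (l := lm) C1 Uq.
  have de0 : 0 < Num.min d e by rewrite lt_min d_gt0.
  have [T HT] := lt_lim _ de0.
  exists T => t tT; have := HT t tT; rewrite lt_min => /andP[ld le].
  by split=> //; have := He q (l t); rewrite subrr normr0 fq sub0r normrN; exact.
have [S HS] := small th0 th00.
(* The parameter frozen after [S], so that the estimates needed by the clamped equation hold at all
   times. *)
pose l' t := l (Num.min t S).
have l'E t : t <= S -> l' t = l t by move=> tS; rewrite /l'; congr l; exact/min_idPl.
have l'S t : `|l' t - lm| < d /\ `|f (q, l' t)| < c * th0.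
  by apply: HS; rewrite ge_min lexx orbT.
have l'b t : lm <= l' t <= lp by exact: lb.
have cl' : continuous l'.
  move=> t; apply: (cvg_comp (fun t => Num.min t S) l _ (cl _)).
  by apply: (@continuous_min _ _ id (cst S) t); [exact: cvg_id|exact: cvg_cst].
clearbody l'.
have bU' z : `|z - q| <= d -> U z by move=> h; apply: bU; exact: le_lt_trans dd2.
have fL' x y t : `|x - q| <= d -> `|y - q| <= d ->
    `|f (x, l' t) - f (y, l' t)| <= K * `|x - y|.
  move=> xd yd; have ld := (l'S t).1.
  by apply: fL; [exact: le_lt_trans dd1|exact: le_lt_trans dd1|exact: lt_trans dd1].
have /choice[y Hy] : forall k : nat, exists x : R -> 'rV[R]_n, x (- k%:R) = q /\
    forall t, is_derive t (1 : R) x (f (clamp q d (x t), l' t)).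
  move=> k; apply: (clamped_solution _ _ C1 (ltW d_gt0) K0 bU' cl' fL') => t.
  exact: ltW (l'S t).2.
have d4 : d / 4 <= d by move: d_gt0; clear; lra.
have inbox (z : 'rV[R]_n) (th : R) : 0 <= th -> th <= th0 ->
    (forall i, `|z 0 i - q 0 i| <= th * w 0 i) -> `|z - q| <= d / 4.
  move=> t0 t1 H; apply: le_trans (row_scale_bound t0 W0 w0 wW H) _.
  by rewrite -th0W ler_wpM2r// ltW.
have touch (z1 z2 : 'rV[R]_n) (D t : R) i : `|z1 - q| <= d / 4 ->
    `|z2 - q| <= d / 4 -> 0 <= D ->
    D <= 2 * th0 -> (forall j, z2 0 j <= z1 0 j + D * w 0 j) ->
    z2 0 i = z1 0 i + D * w 0 i ->
    f (z2, l' t) 0 i + c * D <= f (z1, l' t) 0 i.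
  move=> z1d z2d D0 D1 H E.
  have zD : `|z1 + D *: w - q| <= d.
    have Dw : `|D *: w| <= 2 * th0 * W.
      apply: norm_le_coord => [|j]; first by rewrite mulr_ge0// ?ltW// mulr_gt0.
      by rewrite mxE ger0_norm ?mulr_ge0// ?ler_pM// ltW.
    rewrite addrAC (le_trans (ler_normD _ _))//.
    by move: Dw z1d d_gt0; rewrite -mulrA th0W; clear; lra.
  have ld := (l'S t).1.
  apply: (contracting_touch Kam Con) => //.
  - exact: lt_trans dd0.
  - by apply: le_lt_trans dd0; exact: le_trans d4.
  - exact: le_lt_trans dd0.
  - exact: bU'.
  - by apply: bU'; exact: le_trans d4.
have qd : `|q - q| <= d / 4 by rewrite subrr normr0 divr_ge0// ltW.
have th2 th : th <= th0 -> th <= 2 * th0 by move: th00; clear; lra.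
(* On a face of the box, contraction contributes at least [c * th] inwards, more than the residual
   [f (q, l t)] can undo. *)
have box k (th T : R) : 0 < th -> th <= th0 -> T <= S ->
    (forall t, t <= T -> `|f (q, l t)| < c * th) ->
    forall t, - k%:R <= t <= T -> forall i, `|y k t 0 i - q 0 i| < th * w 0 i.
  move=> t_gt0 tle TS Hf t tT i.
  pose z s := y k s - q.
  have zE s j : z s 0 j = y k s 0 j - q 0 j by rewrite !mxE.
  rewrite -zE; apply: (weighted_box (a := - k%:R) (b := T) (D := fun=> th)
    (dD := fun=> 0) (dz := fun s => f (clamp q d (y k s), l' s)) (z := z)) => //.
  - by move=> s _; have H := (Hy k).2 s; apply: is_derive_eq; rewrite subr0.
  - by move=> j; rewrite zE (Hy k).1 subrr normr0 mulr_gt0.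
  move=> s j /andP[_ sT] bd.
  have yd : `|y k s - q| <= d / 4.
    by apply: (inbox _ th) => // [|j']; [exact: ltW|rewrite -zE].
  have fs := Hf s sT; have := coord_le_norm (f (q, l s)) j; rewrite ler_norml => fj.
  rewrite clamp_id; last exact: le_trans d4.
  have sS := le_trans sT TS.
  rewrite zE mul0r oppr0; split=> E.
    have := touch q (y k s) th s j qd yd (ltW t_gt0) (th2 th tle).
    rewrite l'E// => H; have {}H : f (y k s, l s) 0 j + c * th <= f (q, l s) 0 j.
      apply: H; last by move: E; clear; lra.
      by move=> j'; have := bd j'; rewrite zE ler_norml; clear; lra.
    by move: H fj fs; clear; lra.
  have := touch (y k s) q th s j yd qd (ltW t_gt0) (th2 th tle).
  rewrite l'E// => H; have {}H : f (q, l s) 0 j + c * th <= f (y k s, l s) 0 j.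
    apply: H; last by move: E; clear; lra.
    by move=> j'; have := bd j'; rewrite zE ler_norml; clear; lra.
  by move: H fj fs; clear; lra.
have boxS k t : - k%:R <= t <= S -> `|y k t - q| <= d / 4.
  move=> tS; apply: (inbox _ th0) => // [|i]; first exact: ltW.
  by apply/ltW/(box k th0 S) => // s sS; exact: (HS s sS).2.
(* Slow enough that [c' * w_i < c]: the faces of the shrinking box move in more slowly than the
   difference of two solutions contracts. *)
pose c' := c / (2 * W).
have c'0 : 0 < c' by rewrite divr_gt0// mulr_gt0.
have c'W i : c' * w 0 i < c.
  have : c' * w 0 i < c' * W by rewrite ltr_pM2l.
  have -> : c' * W = c / 2 by rewrite /c'; field; rewrite gt_eqF.
  by move: c0; clear; lra.
clearbody c'.
(* At time [- k] the solution [y k] is at [q] and [y m] within the box of size [th0], so the initial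
   size [2 * th0] leaves strict room. *)
pose D (k : nat) t := 2 * th0 * expR (- (c' * (t + k%:R))).
have D0 k t : 0 < D k t by rewrite mulr_gt0// ?expR_gt0// mulr_gt0.
have Dk (k : nat) : D k (- k%:R) = 2 * th0.
  by rewrite /D addNr mulr0 oppr0 expR0 mulr1.
have D2 (k : nat) s : - k%:R <= s -> D k s <= 2 * th0.
  move=> ks; rewrite /D ler_piMr//; first by rewrite mulr_ge0// ltW.
  rewrite -[leRHS]expR0 ler_expR oppr_le0 (mulr_ge0 (ltW c'0))//.
  by rewrite -lerBlDr sub0r.
have D' k t : is_derive t (1 : R) (D k) (- c' * D k t).
  have H : is_derive t (1 : R) (fun t => expR (- (c' * (t + k%:R))))
      (- c' * expR (- (c' * (t + k%:R)))).
    apply: (is_derive_eq (is_derive1_comp _ _)).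
    by rewrite /GRing.scale /= addr0 mulr1 mulrC.
  by apply: is_derive_eq; rewrite /D /GRing.scale /=; ring.
have DW (k : nat) s i : D k s * w 0 i <= 2 * th0 * W * expR (- (c' * (s + k%:R))).
  rewrite /D mulrAC ler_wpM2r ?expR_ge0//.
  by apply: ler_wpM2l; [rewrite mulr_ge0// ltW|exact: ltW].
clearbody D.
have cauchy (k m : nat) t i : (k <= m)%N -> - k%:R <= t <= S ->
    `|y k t 0 i - y m t 0 i| < D k t * w 0 i.
  move=> km tS.
  have mk s : - k%:R <= s -> - m%:R <= s.
    by apply: le_trans; rewrite lerN2 ler_nat.
  pose z s := y k s - y m s.
  have zE s j : z s 0 j = y k s 0 j - y m s 0 j by rewrite !mxE.
  rewrite -zE; apply: (weighted_box (a := - k%:R) (b := S) (z := z)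
    (dz := fun s => f (clamp q d (y k s), l' s) - f (clamp q d (y m s), l' s))
    _ (D' k) _ _ tS).
  - by move=> s _; have H := (Hy k).2 s; have H1 := (Hy m).2 s; apply: is_derive_eq.
  - move=> j; rewrite zE (Hy k).1 Dk distrC.
    have kS : - k%:R <= S by case/andP: tS; exact: le_trans.
    have kmS : - m%:R <= (- k%:R : R) <= S by apply/andP; split; [exact: mk|].
    have := box m th0 S th00 (lexx _) (lexx _) (fun s sS => (HS s sS).2) _ kmS j.
    by have := mulr_gt0 th00 (w0 j); clear; lra.
  move=> s j /andP[/ltW ks sS] bd.
  have kd : `|y k s - q| <= d / 4 by apply: boxS; rewrite ks.
  have md : `|y m s - q| <= d / 4 by apply: boxS; rewrite mk.
  have cw : 0 < D k s * (c - c' * w 0 j) by rewrite mulr_gt0// subr_gt0.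
  rewrite !clamp_id; [|exact: le_trans d4|exact: le_trans d4].
  rewrite zE !mxE; split=> E.
    have H : f (y k s, l' s) 0 j + c * D k s <= f (y m s, l' s) 0 j.
      apply: touch => //; [exact: ltW|exact: D2| |by move: E; clear; lra].
      by move=> j'; have := bd j'; rewrite zE ler_norml; clear; lra.
    by move: H cw; clear; lra.
  have H : f (y m s, l' s) 0 j + c * D k s <= f (y k s, l' s) 0 j.
    apply: touch => //; [exact: ltW|exact: D2| |by move: E; clear; lra].
    by move=> j'; have := bd j'; rewrite zE ler_norml; clear; lra.
  by move: H cw; clear; lra.
have A0 : 0 < 2 * th0 * W by rewrite !mulr_gt0.
have fLS x1 x2 t : t <= S -> `|x1 - q| <= d -> `|x2 - q| <= d ->
    `|f (x1, l t) - f (x2, l t)| <= K * `|x1 - x2|.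
  by move=> /l'E <-; exact: fL'.
have yS k t : - k%:R <= t <= S -> `|y k t - q| <= d /\
    is_derive t (1 : R) (y k) (f (y k t, l t)).
  move=> tS; have yd := le_trans (boxS k t tS) d4; split=> //.
  by have := (Hy k).2 t; rewrite clamp_id// l'E//; case/andP: tS.
have yy k m t i : (k <= m)%N -> - k%:R <= t <= S ->
    `|y k t 0 i - y m t 0 i| <= 2 * th0 * W * expR (- (c' * (t + k%:R))).
  by move=> km tS; apply: le_trans (DW k t i); apply/ltW/cauchy.
have [x xtraj xlim] := pullback_limit C1 (ltW d_gt0) bU' K0 A0 c'0 cl fLS yS yy.
(* The solutions start at [q] itself, hence inside every box; a smaller [th] confines them, and so
   their limit, closer to [q] in the remote past. *)
exists S, x; split=> // e e0; pose th := Num.min th0 (e / (2 * W)).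
have th_0 : 0 < th by rewrite /th lt_min th00 divr_gt0// mulr_gt0.
have th_1 : th <= th0 by rewrite /th ge_min lexx.
have thW : th * W <= e / 2.
  have : th <= e / (2 * W) by rewrite /th ge_min lexx orbT.
  move=> H; have := ler_wpM2r (ltW W0) H.
  by have -> : e / (2 * W) * W = e / 2 by field; rewrite gt_eqF.
have [T HT] := small th th_0; exists (Num.min T S) => t; rewrite le_min => /andP[tT tS].
apply: (@le_lt_trans _ _ (th * W)); last by move: thW e0; clear; lra.
apply: (row_scale_bound (ltW th_0) W0 w0 wW) => i.
apply/ler_addgt0Pr => eps eps0; have [k kt /ltW H] := xlim t i eps tS eps0.
have TS : Num.min T S <= S by rewrite ge_min lexx orbT.
have ktT : - k%:R <= t <= Num.min T S by rewrite kt le_min tT.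
have fT s : s <= Num.min T S -> `|f (q, l s)| < c * th.
  by rewrite le_min => /andP[sT _]; exact: (HT s sT).2.
have /ltW H2 := box k th (Num.min T S) th_0 th_1 TS fT t ktT i.
have -> : x t 0 i - q 0 i = (y k t 0 i - q 0 i) + (x t 0 i - y k t 0 i) by ring.
by apply: le_trans (ler_normD _ _) _; exact: lerD.
Unshelve. all: by end_near. Qed.

(** * Limits at infinity, uniqueness and maximal continuation *)

Lemma cvg_ninfty_epsP (R : realType) (V : normedModType R) (x : R -> V) (q : V) :
  x t @[t --> -oo] --> q <->
  (forall e, 0 < e -> exists T, forall t, t <= T -> `|x t - q| < e).
Proof.
split=> [/cvgrPdist_lt H e e0|H].
  have [M [_ HM]] := H e e0; exists (M - 1) => t tM.
  by rewrite distrC; apply: HM; rewrite (le_lt_trans tM)// gtrBl.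
apply/cvgrPdist_lt => e e0; have [T HT] := H e e0; exists T; split; first exact: num_real.
by move=> t tT; rewrite /= distrC; apply/HT/ltW.
Qed.

Lemma cvg_pinfty_epsP (R : realType) (V : normedModType R) (x : R -> V) (q : V) :
  x t @[t --> +oo] --> q <->
  (forall e, 0 < e -> exists T, forall t, T <= t -> `|x t - q| < e).
Proof.
split=> [/cvgrPdist_lt H e e0|H].
  have [M [_ HM]] := H e e0; exists (M + 1) => t tM.
  by rewrite distrC; apply: HM; rewrite (lt_le_trans _ tM)// ltrDl.
apply/cvgrPdist_lt => e e0; have [T HT] := H e e0; exists T; split; first exact: num_real.
by move=> t tT; rewrite /= distrC; apply/HT/ltW.
Qed.

(** Agreement is propagated along [[a, b]]: near a time where the curves agree, a local Lipschitz
    bound controls their difference; near a time where they differ, they agree at no nearby time and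
    the implication is vacuous. *)
Lemma trajectories_agree (R : realType) (n : nat) (U : set 'rV[R]_n)
    (f : 'rV[R]_n * R -> 'rV[R]_n) (l : R -> R) (y1 y2 : R -> 'rV[R]_n)
    (a b : R) :
  open U -> C1_field U f -> continuous l -> a <= b ->
  (forall t, a <= t <= b -> U (y1 t) /\ is_derive t (1 : R) y1 (f (y1 t, l t))) ->
  (forall t, a <= t <= b -> U (y2 t) /\ is_derive t (1 : R) y2 (f (y2 t, l t))) ->
  y1 a = y2 a -> y1 b = y2 b.
Proof.
move=> oU C1 cl ab H1 H2 ya.
apply: (propagation (P := fun s => y1 s = y2 s) ab ya) => s sab.
have [Us D1] := H1 s sab; have [_ D2] := H2 s sab.
have /cvgrPdist_lt c1 := is_derive_cont D1.
have /cvgrPdist_lt c2 := is_derive_cont D2.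
have [E|ne] := pselect (y1 s = y2 s); last first.
  have ny : 0 < `|y1 s - y2 s| / 2 by rewrite divr_gt0// normr_gt0 subr_eq0; apply/eqP.
  have /near_ball_real[r1 r10 Hr1] := c1 _ ny.
  have /near_ball_real[r2 r20 Hr2] := c2 _ ny.
  exists (Num.min r1 r2); first by rewrite lt_min r10.
  move=> s1 s2 _ _ _; rewrite lt_min => /andP[/Hr1 h1 /Hr2 h2] _ E; exfalso.
  have : `|y1 s - y2 s| <= `|y1 s - y1 s1| + `|y2 s1 - y2 s|.
    by rewrite -(subrKA (y1 s1)) E ler_normD.
  by rewrite leNgt => /negP; apply; move: h1 h2; rewrite [`|y2 s1 - _|]distrC; clear; lra.
have [K [d [K0 d0 fL]]] := field_lipschitz (l s) oU C1 Us.
have /near_ball_real[r1 r10 Hr1] := c1 _ d0.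
have /near_ball_real[r2 r20 Hr2] := c2 _ d0.
have /cvgrPdist_lt/(_ _ d0)/near_ball_real[r3 r30 Hr3] := cl s.
exists (Num.min r1 (Num.min r2 r3)); first by rewrite !lt_min r10 r20.
move=> s1 s2 as1 s12 s2b s1r s2r y12.
have near_s t : s1 <= t <= s2 -> [/\ `|y1 t - y1 s| < d, `|y2 t - y1 s| < d & `|l t - l s| < d].
  move=> tt; have : `|t - s| < Num.min r1 (Num.min r2 r3).
    by move: s1r s2r tt; rewrite !ltr_norml; clear; lra.
  rewrite !lt_min => /and3P[/Hr1 h1 /Hr2 h2 /Hr3 h3].
  by split; rewrite distrC// E.
have tab t : s1 <= t <= s2 -> a <= t <= b by move: as1 s2b; clear; lra.
pose z t := y1 t - y2 t; pose dz t := f (y1 t, l t) - f (y2 t, l t).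
have Dz t : s1 <= t <= s2 -> is_derive t (1 : R) z (dz t).
  move=> /tab tt; have [_ h1] := H1 t tt; have [_ h2] := H2 t tt.
  exact: is_derive_eq.
(* The growth rate [2 * K] exceeds the Lipschitz constant, which makes the box inequality strict;
   [eta] is then sent to 0. *)
have bound eta : 0 < eta -> forall i, `|z s2 0 i| < eta * expR (2 * K * (s2 - s1)).
  move=> eta0 i; pose D t := eta * expR (2 * K * (t - s1)).
  have D0 t : 0 < D t by rewrite mulr_gt0// expR_gt0.
  have DD t : is_derive t (1 : R) D (2 * K * D t).
    have H : is_derive t (1 : R) (fun t => expR (2 * K * (t - s1)))
        (2 * K * expR (2 * K * (t - s1))).
      apply: (is_derive_eq (is_derive1_comp _ _)).
      by rewrite /GRing.scale /= subr0 mulr1 mulrC.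
    by apply: is_derive_eq; rewrite /D /GRing.scale /=; ring.
  pose w : 'rV[R]_n := const_mx 1.
  have wE j : w 0 j = 1 by rewrite mxE.
  have ss : s1 <= s2 <= s2 by rewrite lexx ltW.
  have := weighted_box (w := w) Dz DD _ _ ss i; rewrite wE mulr1; apply.
    by move=> j; rewrite /z y12 subrr wE mulr1 mxE normr0.
  move=> t j /andP[st ts] bd; rewrite wE mulr1.
  have tt : s1 <= t <= s2 by rewrite ltW.
  have [n1 n2 n3] := near_s t tt.
  have zD : `|y1 t - y2 t| <= D t.
    by apply: norm_le_coord => [|k]; [exact: ltW|have := bd k; rewrite wE mulr1].
  have : `|dz t 0 j| < 2 * K * D t.
    apply: le_lt_trans (coord_le_norm _ _) _; apply: le_lt_trans (fL _ _ _ n1 n2 n3) _.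
    apply: (@le_lt_trans _ _ (K * D t)); first by rewrite ler_wpM2l// ltW.
    by have := mulr_gt0 K0 (D0 t); rewrite -mulrA; clear; lra.
  by rewrite ltr_norml; clear; split=> _; lra.
apply/eqP; rewrite -subr_eq0; apply/eqP/rowP => i; rewrite [RHS]mxE.
apply/eqP; rewrite -normr_le0; apply/ler_addgt0Pr => e e0; rewrite add0r.
have X0 : 0 < expR (2 * K * (s2 - s1)) by exact: expR_gt0.
have := bound (e / expR (2 * K * (s2 - s1))) (divr_gt0 e0 X0) i.
by rewrite divfK ?gt_eqF// => /ltW.
Qed.

(** The end time [T] is the supremum over all trajectories that continue [x0]. Any two of them agree
    where both are defined, by uniqueness from a time before [S0], so they glue. *)
Lemma maximal_extension (R : realType) (n : nat) (U : set 'rV[R]_n)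
    (f : 'rV[R]_n * R -> 'rV[R]_n) (l : R -> R) (x0 : R -> 'rV[R]_n) (S0 : R) :
  open U -> C1_field U f -> continuous l ->
  trajectory U (fun t z => f (z, l t)) [set t | t < S0] x0 ->
  exists (T : \bar R) (x : R -> 'rV[R]_n),
  [/\ (S0%:E <= T)%E,
      trajectory U (fun t z => f (z, l t)) [set t | (t%:E < T)%E] x,
      forall t, t < S0 -> x t = x0 t &
      forall (T' : \bar R) (y : R -> 'rV[R]_n),
        trajectory U (fun t z => f (z, l t)) [set t | (t%:E < T')%E] y ->
        (forall t, (t%:E < T)%E -> (t%:E < T')%E -> y t = x t) ->
        (T' <= T)%E].
Proof.
move=> oU C1 cl traj0.
pose good (T : \bar R) y := trajectory U (fun t z => f (z, l t)) [set t | (t%:E < T)%E] y /\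
  forall t, t < S0 -> (t%:E < T)%E -> y t = x0 t.
have agree T1 y1 T2 y2 t : good T1 y1 -> good T2 y2 -> (t%:E < T1)%E ->
    (t%:E < T2)%E -> y1 t = y2 t.
  move=> [tr1 e1] [tr2 e2] t1 t2; pose a := Num.min S0 t - 1.
  have at_ : a <= t by have : Num.min S0 t <= t; [rewrite ge_min lexx orbT|rewrite /a; lra].
  have aS : a < S0 by have : Num.min S0 t <= S0; [rewrite ge_min lexx|rewrite /a; lra].
  have dom (T : \bar R) s : (t%:E < T)%E -> a <= s <= t -> (s%:E < T)%E.
    by move=> tT /andP[_ st]; apply: le_lt_trans tT; rewrite lee_fin.
  apply: (trajectories_agree oU C1 cl at_) => [s st|s st|].
  - by apply: tr1; exact: dom st.
  - by apply: tr2; exact: dom st.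
  - by rewrite e1 ?e2//; apply: dom => //; rewrite lexx.
pose E := [set T | exists y, good T y].
have ES0 : E S0%:E by exists x0; split=> // t /=; rewrite lte_fin => /traj0.
pose T := ereal_sup E.
have S0T : (S0%:E <= T)%E by exact: ereal_sup_ubound.
have /choice[Y HY] : forall t, exists y : R -> 'rV[R]_n, (t%:E < T)%E ->
    exists2 T', (t%:E < T')%E & good T' y.
  move=> t; have [tT|tT] := ltP t%:E T; last by exists x0.
  have [T' [y gy] tT'] := ereal_sup_gt tT.
  by exists y => _; exists T'.
pose x t := Y t t.
have xE T' y t : good T' y -> (t%:E < T')%E -> x t = y t.
  move=> gy tT'; have T'T : (T' <= T)%E by apply: ereal_sup_ubound; exists y.
  have [T2 tT2 gY] := HY t (lt_le_trans tT' T'T).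
  exact: agree gY gy tT2 tT'.
exists T, x; split=> //.
- move=> t /= tT; have [T' tT' gY] := HY t tT.
  have [Ut Dt] := gY.1 t tT'; split=> //.
  apply: near_eq_is_derive Dt.
  suff [d d0 Hd] : exists2 d : R, 0 < d & forall s, `|s - t| < d -> (s%:E < T')%E.
    apply/near_ball_real; exists d => // s sd; apply/esym.
    by rewrite (xE T' (Y t))//; exact: Hd.
  case: T' tT' {gY Ut} => [r| |]; rewrite ?lte_fin//.
    move=> tr; exists (r - t); first by rewrite subr_gt0.
    by move=> s; rewrite lte_fin ltr_norml; clear; lra.
  by exists 1 => // s _; rewrite ltry.
- move=> t tS; apply: (xE S0%:E x0); last by rewrite lte_fin.
  by split=> // s /=; rewrite lte_fin => /traj0.
- move=> T' y tr ag; apply: ereal_sup_ubound; exists y; split=> // t tS tT'.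
  rewrite ag//; last by apply: lt_le_trans S0T; rewrite lte_fin.
  apply: (xE S0%:E x0); last by rewrite lte_fin.
  by split=> // s /=; rewrite lte_fin => /traj0.
Qed.

Lemma pullback_attractor_exists (R : realType) (n : nat) (U : set 'rV[R]_n)
    (f : 'rV[R]_n * R -> 'rV[R]_n) (lm lp c d0 r : R) (L : R -> R)
    (q w : 'rV[R]_n) :
  open U -> C1_field U f -> kamke U f lm lp -> U q -> f (q, lm) = 0 ->
  vec_ll 0 w -> 0 < c -> 0 < d0 -> contracting f q lm w c d0 ->
  continuous L -> (forall t, lm < L t < lp) -> L s @[s --> -oo] --> lm -> 0 < r ->
  exists T x, pullback_attractor U f L r q T x.
Proof.
move=> oU C1 Kam Uq fq w0 c0 d00 Con cL Lb /cvg_ninfty_epsP Llim r0.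
have cl : continuous (fun t => L (r * t)).
  move=> t; apply: (cvg_comp (fun t => r * t) L _ (cL _)).
  by apply: cvgM; [exact: cvg_cst|exact: cvg_id].
have lb t : lm <= L (r * t) <= lp by have /andP[/ltW-> /ltW->] := Lb (r * t).
have llim e : 0 < e -> exists S, forall t, t <= S -> `|L (r * t) - lm| < e.
  move=> e0; have [S HS] := Llim e e0; exists (S / r) => t tS; apply: HS.
  by rewrite mulrC -ler_pdivlMr.
have [S [x0 [tr0 lim0]]] := pullback_local oU C1 Kam Uq fq w0 c0 d00 Con cl lb llim.
have [T [x [ST tr e0 maxT]]] := maximal_extension oU C1 cl tr0.
exists T, x; split=> //; first by apply: lt_le_trans ST; rewrite ltNyr.
apply/cvg_ninfty_epsP => e epos; have [T1 HT1] := lim0 e epos.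
exists (Num.min T1 (S - 1)) => t; rewrite le_min => /andP[t1 t2].
rewrite e0; first exact: HT1.
by move: t2; clear; lra.
Qed.

(** * Barriers *)

(** At a first contact [y] is above [b] and touches it in a coordinate [i]; by Kamke's condition its
    speed there is at least that of the field at [b], which exceeds the speed of [b]. *)
Lemma barrier (R : realType) (n : nat) (U : set 'rV[R]_n)
    (f : 'rV[R]_n * R -> 'rV[R]_n) (lm lp N : R) (l : R -> R)
    (y b db : R -> 'rV[R]_n) (s0 s1 : R) :
  kamke U f lm lp -> 0 < N ->
  (forall s, s0 <= s <= s1 -> lm <= l s <= lp) ->
  (forall s, s0 <= s <= s1 ->
     U (y s) /\ is_derive s (1 : R) y (N *: f (y s, l s))) ->
  (forall s, s0 <= s <= s1 -> U (b s) /\ is_derive s (1 : R) b (db s)) ->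
  (forall s i, s0 <= s <= s1 -> db s 0 i < N * f (b s, l s) 0 i) ->
  vec_ll (b s0) (y s0) -> forall s, s0 <= s <= s1 -> vec_ll (b s) (y s).
Proof.
move=> Kam N0 lb Hy Hb sub start s ss i; rewrite -subr_gt0.
apply: (stays_positive (phi := fun i s => y s 0 i - b s 0 i)
  (dphi := fun i s => N * f (y s, l s) 0 i - db s 0 i) _ _ _ ss) => {s ss i}.
- move=> i s ss; have [_ /is_derive_rowP/(_ i) Dy] := Hy s ss.
  have [_ /is_derive_rowP/(_ i) Db] := Hb s ss; rewrite mxE in Dy.
  exact: is_derive_eq.
- by move=> i; rewrite subr_gt0.
move=> i s /andP[/ltW s0s ss1] nn /eqP; rewrite subr_eq0 => /eqP E.
have ss : s0 <= s <= s1 by rewrite s0s.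
rewrite subr_gt0; apply: lt_le_trans (sub s i ss) _; rewrite ler_pM2l//.
apply: Kam; [exact: lb|exact: (Hb s ss).1|exact: (Hy s ss).1| |by []].
by move=> j; rewrite -subr_ge0.
Qed.

Lemma constant_barrier (R : realType) (n : nat) (U : set 'rV[R]_n)
    (f : 'rV[R]_n * R -> 'rV[R]_n) (lm lp N : R) (l : R -> R)
    (y : R -> 'rV[R]_n) (a : 'rV[R]_n) (s0 s1 : R) :
  kamke U f lm lp -> 0 < N ->
  (forall s, s0 <= s <= s1 -> lm <= l s <= lp) ->
  (forall s, s0 <= s <= s1 ->
     U (y s) /\ is_derive s (1 : R) y (N *: f (y s, l s))) ->
  U a -> (forall s i, s0 <= s <= s1 -> 0 < f (a, l s) 0 i) ->
  vec_ll a (y s0) -> s0 <= s1 -> vec_ll a (y s1).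
Proof.
move=> Kam N0 lb Hy Ua fa start s01.
apply: (barrier (b := fun=> a) (db := fun=> 0) Kam N0 lb Hy) => //.
- by move=> s _; split=> //; exact: is_derive_cst.
- by move=> s i ss; rewrite mxE mulr_gt0// fa.
- by rewrite s01 lexx.
Qed.

Lemma linear_barrier (R : realType) (n : nat) (U : set 'rV[R]_n)
    (f : 'rV[R]_n * R -> 'rV[R]_n) (lm lp N : R) (l : R -> R)
    (y : R -> 'rV[R]_n) (a v : 'rV[R]_n) (s0 s1 : R) :
  kamke U f lm lp -> 0 < N ->
  (forall s, s0 <= s <= s1 -> lm <= l s <= lp) ->
  (forall s, s0 <= s <= s1 ->
     U (y s) /\ is_derive s (1 : R) y (N *: f (y s, l s))) ->
  (forall tau s, 0 <= tau <= 1 -> s0 <= s <= s1 -> U (a + tau *: v) /\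
     forall i, v 0 i / (s1 - s0) < N * f (a + tau *: v, l s) 0 i) ->
  vec_ll a (y s0) -> s0 < s1 -> vec_ll (a + v) (y s1).
Proof.
move=> Kam N0 lb Hy sub start s01.
have ds : 0 < s1 - s0 by rewrite subr_gt0.
pose tau s := (s - s0) / (s1 - s0).
have tau01 s : s0 <= s <= s1 -> 0 <= tau s <= 1.
  move=> /andP[h1 h2]; rewrite /tau ler_pdivrMr// mul1r lerD2r h2 andbT.
  by rewrite divr_ge0 ?subr_ge0// ltW.
have -> : a + v = a + tau s1 *: v by rewrite /tau divff ?gt_eqF// scale1r.
apply: (barrier (b := fun s => a + tau s *: v)
  (db := fun=> (s1 - s0)^-1 *: v) Kam N0 lb Hy).
- move=> s ss; split; first exact: (sub _ s (tau01 s ss) ss).1.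
  apply/is_derive_rowP => i; under eq_fun do rewrite !mxE.
  by apply: is_derive_eq; rewrite !mxE /GRing.scale /=; ring.
- by move=> s i ss; rewrite mxE mulrC; exact: (sub _ s (tau01 s ss) ss).2.
- by rewrite /tau subrr mul0r scale0r addr0.
- by rewrite ltW//= lexx.
Qed.

(** * Corners at equilibria and tipping at large rates *)

Definition has_contraction (R : realType) (n : nat)
    (f : 'rV[R]_n * R -> 'rV[R]_n) (x : 'rV[R]_n) (l : R) : Prop :=
  exists w c d, [/\ vec_ll 0 w, 0 < c, 0 < d & contracting f x l w c d].

Definition has_expansion (R : realType) (n : nat)
    (f : 'rV[R]_n * R -> 'rV[R]_n) (x : 'rV[R]_n) (l : R) : Prop :=
  exists w c d, [/\ vec_ll 0 w, 0 < c, 0 < d & expanding f x l w c d].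

Definition field_cont (R : realType) (n : nat) (U : set 'rV[R]_n)
    (f : 'rV[R]_n * R -> 'rV[R]_n) : Prop :=
  forall x l, U x -> {for (x, l), continuous f}.

Lemma field_pos_near (R : realType) (n : nat) (U : set 'rV[R]_n)
    (f : 'rV[R]_n * R -> 'rV[R]_n) (z : 'rV[R]_n) (l0 k : R) :
  field_cont U f -> U z -> (forall i, k < f (z, l0) 0 i) ->
  exists2 d : R, 0 < d & forall l, `|l - l0| < d -> forall i, k < f (z, l) 0 i.
Proof.
move=> cf Uz fz.
have : \forall x \near (z, l0), forall i, k < f x 0 i.
  apply: (@filter_forall _ _ (fun i x => k < f x 0 i) (nbhs (z, l0))) => i.
  have cfi := coord_cont (i := i) (cf z l0 Uz).
  by have /cvgr_gt/(_ _ (fz i)) := cfi.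
move=> /near_ball_pair[d d0 H]; exists d => // l ld; apply: H => //.
by rewrite subrr normr0.
Qed.

Lemma row_scale_norm (R : realType) (n : nat) (w : 'rV[R]_n) (W th : R) :
  0 < W -> vec_ll 0 w -> (forall i, w 0 i < W) -> `|th *: w| <= `|th| * W.
Proof.
move=> W0 w0 wW; apply: norm_le_coord => [|i]; first by rewrite mulr_ge0// ltW.
rewrite mxE normrM ler_wpM2l// ger0_norm ?ltW//.
by have := w0 i; rewrite mxE.
Qed.

(** The corner is [q - th *: w]. Contraction makes the field at least [c * th] in every coordinate
    there, and by continuity still positive for nearby parameters, so the corner is a barrier that
    does not move. *)
Lemma contraction_corner (R : realType) (n : nat) (U : set 'rV[R]_n)
    (f : 'rV[R]_n * R -> 'rV[R]_n) (q : 'rV[R]_n) (l0 e : R) :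
  open U -> field_cont U f -> U q -> f (q, l0) = 0 -> has_contraction f q l0 ->
  0 < e ->
  exists a d, [/\ 0 < d, U a, vec_ll a q, forall i, q 0 i - e < a 0 i &
    forall l, `|l - l0| < d -> forall i, 0 < f (a, l) 0 i].
Proof.
move=> oU cf Uq fq [w [c [d0 [w0 c0 d00 Con]]]] e0.
have [d1 d10 bU] := open_ball_sub oU Uq.
have [W W0 wW] := finite_upper_bound (fun i => w 0 i).
have [r r0 [rd0 rd1 re]] : exists2 r, 0 < r & [/\ r < d0, r < d1 & r < e].
  have : \forall r \near (0 : R)^'+, [/\ 0 < r, r < d0, r < d1 & r < e].
    by near=> r; split; near: r; [exact: nbhs_right_gt|exact: nbhs_right_lt..].
  by move=> /filter_ex[r [? ? ? ?]]; exists r.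
pose th := r / W; have th0 : 0 < th by rewrite divr_gt0.
have thW : th * W = r by rewrite /th divfK// gt_eqF.
have wi i : 0 < w 0 i by have := w0 i; rewrite mxE.
have aq : `|q - th *: w - q| <= r.
  rewrite addrAC subrr sub0r normrN -thW.
  by have := row_scale_norm th W0 w0 wW; rewrite ger0_norm// ltW.
have Ua : U (q - th *: w) by apply: bU; exact: le_lt_trans rd1.
have pos i : 0 < f (q - th *: w, l0) 0 i.
  have := Con (q - th *: w) th l0 i (ltW th0).
  rewrite subrK subrr subrr !normr0 fq mxE add0r => /(_ (le_lt_trans aq rd0) d00 d00).
  by apply: lt_le_trans; rewrite mulr_gt0.
have [d d_gt0 Hd] := field_pos_near cf Ua pos.
exists (q - th *: w), d; split=> // i; rewrite !mxE.
  by rewrite gtrBl mulr_gt0.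
by rewrite ltrD2l ltrN2 (lt_trans _ re)// -thW ltr_pM2l.
Unshelve. all: by end_near. Qed.

(** The corner [q + th *: w] above the equilibrium also has a positive field: a solution above it
    stays clear of [q] while the parameter is close to [l0]. *)
Lemma expansion_corner (R : realType) (n : nat) (U : set 'rV[R]_n)
    (f : 'rV[R]_n * R -> 'rV[R]_n) (q : 'rV[R]_n) (l0 e : R) :
  open U -> field_cont U f -> U q -> f (q, l0) = 0 -> has_expansion f q l0 ->
  0 < e ->
  exists a d, [/\ 0 < d, U a, vec_ll q a, forall i, a 0 i < q 0 i + e &
    forall l, `|l - l0| < d -> forall i, 0 < f (a, l) 0 i].
Proof.
move=> oU cf Uq fq [w [c [d0 [w0 c0 d00 Exp]]]] e0.
have [d1 d10 bU] := open_ball_sub oU Uq.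
have [W W0 wW] := finite_upper_bound (fun i => w 0 i).
have [r r0 [rd0 rd1 re]] : exists2 r, 0 < r & [/\ r < d0, r < d1 & r < e].
  have : \forall r \near (0 : R)^'+, [/\ 0 < r, r < d0, r < d1 & r < e].
    by near=> r; split; near: r; [exact: nbhs_right_gt|exact: nbhs_right_lt..].
  by move=> /filter_ex[r [? ? ? ?]]; exists r.
pose th := r / W; have th0 : 0 < th by rewrite divr_gt0.
have thW : th * W = r by rewrite /th divfK// gt_eqF.
have wi i : 0 < w 0 i by have := w0 i; rewrite mxE.
have aq : `|q + th *: w - q| <= r.
  rewrite addrAC subrr add0r -thW.
  by have := row_scale_norm th W0 w0 wW; rewrite ger0_norm// ltW.
have Ua : U (q + th *: w) by apply: bU; exact: le_lt_trans rd1.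
have pos i : 0 < f (q + th *: w, l0) 0 i.
  have := Exp q th l0 i (ltW th0).
  rewrite !subrr !normr0 fq mxE add0r => /(_ d00 (le_lt_trans aq rd0) d00).
  by apply: lt_le_trans; rewrite mulr_gt0.
have [d d_gt0 Hd] := field_pos_near cf Ua pos.
exists (q + th *: w), d; split=> // i; rewrite !mxE.
  by rewrite ltrDl mulr_gt0.
by rewrite ltrD2l (lt_trans _ re)// -thW ltr_pM2l.
Unshelve. all: by end_near. Qed.

Lemma field_bounded_segment (R : realType) (n : nat) (U : set 'rV[R]_n)
    (f : 'rV[R]_n * R -> 'rV[R]_n) (a v : 'rV[R]_n) (lm lp : R) :
  field_cont U f -> (forall tau, 0 <= tau <= 1 -> U (a + tau *: v)) ->
  exists2 M, 0 < M & forall tau l, 0 <= tau <= 1 -> lm <= l <= lp ->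
    `|f (a + tau *: v, l)| < M.
Proof.
move=> cf Us; have [lmp|lpm] := leP lm lp; last first.
  by exists 1 => // tau l _ ll; exfalso; move: ll lpm; clear; lra.
pose A : set (R * R) := `[0, 1] `*` `[lm, lp].
pose g (z : R * R) := `|f (a + z.1 *: v, z.2)|.
have cA : compact A by apply: compact_setX; exact: segment_compact.
have A0 : A !=set0 by exists (0, lm); split; rewrite /= in_itv/= lexx ?ler01.
have cg : {within A, continuous g}.
  apply: continuous_in_subspaceT => z /set_mem[/= + _]; rewrite in_itv/= => z01.
  have Uz := Us _ z01.
  have c1 : (fun z : R * R => a + z.1 *: v) x @[x --> z] --> a + z.1 *: v.
    by apply: cvgD; [exact: cvg_cst|apply: cvgZr_tmp; exact: cvg_fst].
  have c2 : (fun z : R * R => z.2) x @[x --> z] --> z.2 by exact: cvg_snd.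
  have cp : (fun z : R * R => (a + z.1 *: v, z.2)) x @[x --> z] --> (a + z.1 *: v, z.2).
    exact: (cvg_pair c1 c2).
  apply: cvg_norm; exact: (cvg_comp (fun z : R * R => (a + z.1 *: v, z.2)) f cp (cf _ _ Uz)).
have [z Az Hz] := compact_EVT_max A0 cA cg.
exists (g z + 1) => [|tau l t01 ll]; first by rewrite ltr_wpDl// normr_ge0.
apply: (@le_lt_trans _ _ (g z)); last by rewrite ltrDl.
by apply: (Hz (tau, l)); apply/mem_set; split; rewrite /= in_itv.
Qed.

(** A bound on how far a solution can fall in a short time. The barrier descends the diagonal from
    [a] to [a - g] faster than the field on that segment can push, so only the size of the field on
    the segment enters, wherever the solution goes. *)
Lemma drop_barrier (R : realType) (n : nat) (U : set 'rV[R]_n)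
    (f : 'rV[R]_n * R -> 'rV[R]_n) (lm lp : R) (a : 'rV[R]_n) (g : R) :
  kamke U f lm lp -> field_cont U f ->
  (forall tau, 0 <= tau <= 1 -> U (a + tau *: const_mx (- g))) ->
  0 < g ->
  exists2 M, 0 < M & forall N l y s0 s1, 0 < N -> s0 < s1 ->
    N * M * (s1 - s0) <= g ->
    (forall s, s0 <= s <= s1 -> lm <= l s <= lp) ->
    (forall s, s0 <= s <= s1 ->
       U (y s) /\ is_derive s (1 : R) y (N *: f (y s, l s))) ->
    vec_ll a (y s0) -> forall i, a 0 i - g < y s1 0 i.
Proof.
move=> Kam cf Us g0; have [M M0 HM] := field_bounded_segment lm lp cf Us.
exists M => // N l y s0 s1 N0 s01 Ng lb Hy start i.
have ds : 0 < s1 - s0 by rewrite subr_gt0.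
have := linear_barrier (v := const_mx (- g)) Kam N0 lb Hy _ start s01.
move=> H; have {}H := H _ i; rewrite 2!mxE in H; apply: H => tau s t01 ss.
split=> [|j]; first exact: Us.
rewrite mxE ltr_pdivrMr//.
have fj : - M < f (a + tau *: const_mx (- g), l s) 0 j.
  have := le_lt_trans (coord_le_norm _ j) (HM tau (l s) t01 (lb s ss)).
  by rewrite ltr_norml => /andP[].
have : N * (s1 - s0) * - M < N * (s1 - s0) * f (a + tau *: const_mx (- g), l s) 0 j.
  by rewrite ltr_pM2l// mulr_gt0.
by move: Ng; rewrite -!mulrA ![(s1 - s0) * _]mulrC !mulrA mulrN; clear; lra.
Qed.

Lemma is_derive_affine_time (R : realType) (n : nat) (x : R -> 'rV[R]_n)
    (v : 'rV[R]_n) (al be s : R) :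
  is_derive (al * s + be) (1 : R) x v ->
  is_derive s (1 : R) (fun s => x (al * s + be)) (al *: v).
Proof.
move=> /is_derive_rowP H; apply/is_derive_rowP => i; have Hi := H i.
have D : is_derive s (1 : R) (fun s => al * s + be) al.
  by apply: is_derive_eq; rewrite /GRing.scale /=; ring.
apply: (is_derive_eq (is_derive1_comp (f := fun t => x t 0 i) (g := fun s => al * s + be) _ _)).
by rewrite mxE /GRing.scale /= mulrC.
Qed.

Lemma cvg_ninfty_affine_time (R : realType) (V : normedModType R) (x : R -> V)
    (q : V) (al be : R) : 0 < al ->
  x t @[t --> -oo] --> q -> x (al * s + be) @[s --> -oo] --> q.
Proof.
move=> al0 /cvg_ninfty_epsP H; apply/cvg_ninfty_epsP => e e0.
have [T HT] := H e e0; exists ((T - be) / al) => t; rewrite ler_pdivlMr// => tT.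
by apply: HT; rewrite mulrC; move: tT; clear; lra.
Qed.

Lemma cvg_pinfty_affine_time (R : realType) (V : normedModType R) (x : R -> V)
    (q : V) (al be : R) : 0 < al ->
  x t @[t --> +oo] --> q -> x (al * s + be) @[s --> +oo] --> q.
Proof.
move=> al0 /cvg_pinfty_epsP H; apply/cvg_pinfty_epsP => e e0.
have [T HT] := H e e0; exists ((T - be) / al) => t; rewrite ler_pdivrMr// => tT.
by apply: HT; rewrite mulrC; move: tT; clear; lra.
Qed.

Lemma vec_ll_gap (R : realType) (n : nat) (a b : 'rV[R]_n) :
  vec_ll a b -> exists2 g, 0 < g & forall i, a 0 i + g < b 0 i.
Proof.
move=> ab; have ab' i : 0 < b 0 i - a 0 i by rewrite subr_gt0.
have [g g0 Hg] := finite_pos_lower_bound ab'.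
by exists g => // i; rewrite addrC -ltrBrDr.
Qed.

Lemma dist_coord (R : realType) (n : nat) (x y : 'rV[R]_n) (e : R) i :
  `|x - y| < e -> `|x 0 i - y 0 i| < e.
Proof. by apply: le_lt_trans; have := coord_le_norm (x - y) i; rewrite !mxE. Qed.

Lemma past_above_corner (R : realType) (n : nat) (U : set 'rV[R]_n)
    (f : 'rV[R]_n * R -> 'rV[R]_n) (lm lp N S : R) (L : R -> R)
    (q a : 'rV[R]_n) (y : R -> 'rV[R]_n) :
  kamke U f lm lp -> (forall s, lm <= L s <= lp) -> 0 < N -> U a -> vec_ll a q ->
  (forall s, s <= S -> forall i, 0 < f (a, L s) 0 i) ->
  (forall s, s <= S -> U (y s) /\ is_derive s (1 : R) y (N *: f (y s, L s))) ->
  y s @[s --> -oo] --> q -> forall s, s <= S -> vec_ll a (y s).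
Proof.
move=> Kam lb N0 Ua aq fa Hy /cvg_ninfty_epsP lim s sS.
have [g g0 Hg] := vec_ll_gap aq; have [T HT] := lim g g0.
have t0s : Num.min T s <= s by rewrite ge_min lexx orbT.
have t0T : Num.min T s <= T by rewrite ge_min lexx.
apply: (constant_barrier (s0 := Num.min T s) (l := L) Kam N0) => //.
- by move=> t /andP[_ ts]; apply: Hy; exact: le_trans sS.
- by move=> t i /andP[_ ts]; apply: fa; exact: le_trans sS.
move=> i; have := dist_coord i (HT _ t0T); have := Hg i.
by rewrite ltr_norml; clear; lra.
Qed.

(** The corner separates the solution from [q] forever. The argument ['I_n] provides a coordinate in
    which to read this: without one, [vec_ll] would be vacuous. *)
Lemma future_above_corner (R : realType) (n : nat) (U : set 'rV[R]_n)
    (f : 'rV[R]_n * R -> 'rV[R]_n) (lm lp N S : R) (L : R -> R)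
    (b q : 'rV[R]_n) (y : R -> 'rV[R]_n) :
  'I_n -> kamke U f lm lp -> (forall s, lm <= L s <= lp) -> 0 < N ->
  U b -> vec_ll q b ->
  (forall s, S <= s -> forall i, 0 < f (b, L s) 0 i) ->
  (forall s, S <= s -> U (y s) /\ is_derive s (1 : R) y (N *: f (y s, L s))) ->
  vec_ll b (y S) -> ~ (y s @[s --> +oo] --> q).
Proof.
move=> i Kam lb N0 Ub qb fb Hy start /cvg_pinfty_epsP lim.
have [g g0 Hg] := vec_ll_gap qb; have [T HT] := lim g g0.
pose t := Num.max T S.
have tT : T <= t by rewrite le_max lexx.
have tS : S <= t by rewrite le_max lexx orbT.
have : vec_ll b (y t).
  apply: (constant_barrier (s0 := S) (l := L) Kam N0) => //.
  - by move=> s /andP[Ss _]; exact: Hy.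
  - by move=> s j /andP[Ss _]; exact: fb.
move=> /(_ i); have := dist_coord i (HT _ tT); have := Hg i.
by rewrite ltr_norml => h1 h2 h3; suff : false by []; move: h1 h2 h3; clear; lra.
Qed.

Lemma tipping_at_large_rates (R : realType) (n : nat) (U : set 'rV[R]_n)
    (f : 'rV[R]_n * R -> 'rV[R]_n) (lm lp : R) (L : R -> R)
    (qm qp pp : 'rV[R]_n) :
  'I_n -> open U -> field_cont U f -> kamke U f lm lp ->
  (forall s, lm <= L s <= lp) ->
  L s @[s --> -oo] --> lm -> L s @[s --> +oo] --> lp ->
  U qm -> f (qm, lm) = 0 -> has_contraction f qm lm ->
  U pp -> f (pp, lp) = 0 -> has_expansion f pp lp ->
  vec_ll qp pp -> vec_ll pp qm ->
  exists2 r0, 0 < r0 & forall r, r0 < r -> forall x,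
    trajectory U (shifted_field f L r) setT x ->
    x t @[t --> -oo] --> qm -> ~ (x t @[t --> +oo] --> qp).
Proof.
move=> i0 oU cf Kam lb /cvg_ninfty_epsP Lm /cvg_pinfty_epsP Lp Uq fq conq Up fp expp qp_pp pp_qm.
have [g g0 Hg] := vec_ll_gap pp_qm.
have [d d0 bU] := open_ball_sub oU Uq.
(* [g / 4]: the solution ends above a point within [2 * e] of [qm], the corner at [pp] lies within
   [e] of [pp], and [3 * e < g]. [d / 4] keeps the falling barrier in [U]. *)
pose e := Num.min (g / 4) (d / 4).
have e0 : 0 < e by rewrite lt_min !divr_gt0.
have eg : e <= g / 4 by rewrite ge_min lexx.
have ed : e <= d / 4 by rewrite ge_min lexx orbT.
clearbody e.
have [a [da [da0 Ua aq qa fa]]] := contraction_corner oU cf Uq fq conq e0.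
have [b [db [db0 Ub pb bp fb]]] := expansion_corner oU cf Up fp expp e0.
have [S HS] := Lm da da0; have [S1' HS1] := Lp db db0.
pose S1 := Num.max S1' (S + 1).
have S1S : S < S1 by rewrite lt_max ltrDl ltr01 orbT.
have {}HS1 s : S1 <= s -> `|L s - lp| < db.
  by rewrite ge_max => /andP[/HS1].
clearbody S1.
have Us tau : 0 <= tau <= 1 -> U (a + tau *: const_mx (- e)).
  move=> /andP[t0 t1]; apply: bU; apply: (@le_lt_trans _ _ (d / 2)); last first.
    by move: d0; clear; lra.
  apply: norm_le_coord => [|i]; first by rewrite divr_ge0// ltW.
  have te : tau * e <= e by rewrite ler_piMl// ltW.
  have te0 : 0 <= tau * e by rewrite mulr_ge0// ltW.
  have := aq i; have := qa i; rewrite !mxE mulrN ler_norml.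
  by move: te te0 ed e0 d0; clear; lra.
have [M M0 drop] := drop_barrier Kam cf Us e0.
have ds : 0 < S1 - S by rewrite subr_gt0.
(* The condition of [drop] for [N = 1 / r] on the transition interval from [S] to [S1]. *)
exists (M * (S1 - S) / e); first by rewrite divr_gt0// mulr_gt0.
move=> r rr x tr xm xp.
have r0 : 0 < r by apply: lt_trans rr; rewrite divr_gt0// mulr_gt0.
have N0 : 0 < r^-1 by rewrite invr_gt0.
pose y s := x (r^-1 * s + 0).
have Hy s : U (y s) /\ is_derive s (1 : R) y (r^-1 *: f (y s, L s)).
  have [Ux Dx] := tr (r^-1 * s + 0) I; split=> //.
  have := is_derive_affine_time Dx.
  by rewrite /shifted_field /y addr0 mulrA mulfV ?gt_eqF// mul1r.
have ym : y s @[s --> -oo] --> qm by exact: cvg_ninfty_affine_time.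
have yp : y s @[s --> +oo] --> qp by exact: cvg_pinfty_affine_time.
have yS : vec_ll a (y S).
  apply: (past_above_corner Kam lb N0 Ua aq _ _ ym (lexx S)) => [s sS|s _]; last exact: Hy.
  by apply: fa; exact: HS.
have yS1 : forall i, a 0 i - e < y S1 0 i.
  apply: (drop r^-1 L y S S1 N0 S1S) => //.
  rewrite -mulrA mulrC ler_pdivrMr// -ler_pdivrMl// mulrC.
  exact: ltW.
apply: (future_above_corner i0 Kam lb N0 Ub _ _ (S := S1) _ _ yp).
- by move=> i; exact: lt_trans (qp_pp i) (pb i).
- by move=> s /HS1; exact: fb.
- by move=> s _; exact: Hy.
- move=> i; have := yS1 i; have := bp i; have := qa i; have := Hg i.
  by move: eg g0; clear; lra.
Qed.

(** * Slow passage along a path *)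

(** One threshold [N0] serves every member of [Sol], so the speed can be fixed before a particular
    solution is considered. *)
Definition eventually_above (R : realType) (n : nat)
    (Sol : R -> (R -> 'rV[R]_n) -> Prop) (s : R) (a : 'rV[R]_n) : Prop :=
  exists N0, forall N y, N0 < N -> Sol N y -> vec_ll a (y s).

(* [Sol N y] is a family of solutions, on the times in [D], of the system
   written in the time of the parameter path, where [N] is the inverse of the
   speed at which the path is followed. *)
Definition slow_family (R : realType) (n : nat) (U : set 'rV[R]_n)
    (f : 'rV[R]_n * R -> 'rV[R]_n) (L : R -> R) (D : set R)
    (Sol : R -> (R -> 'rV[R]_n) -> Prop) : Prop :=
  forall N y, Sol N y -> 0 < N /\
    forall s, D s -> U (y s) /\ is_derive s (1 : R) y (N *: f (y s, L s)).

Lemma eventually_above_le (R : realType) (n : nat)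
    (Sol : R -> (R -> 'rV[R]_n) -> Prop) (s : R) (a b : 'rV[R]_n) :
  vec_le b a -> eventually_above Sol s a -> eventually_above Sol s b.
Proof.
move=> ba [N0 H]; exists N0 => N y NN Sy i.
exact: le_lt_trans (ba i) (H N y NN Sy i).
Qed.

Lemma eventually_above_hold (R : realType) (n : nat) (U : set 'rV[R]_n)
    (f : 'rV[R]_n * R -> 'rV[R]_n) (lm lp : R) (L : R -> R) (D : set R)
    (Sol : R -> (R -> 'rV[R]_n) -> Prop) (s1 s2 : R) (a : 'rV[R]_n) :
  kamke U f lm lp -> (forall s, lm <= L s <= lp) -> slow_family U f L D Sol ->
  s1 <= s2 -> (forall s, s1 <= s <= s2 -> D s) -> U a ->
  (forall s, s1 <= s <= s2 -> forall i, 0 < f (a, L s) 0 i) ->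
  eventually_above Sol s1 a -> eventually_above Sol s2 a.
Proof.
move=> Kam lb fam s12 dom Ua fa [N0 H]; exists N0 => N y NN Sy.
have [Npos Hy] := fam N y Sy.
apply: (constant_barrier (s0 := s1) (l := L) Kam Npos) => //.
- by move=> s /dom; exact: Hy.
- by move=> s i ss; exact: fa.
- exact: H N y NN Sy.
Qed.

(** A barrier may be moved by [v] in any time interval, however short: a field of at least [k] along
    the way outruns it once [N * k] exceeds the required speed. *)
Lemma eventually_above_ramp (R : realType) (n : nat) (U : set 'rV[R]_n)
    (f : 'rV[R]_n * R -> 'rV[R]_n) (lm lp : R) (L : R -> R) (D : set R)
    (Sol : R -> (R -> 'rV[R]_n) -> Prop) (s1 s2 k : R) (a v : 'rV[R]_n) :
  kamke U f lm lp -> (forall s, lm <= L s <= lp) -> slow_family U f L D Sol ->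
  s1 < s2 -> (forall s, s1 <= s <= s2 -> D s) -> 0 < k ->
  (forall tau s, 0 <= tau <= 1 -> s1 <= s <= s2 -> U (a + tau *: v) /\
     forall i, k <= f (a + tau *: v, L s) 0 i) ->
  eventually_above Sol s1 a -> eventually_above Sol s2 (a + v).
Proof.
move=> Kam lb fam s12 dom k0 H1 [N0 H].
have [V V0 HV] := finite_upper_bound (fun i => v 0 i / (s2 - s1)).
exists (Num.max N0 (V / k)) => N y; rewrite gt_max => /andP[NN NV] Sy.
have [Npos Hy] := fam N y Sy.
apply: (linear_barrier (l := L) Kam Npos _ _ _ (H N y NN Sy) s12) => //.
- by move=> s /dom; exact: Hy.
move=> tau s t01 ss; have [Ut ft] := H1 tau s t01 ss; split=> // i.
apply: (lt_trans (HV i)); move: NV; rewrite ltr_pdivrMr// => NV.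
by apply: (lt_le_trans NV); rewrite ler_pM2l.
Qed.

(** Margins are along the constant row rather than a local [w], so the property can be handed from
    one neighbourhood to the next. Tracking asks for every margin, [stays_above] for just one. *)
Definition tracks_below (R : realType) (n : nat)
    (Sol : R -> (R -> 'rV[R]_n) -> Prop) (q : R -> 'rV[R]_n) (s : R) : Prop :=
  forall eta, 0 < eta -> eventually_above Sol s (q s - const_mx eta).

Definition stays_above (R : realType) (n : nat)
    (Sol : R -> (R -> 'rV[R]_n) -> Prop) (p : R -> 'rV[R]_n) (s : R) : Prop :=
  exists2 m, 0 < m & eventually_above Sol s (p s + const_mx m).

Lemma field_near_equilibrium (R : realType) (n : nat) (U : set 'rV[R]_n)
    (f : 'rV[R]_n * R -> 'rV[R]_n) (L : R -> R) (x : 'rV[R]_n) (s e : R) :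
  field_cont U f -> U x -> {for s, continuous L} -> f (x, L s) = 0 -> 0 < e ->
  exists2 r : R, 0 < r & forall t, `|t - s| < r -> forall i, - e < f (x, L t) 0 i.
Proof.
move=> cf Ux cL fx e0.
have H i : - e < f (x, L s) 0 i by rewrite fx mxE oppr_lt0.
have [d d0 Hd] := field_pos_near cf Ux H.
move/cvgrPdist_lt : cL => /(_ _ d0)/near_ball_real[r r0 Hr].
by exists r => // t tr; apply: Hd; rewrite distrC; exact: Hr.
Qed.

(** Being above a fixed corner up to time [s] improves to tracking at [s]: the barrier ramps from
    [q s - 2 th w] up to [q s - th1 w] with [th1] as small as wanted, contraction giving a positive
    field on the way. The centre [(x0, l0)] may be a point of the path or its limit. *)
Lemma tracking_local (R : realType) (n : nat) (U : set 'rV[R]_n)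
    (f : 'rV[R]_n * R -> 'rV[R]_n) (lm lp : R) (L : R -> R) (D : set R)
    (Sol : R -> (R -> 'rV[R]_n) -> Prop) (q : R -> 'rV[R]_n)
    (x0 : 'rV[R]_n) (l0 : R) :
  open U -> field_cont U f -> kamke U f lm lp -> (forall s, lm <= L s <= lp) ->
  slow_family U f L D Sol -> continuous L ->
  (forall s, U (q s) /\ f (q s, L s) = 0) ->
  U x0 -> f (x0, l0) = 0 -> has_contraction f x0 l0 ->
  exists a d, [/\ 0 < d, U a, forall y, `|y - x0| < d -> vec_ll a y,
    forall l, `|l - l0| < d -> forall i, 0 < f (a, l) 0 i &
    forall s1 s, s1 < s -> `|q s - x0| < d ->
      (forall t, s1 <= t <= s -> [/\ D t, `|L t - l0| < d & eventually_above Sol t a]) ->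
      tracks_below Sol q s].
Proof.
move=> oU cf Kam lb fam cL Hq Ux fx [w [c [d0 [w0 c0 d00 Con]]]].
have [d1 d10 bU] := open_ball_sub oU Ux.
have [W W0 wW] := finite_upper_bound (fun i => w 0 i).
have wi i : 0 < w 0 i by have := w0 i; rewrite mxE.
have [m m0 wm] := finite_pos_lower_bound wi.
have [r r0 [rd0 rd1]] : exists2 r, 0 < r & r < d0 / 2 /\ r < d1 / 2.
  have : \forall r \near (0 : R)^'+, [/\ 0 < r, r < d0 / 2 & r < d1 / 2].
    by near=> r; split; near: r; [exact: nbhs_right_gt|apply: nbhs_right_lt; rewrite divr_gt0//..].
  by move=> /filter_ex[r [? ? ?]]; exists r.
pose th := r / W / 2; have th0 : 0 < th by rewrite !divr_gt0.
have thW : 2 * th * W = r by rewrite /th; field; rewrite gt_eqF.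
clearbody th.
have near_x0 y t : `|y - x0| < r -> 0 <= t <= 2 * th ->
    `|y - t *: w - x0| < d0 /\ U (y - t *: w).
  move=> yr /andP[t0 t1].
  have H : `|y - t *: w - x0| < 2 * r.
    have := row_scale_norm t W0 w0 wW; rewrite ger0_norm// => h1.
    have h2 : t * W <= r by rewrite -thW ler_wpM2r// ltW.
    rewrite addrAC (le_lt_trans (ler_normB _ _))//.
    by move: h1 h2 yr; clear; lra.
  split; first by move: H rd0; clear; lra.
  by apply: bU; move: H rd1; clear; lra.
have x0x0 : `|x0 - x0| < r by rewrite subrr normr0.
have thin : 0 <= th <= 2 * th by move: th0; clear; lra.
have [ad0 Ua] := near_x0 x0 th x0x0 thin.
have pos i : 0 < f (x0 - th *: w, l0) 0 i.
  have := Con (x0 - th *: w) th l0 i (ltW th0).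
  rewrite subrK !subrr !normr0 fx mxE add0r => /(_ ad0 d00 d00).
  by apply: lt_le_trans; rewrite mulr_gt0.
have [da da0 Hd] := field_pos_near cf Ua pos.
(* With [d <= th * m] and [m] below all [w_i], the [d]-ball lies above the corner, and the start
   [q s - 2 th w] of the ramp lies below it. *)
pose d := Num.min (Num.min da d0) (Num.min r (th * m)).
have d_gt0 : 0 < d by rewrite !lt_min da0 d00 r0 mulr_gt0.
have [dda ddd0 dr dm] : [/\ d <= da, d <= d0, d <= r & d <= th * m].
  by rewrite /d; split; rewrite !ge_min lexx ?orbT.
clearbody d.
have cmp y i : `|y - x0| < d -> x0 0 i - th * w 0 i < y 0 i.
  move=> yd; have := dist_coord i yd.
  have : th * m < th * w 0 i by rewrite ltr_pM2l.
  by rewrite ltr_norml; move: dm; clear; lra.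
exists (x0 - th *: w), d; split=> //.
- by move=> y yd i; rewrite !mxE; exact: cmp.
- by move=> l ld; apply: Hd; exact: lt_le_trans dda.
move=> s1 s s1s qs Hs eta eta0.
have [Uqs fqs] := Hq s.
pose th1 := Num.min th (eta / W).
have th10 : 0 < th1 by rewrite lt_min th0 divr_gt0.
have th1th : th1 <= th by rewrite ge_min lexx.
have th1W : th1 * W <= eta by rewrite -ler_pdivlMr// ge_min lexx orbT.
clearbody th1.
have k0 : 0 < c * th1 / 2 by rewrite divr_gt0// mulr_gt0.
have [rho rho0 Hrho] := field_near_equilibrium cf Uqs (cL s) fqs k0.
(* Close enough to [s] that [f (q s, L t)] costs at most half of the gain [c * th1]. *)
pose s0 := Num.max s1 (s - rho / 2).
have s0s : s0 < s by rewrite gt_max s1s gtrBl divr_gt0.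
have s1s0 : s1 <= s0 by rewrite le_max lexx.
have s0rho : s - rho / 2 <= s0 by rewrite le_max lexx orbT.
clearbody s0.
have sub t : s0 <= t <= s -> s1 <= t <= s.
  by move=> /andP[h1 ->]; rewrite (le_trans s1s0 h1).
have [D0 _ A0] := Hs s0 (sub s0 (introT andP (conj (lexx _) (ltW s0s)))).
have start : eventually_above Sol s0 (q s - (2 * th) *: w).
  apply: eventually_above_le A0 => i; rewrite !mxE.
  have := dist_coord i qs; have : th * m < th * w 0 i by rewrite ltr_pM2l.
  by rewrite ltr_norml; move: dm; clear; lra.
have ramp : eventually_above Sol s (q s - (2 * th) *: w + (2 * th - th1) *: w).
  apply: (eventually_above_ramp Kam lb fam s0s _ k0 _ start).
    by move=> t /sub/Hs[].
  move=> tau t /andP[tau0 tau1] ts.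
  pose th2 := 2 * th - tau * (2 * th - th1).
  have E : q s - (2 * th) *: w + tau *: ((2 * th - th1) *: w) = q s - th2 *: w.
    rewrite scalerA -addrA -[- (_ *: w)]scaleNr -[- (th2 *: w)]scaleNr -scalerDl.
    congr (_ + _ *: _).
    by rewrite /th2; ring.
  have th2b : th1 <= th2 <= 2 * th.
    have h : 0 <= 2 * th - th1 by move: th1th th0; clear; lra.
    have := mulr_ge0 tau0 h; have : tau * (2 * th - th1) <= 2 * th - th1 by rewrite ler_piMl.
    by rewrite /th2; clear; lra.
  have th2p : 0 <= th2 <= 2 * th by move: th2b th10; clear; lra.
  rewrite E; have [qd Uq] := near_x0 (q s) th2 (lt_le_trans qs dr) th2p.
  split=> // i; have [_ Lt _] := Hs t (sub t ts).
  have := Con (q s - th2 *: w) th2 (L t) i (proj1 (andP th2p)) qd.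
  rewrite subrK => /(_ (lt_le_trans qs ddd0) (lt_le_trans Lt ddd0)).
  have trho : `|t - s| < rho by move: ts s0rho rho0; rewrite ltr_norml; clear; lra.
  have := Hrho t trho i.
  have : c * th1 <= c * th2 by rewrite ler_pM2l//; case/andP: th2b.
  by clear; lra.
apply: eventually_above_le ramp => i; rewrite !mxE.
have : th1 * w 0 i <= th1 * W by rewrite ler_wpM2l ?ltW.
by move: th1W; rewrite mulrBl; clear; lra.
Unshelve. all: by end_near. Qed.

(** Under slow enough passage any margin above [p] grows to the fixed corner [x0 + th *: w] within
    any given time interval: the barrier ramps from [p s1 + th1 w] to [p s1 + 2 th w], and expansion
    keeps the field positive on the way. *)
Lemma departure_local (R : realType) (n : nat) (U : set 'rV[R]_n)
    (f : 'rV[R]_n * R -> 'rV[R]_n) (lm lp : R) (L : R -> R) (D : set R)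
    (Sol : R -> (R -> 'rV[R]_n) -> Prop) (p : R -> 'rV[R]_n)
    (x0 : 'rV[R]_n) (l0 : R) :
  open U -> field_cont U f -> kamke U f lm lp -> (forall s, lm <= L s <= lp) ->
  slow_family U f L D Sol -> continuous L ->
  (forall s, U (p s) /\ f (p s, L s) = 0) ->
  U x0 -> f (x0, l0) = 0 -> has_expansion f x0 l0 ->
  exists a d, [/\ 0 < d, U a, forall y i, `|y - x0| < d -> y 0 i + d < a 0 i,
    forall l, `|l - l0| < d -> forall i, 0 < f (a, l) 0 i &
    forall s1 s2, s1 < s2 -> `|p s1 - x0| < d ->
      (forall t, s1 <= t <= s2 -> D t /\ `|L t - l0| < d) ->
      stays_above Sol p s1 -> exists2 s, s1 < s <= s2 & eventually_above Sol s a].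
Proof.
move=> oU cf Kam lb fam cL Hp Ux fx [w [c [d0 [w0 c0 d00 Exp]]]].
have [d1 d10 bU] := open_ball_sub oU Ux.
have [W W0 wW] := finite_upper_bound (fun i => w 0 i).
have wi i : 0 < w 0 i by have := w0 i; rewrite mxE.
have [m m0 wm] := finite_pos_lower_bound wi.
have [r r0 [rd0 rd1]] : exists2 r, 0 < r & r < d0 / 2 /\ r < d1 / 2.
  have : \forall r \near (0 : R)^'+, [/\ 0 < r, r < d0 / 2 & r < d1 / 2].
    by near=> r; split; near: r; [exact: nbhs_right_gt|apply: nbhs_right_lt; rewrite divr_gt0//..].
  by move=> /filter_ex[r [? ? ?]]; exists r.
pose th := r / W / 2; have th0 : 0 < th by rewrite !divr_gt0.
have thW : 2 * th * W = r by rewrite /th; field; rewrite gt_eqF.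
clearbody th.
have near_x0 y t : `|y - x0| < r -> 0 <= t <= 2 * th ->
    `|y + t *: w - x0| < d0 /\ U (y + t *: w).
  move=> yr /andP[t0 t1].
  have H : `|y + t *: w - x0| < 2 * r.
    have := row_scale_norm t W0 w0 wW; rewrite ger0_norm// => h1.
    have h2 : t * W <= r by rewrite -thW ler_wpM2r// ltW.
    rewrite addrAC (le_lt_trans (ler_normD _ _))//.
    by move: h1 h2 yr; clear; lra.
  split; first by move: H rd0; clear; lra.
  by apply: bU; move: H rd1; clear; lra.
have x0x0 : `|x0 - x0| < r by rewrite subrr normr0.
have thin : 0 <= th <= 2 * th by move: th0; clear; lra.
have [ad0 Ua] := near_x0 x0 th x0x0 thin.
have pos i : 0 < f (x0 + th *: w, l0) 0 i.
  have := Exp x0 th l0 i (ltW th0).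
  rewrite !subrr !normr0 fx mxE add0r => /(_ d00 ad0 d00).
  by apply: lt_le_trans; rewrite mulr_gt0.
have [da da0 Hd] := field_pos_near cf Ua pos.
(* Half of [th * m], so that the corner exceeds the whole [d]-ball by a further [d]; this is the
   margin that [stays_above] receives back. *)
pose d := Num.min (Num.min da d0) (Num.min r (th * m / 2)).
have d_gt0 : 0 < d by rewrite !lt_min da0 d00 r0 divr_gt0// mulr_gt0.
have [dda ddd0 dr dm] : [/\ d <= da, d <= d0, d <= r & d <= th * m / 2].
  by rewrite /d; split; rewrite !ge_min lexx ?orbT.
clearbody d.
exists (x0 + th *: w), d; split=> //.
- move=> y i yd; rewrite !mxE; have := dist_coord i yd.
  have : th * m < th * w 0 i by rewrite ltr_pM2l.
  by rewrite ltr_norml; move: dm; clear; lra.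
- by move=> l ld; apply: Hd; exact: lt_le_trans dda.
move=> s1 s2 s12 ps Hs [m' m'0 start0].
have [Ups fps] := Hp s1.
pose th1 := Num.min th (m' / W).
have th10 : 0 < th1 by rewrite lt_min th0 divr_gt0.
have th1th : th1 <= th by rewrite ge_min lexx.
have th1W : th1 * W <= m' by rewrite -ler_pdivlMr// ge_min lexx orbT.
clearbody th1.
have k0 : 0 < c * th1 / 2 by rewrite divr_gt0// mulr_gt0.
have [rho rho0 Hrho] := field_near_equilibrium cf Ups (cL s1) fps k0.
pose s := Num.min s2 (s1 + rho / 2).
have s1s : s1 < s by rewrite lt_min s12 ltrDl divr_gt0.
have ss2 : s <= s2 by rewrite ge_min lexx.
have srho : s <= s1 + rho / 2 by rewrite ge_min lexx orbT.
clearbody s.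
have sub t : s1 <= t <= s -> s1 <= t <= s2.
  by move=> /andP[-> h1]; rewrite (le_trans h1 ss2).
exists s; first by rewrite s1s.
have start : eventually_above Sol s1 (p s1 + th1 *: w).
  apply: eventually_above_le start0 => i; rewrite !mxE lerD2l.
  by apply: le_trans th1W; rewrite ler_wpM2l ?ltW.
have ramp : eventually_above Sol s (p s1 + th1 *: w + (2 * th - th1) *: w).
  apply: (eventually_above_ramp Kam lb fam s1s _ k0 _ start).
    by move=> t /sub/Hs[].
  move=> tau t /andP[tau0 tau1] ts.
  pose th2 := th1 + tau * (2 * th - th1).
  have E : p s1 + th1 *: w + tau *: ((2 * th - th1) *: w) = p s1 + th2 *: w.
    by rewrite scalerA -addrA -scalerDl.
  have th2b : th1 <= th2 <= 2 * th.
    have h : 0 <= 2 * th - th1 by move: th1th th0; clear; lra.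
    have := mulr_ge0 tau0 h; have : tau * (2 * th - th1) <= 2 * th - th1 by rewrite ler_piMl.
    by rewrite /th2; clear; lra.
  have th2p : 0 <= th2 <= 2 * th by move: th2b th10; clear; lra.
  rewrite E; have [pd Up] := near_x0 (p s1) th2 (lt_le_trans ps dr) th2p.
  split=> // i; have [_ Lt] := Hs t (sub t ts).
  have := Exp (p s1) th2 (L t) i (proj1 (andP th2p)) (lt_le_trans ps ddd0) pd (lt_le_trans Lt ddd0).
  have trho : `|t - s1| < rho by move: ts srho rho0; rewrite ltr_norml; clear; lra.
  have := Hrho t trho i.
  have : c * th1 <= c * th2 by rewrite ler_pM2l//; case/andP: th2b.
  by clear; lra.
apply: eventually_above_le ramp => i; rewrite !mxE.
have := dist_coord i ps; have : th * m < th * w 0 i by rewrite ltr_pM2l.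
have tm : 0 < th * m by rewrite mulr_gt0.
by rewrite ltr_norml mulrBl; move: dm tm; clear; lra.
Unshelve. all: by end_near. Qed.

Lemma tracking_propagates (R : realType) (n : nat) (U : set 'rV[R]_n)
    (f : 'rV[R]_n * R -> 'rV[R]_n) (lm lp : R) (L : R -> R) (D : set R)
    (Sol : R -> (R -> 'rV[R]_n) -> Prop) (q : R -> 'rV[R]_n) (a b : R) :
  open U -> field_cont U f -> kamke U f lm lp -> (forall s, lm <= L s <= lp) ->
  slow_family U f L D Sol -> continuous L -> continuous q ->
  (forall s, U (q s) /\ f (q s, L s) = 0) ->
  (forall s, has_contraction f (q s) (L s)) ->
  a <= b -> (forall s, a <= s <= b -> D s) ->
  tracks_below Sol q a -> tracks_below Sol q b.
Proof.
move=> oU cf Kam lb fam cL cq Hq Con ab dom start.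
apply: (propagation ab start) => s sab; have [Uq fq] := Hq s.
have [z [d [d0 Uz zy fz step]]] := tracking_local oU cf Kam lb fam cL Hq Uq fq (Con s).
have /cvgrPdist_lt/(_ _ d0)/near_ball_real[r1 r10 Hr1] := cq s.
have /cvgrPdist_lt/(_ _ d0)/near_ball_real[r2 r20 Hr2] := cL s.
exists (Num.min r1 r2); first by rewrite lt_min r10.
move=> s1 s2 as1 s12 s2b s1r s2r tr.
have near_s t : s1 <= t <= s2 -> `|q t - q s| < d /\ `|L t - L s| < d.
  move=> tt; have : `|t - s| < Num.min r1 r2.
    by move: s1r s2r tt; rewrite !ltr_norml; clear; lra.
  by rewrite lt_min => /andP[/Hr1 h1 /Hr2 h2]; rewrite distrC h1 distrC h2.
have dom' t : s1 <= t <= s2 -> D t by move=> tt; apply: dom; move: tt as1 s2b; clear; lra.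
have s11 : s1 <= s1 <= s2 by rewrite lexx ltW.
have s22 : s1 <= s2 <= s2 by rewrite lexx ltW.
have above1 : eventually_above Sol s1 z.
  have [g g0 Hg] := vec_ll_gap (zy _ (near_s s1 s11).1).
  apply: eventually_above_le (tr g g0) => i; rewrite !mxE.
  by have := Hg i; clear; lra.
apply: (step s1 s2 s12 (near_s s2 s22).1) => t ts.
have [t1 t2] := andP ts.
split; [exact: dom'|exact: (near_s t ts).2|].
have sub t' : s1 <= t' <= t -> s1 <= t' <= s2.
  by move=> /andP[-> h]; rewrite (le_trans h t2).
apply: (eventually_above_hold Kam lb fam t1 _ Uz _ above1) => t' /sub tt'; first exact: dom'.
by apply: fz; exact: (near_s t' tt').2.
Qed.

Lemma departure_propagates (R : realType) (n : nat) (U : set 'rV[R]_n)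
    (f : 'rV[R]_n * R -> 'rV[R]_n) (lm lp : R) (L : R -> R) (D : set R)
    (Sol : R -> (R -> 'rV[R]_n) -> Prop) (p : R -> 'rV[R]_n) (a b : R) :
  open U -> field_cont U f -> kamke U f lm lp -> (forall s, lm <= L s <= lp) ->
  slow_family U f L D Sol -> continuous L -> continuous p ->
  (forall s, U (p s) /\ f (p s, L s) = 0) ->
  (forall s, has_expansion f (p s) (L s)) ->
  a <= b -> (forall s, a <= s <= b -> D s) ->
  stays_above Sol p a -> stays_above Sol p b.
Proof.
move=> oU cf Kam lb fam cL cp Hp Exp ab dom start.
apply: (propagation ab start) => s sab; have [Up fp] := Hp s.
have [z [d [d0 Uz zy fz step]]] := departure_local oU cf Kam lb fam cL Hp Up fp (Exp s).
have /cvgrPdist_lt/(_ _ d0)/near_ball_real[r1 r10 Hr1] := cp s.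
have /cvgrPdist_lt/(_ _ d0)/near_ball_real[r2 r20 Hr2] := cL s.
exists (Num.min r1 r2); first by rewrite lt_min r10.
move=> s1 s2 as1 s12 s2b s1r s2r st.
have near_s t : s1 <= t <= s2 -> `|p t - p s| < d /\ `|L t - L s| < d.
  move=> tt; have : `|t - s| < Num.min r1 r2.
    by move: s1r s2r tt; rewrite !ltr_norml; clear; lra.
  by rewrite lt_min => /andP[/Hr1 h1 /Hr2 h2]; rewrite distrC h1 distrC h2.
have dom' t : s1 <= t <= s2 -> D t by move=> tt; apply: dom; move: tt as1 s2b; clear; lra.
have s11 : s1 <= s1 <= s2 by rewrite lexx ltW.
have s22 : s1 <= s2 <= s2 by rewrite lexx ltW.
have [t|s3 /andP[s13 s32] above3] := step s1 s2 s12 (near_s s1 s11).1 _ st.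
  by move=> ts; split; [exact: dom'|exact: (near_s t ts).2].
exists d => //.
have sub t : s3 <= t <= s2 -> s1 <= t <= s2.
  by move=> /andP[h ->]; rewrite (le_trans (ltW s13) h).
have := eventually_above_hold Kam lb fam s32 (fun t tt => dom' t (sub t tt)) Uz
  (fun t tt => fz _ (near_s t (sub t tt)).2) above3.
apply: eventually_above_le => i; rewrite !mxE ltW//.
by apply: zy; exact: (near_s s2 s22).1.
Qed.

(** * A parameter shift with a fast jump *)

Lemma real_C1_derive (R : realType) (L L1 : R -> R) :
  (forall t, is_derive t (1 : R) L (L1 t)) ->
  (forall t, differentiable L t) /\ forall v : R, 'D_v L = fun t => v * L1 t.
Proof.
move=> D; have dL t : differentiable L t.
  by apply/derivable1_diffP; have [] := D t.
split=> // v; apply/funext => t; rewrite deriveE//.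
have -> : v = v *: (1 : R) by rewrite /GRing.scale /= mulr1.
by rewrite linearZ -deriveE// (@derive_val _ _ _ _ _ _ _ (D t)) /GRing.scale /= mulr1.
Qed.

(** On the line all directional derivatives are multiples of the ordinary one, so the recursion in
    [Ck] reduces to two derivatives, the second continuous. *)
Lemma real_Ck2P (R : realType) (L : R -> R) :
  Ck 2 setT L <-> exists L1 L2 : R -> R,
    [/\ forall t, is_derive t (1 : R) L (L1 t),
        forall t, is_derive t (1 : R) L1 (L2 t) & continuous L2].
Proof.
split=> [[dL H]|[L1 [L2 [D1 D2 c2]]]].
  have [d1 H1] := H 1; exists ('D_1 L), ('D_1 ('D_1 L)); split.
  - by move=> t; apply: derivableP; apply: diff_derivable; exact: dL.
  - by move=> t; apply: derivableP; apply: diff_derivable; exact: d1.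
  - by move=> t; exact: H1.
have [dL E1] := real_C1_derive D1.
split=> [t _|v]; first exact: dL.
have D2' t : is_derive t (1 : R) (fun t => v * L1 t) (v * L2 t).
  by have H := D2 t; apply: is_derive_eq; rewrite /GRing.scale /=; ring.
have [dL1 E2] := real_C1_derive D2'.
rewrite E1; split=> [t _|v']; first exact: dL1.
rewrite E2 => t _; apply: cvgM; first exact: cvg_cst.
by apply: cvgM; [exact: cvg_cst|exact: c2].
Qed.

Definition pos_part (R : realType) (t : R) : R := Num.max t 0.

(** The expansion error for a step [h] is at most [h ^ 2], across the kink as well, hence the radius
    [e]. *)
Lemma is_derive_pos_part2 (R : realType) (t : R) :
  is_derive t (1 : R) (fun t => pos_part t ^+ 2) (2 * pos_part t).
Proof.
apply/is_derive_epsP => e e0; exists e => // h he.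
apply: (@le_trans _ _ (`|h| ^+ 2)); last by rewrite expr2 ler_wpM2r// ltW.
rewrite -normrX [leRHS]ger0_norm ?sqr_ge0// /pos_part ler_norml !expr2.
case: (leP t 0) => t0; case: (leP (t + h) 0) => th0; rewrite ?mulr0 ?mul0r; nra.
Qed.

Lemma is_derive_pos_part3 (R : realType) (t : R) :
  is_derive t (1 : R) (fun t => pos_part t ^+ 3) (3 * pos_part t ^+ 2).
Proof.
have -> : (fun t : R => pos_part t ^+ 3) = (fun t => t * pos_part t ^+ 2).
  apply/funext => s; rewrite exprS /pos_part; case: (leP s 0) => // s0.
  by rewrite expr2 !mul0r mulr0.
have H := is_derive_pos_part2 t.
apply: is_derive_eq; rewrite /GRing.scale /= /pos_part.
by case: (leP t 0) => t0; ring.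
Qed.

Lemma is_derive_affine_arg (R : realType) (F : R -> R) (d a b t : R) :
  is_derive (a * t + b) (1 : R) F d ->
  is_derive t (1 : R) (fun t => F (a * t + b)) (a * d).
Proof.
move=> H; have D : is_derive t (1 : R) (fun t => a * t + b) a.
  by apply: is_derive_eq; rewrite /GRing.scale /=; ring.
apply: (is_derive_eq (is_derive1_comp (f := F) (g := fun s => a * s + b) _ _)).
by rewrite /GRing.scale /= mulrC.
Qed.

(* The cubic B-spline, integrated: third differences of [pos_part t ^+ 3]
   vanish before the first knot and are constant after the last one. *)
Lemma smooth_step (R : realType) : exists h h1 h2 : R -> R,
  [/\ forall t, is_derive t (1 : R) h (h1 t),
      forall t, is_derive t (1 : R) h1 (h2 t), continuous h2,
      forall t, t <= 0 -> h t = 0 /\ h1 t = 0 &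
      forall t, 1 <= t -> h t = 1 /\ h1 t = 0].
Proof.
(* Knots at 0, 1/3, 2/3 and 1, with the weights of a third difference. The summand [+ 0] gives all
   four arguments the form [a * t + b]. *)
pose B (F : R -> R) t := F (3 * t + 0) - 3 * F (3 * t - 1) + 3 * F (3 * t - 2) - F (3 * t - 3).
have B' F F' t : (forall t, is_derive t (1 : R) F (F' t)) ->
    is_derive t (1 : R) (B F) (3 * B F' t).
  move=> D; have H0 := is_derive_affine_arg (D (3 * t + 0)).
  have H1 := is_derive_affine_arg (D (3 * t - 1)).
  have H2 := is_derive_affine_arg (D (3 * t - 2)).
  have H3 := is_derive_affine_arg (D (3 * t - 3)).
  by apply: is_derive_eq; rewrite /B /GRing.scale /=; ring.
pose T k (t : R) := pos_part t ^+ k.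
(* The third difference of the cube is 6, whence [6^-1]; each differentiation brings a factor 3 from
   the rescaling and one from the power. *)
exists (fun t => 6^-1 * B (T 3%N) t), (fun t => 6^-1 * (9 * B (T 2%N) t)),
  (fun t => 9 * B (@pos_part R) t).
have D3 t : is_derive t (1 : R) (T 3%N) (3 * T 2%N t) by exact: is_derive_pos_part3.
have D2 t : is_derive t (1 : R) (T 2%N) (2 * pos_part t) by exact: is_derive_pos_part2.
split.
- move=> t; have H := B' _ _ t D3; apply: is_derive_eq.
  by rewrite /B /GRing.scale /=; ring.
- move=> t; have H := B' _ _ t D2; apply: is_derive_eq.
  by rewrite /B /GRing.scale /=; clear; lra.
- move=> t; have cp : continuous (@pos_part R).
    by move=> s; apply: (@continuous_max _ _ id (cst 0) s); [exact: cvg_id|exact: cvg_cst].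
  have ca (a b : R) : (fun t => pos_part (a * t + b)) s @[s --> t] --> pos_part (a * t + b).
    apply: (cvg_comp (fun t => a * t + b) (@pos_part R) _ (cp _)).
    by apply: cvgD; [apply: cvgM; [exact: cvg_cst|exact: cvg_id]|exact: cvg_cst].
  rewrite /B; apply: cvgM; first exact: cvg_cst.
  apply: cvgB; last exact: ca.
  apply: cvgD; last by apply: cvgM; [exact: cvg_cst|exact: ca].
  by apply: cvgB; [exact: ca|apply: cvgM; [exact: cvg_cst|exact: ca]].
- move=> t t0; have P (a : R) : a <= 0 -> pos_part (3 * t + a) = 0.
    by move=> a0; apply/max_idPr; move: t0 a0; clear; lra.
  by rewrite /B /T !P ?oppr_le0//; split; field.
- move=> t t1; have P (a : R) : - 3 <= a -> pos_part (3 * t + a) = 3 * t + a.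
    by move=> a0; apply/max_idPl; move: t1 a0; clear; lra.
  by rewrite /B /T !P ?lerN2 ?ler_nat//; [split; field|clear; lra..].
Qed.

(* [L'] follows [L] at speed [e] up to the value [L u], jumps to [L v] during
   [[0, d]], and then follows [L] at speed [e] again. *)
Lemma shift_with_jump (R : realType) (lm lp : R) (L : R -> R) (u v e d : R) :
  parameter_shift lm lp L -> 0 < e -> 0 < d ->
  exists L', [/\ parameter_shift lm lp L',
    forall t, t <= 0 -> L' t = L (e * t + u) &
    forall t, d <= t -> L' t = L (e * t + (v - e * d))].
Proof.
move=> [/real_Ck2P[L1 [L2 [D1 D2 c2]]] Lb [Lm Lp] [dLm dLp]] e0 d0.
have [h [h1 [h2 [Dh Dh1 ch2 h_neg h_pos]]]] := smooth_step R.
(* The jump in [sig], adjusted for the drift [e * d] so that [sig d = v]. *)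
pose A := v - u - e * d.
pose sig t := e * t + u + A * h (d^-1 * t + 0).
pose sig1 t := e + A * (d^-1 * h1 (d^-1 * t + 0)).
pose sig2 t := A * (d^-1 * (d^-1 * h2 (d^-1 * t + 0))).
have Ds t : is_derive t (1 : R) sig (sig1 t).
  have H := is_derive_affine_arg (Dh (d^-1 * t + 0)).
  by apply: is_derive_eq; rewrite /sig1 /GRing.scale /=; ring.
have Ds1 t : is_derive t (1 : R) sig1 (sig2 t).
  have H := is_derive_affine_arg (Dh1 (d^-1 * t + 0)).
  by apply: is_derive_eq; rewrite /sig2 /GRing.scale /=; ring.
have dinv : 0 < d^-1 by rewrite invr_gt0.
have s_neg t : t <= 0 -> sig t = e * t + u /\ sig1 t = e.
  move=> t0; have [E1 E2] : h (d^-1 * t + 0) = 0 /\ h1 (d^-1 * t + 0) = 0.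
    by apply: h_neg; rewrite addr0 pmulr_rle0.
  by rewrite /sig /sig1 E1 E2; split; ring.
have s_pos t : d <= t -> sig t = e * t + (v - e * d) /\ sig1 t = e.
  move=> dt; have [E1 E2] : h (d^-1 * t + 0) = 1 /\ h1 (d^-1 * t + 0) = 0.
    by apply: h_pos; rewrite addr0 ler_pdivlMl// mulr1.
  by rewrite /sig /sig1 E1 E2 /A; split; ring.
pose L'1 t := L1 (sig t) * sig1 t.
have D' t : is_derive t (1 : R) (fun t => L (sig t)) (L'1 t).
  by apply: (is_derive_eq (is_derive1_comp (f := L) (g := sig) _ _)).
have dE t : derive1 (fun t => L (sig t)) t = L'1 t.
  by rewrite derive1E (@derive_val _ _ _ _ _ _ _ (D' t)).
have dLE t : derive1 L t = L1 t.
  by rewrite derive1E (@derive_val _ _ _ _ _ _ _ (D1 t)).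
exists (fun t => L (sig t)); split; last 2 first.
- by move=> t /s_neg[->].
- by move=> t /s_pos[->].
split.
- apply/real_Ck2P; exists L'1, (fun t => L2 (sig t) * sig1 t * sig1 t + L1 (sig t) * sig2 t).
  split=> //.
  + move=> t; have H : is_derive t (1 : R) (fun t => L1 (sig t)) (L2 (sig t) * sig1 t).
      by apply: (is_derive_eq (is_derive1_comp (f := L1) (g := sig) _ _)).
    have H2 := Ds1 t.
    by apply: is_derive_eq; rewrite /GRing.scale /=; ring.
  + move=> t; have cs := is_derive_cont (Ds t); have cs1 := is_derive_cont (Ds1 t).
    have cL1 := is_derive_cont (D2 (sig t)).
    have cs2 : {for t, continuous sig2}.
      apply: cvgM; first exact: cvg_cst.
      apply: cvgM; first exact: cvg_cst.
      apply: cvgM; first exact: cvg_cst.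
      apply: (cvg_comp (fun t => d^-1 * t + 0) h2 _ (ch2 _)).
      by apply: cvgD; [apply: cvgM; [exact: cvg_cst|exact: cvg_id]|exact: cvg_cst].
    apply: cvgD.
      apply: cvgM; last exact: cs1.
      by apply: cvgM; [exact: (cvg_comp sig L2 cs (c2 _))|exact: cs1].
    by apply: cvgM; [exact: (cvg_comp sig L1 cs cL1)|exact: cs2].
- by move=> s; exact: Lb.
- split.
    have /cvg_ninfty_epsP H := cvg_ninfty_affine_time u e0 Lm.
    apply/cvg_ninfty_epsP => eps /H[T HT]; exists (Num.min T 0) => t.
    by rewrite le_min => /andP[tT t0]; rewrite (s_neg t t0).1; exact: HT.
  have /cvg_pinfty_epsP H := cvg_pinfty_affine_time (v - e * d) e0 Lp.
  apply/cvg_pinfty_epsP => eps /H[T HT]; exists (Num.max T d) => t.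
  by rewrite ge_max => /andP[tT t0]; rewrite (s_pos t t0).1; exact: HT.
- split.
    have /cvg_ninfty_epsP H := cvg_ninfty_affine_time u e0 dLm.
    apply/cvg_ninfty_epsP => eps eps0; have [T HT] := H (eps / e) (divr_gt0 eps0 e0).
    exists (Num.min T 0) => t; rewrite le_min => /andP[tT t0].
    have := HT t tT; rewrite dE /L'1 (s_neg t t0).1 (s_neg t t0).2 dLE !subr0.
    by rewrite normrM (gtr0_norm e0) ltr_pdivlMr.
  have /cvg_pinfty_epsP H := cvg_pinfty_affine_time (v - e * d) e0 dLp.
  apply/cvg_pinfty_epsP => eps eps0; have [T HT] := H (eps / e) (divr_gt0 eps0 e0).
  exists (Num.max T d) => t; rewrite ge_max => /andP[tT t0].
  have := HT t tT; rewrite dE /L'1 (s_pos t t0).1 (s_pos t t0).2 dLE !subr0.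
  by rewrite normrM (gtr0_norm e0) ltr_pdivlMr.
Qed.

(** The rate is 1, since slow and fast motion are both built into the shift. The duration [d] of the
    jump comes from a bound on the field, [N] from tracking and departure, and only then is [L']
    formed. *)
Lemma tipping_for_some_shift (R : realType) (n : nat) (U : set 'rV[R]_n)
    (f : 'rV[R]_n * R -> 'rV[R]_n) (lm lp : R) (L : R -> R)
    (p q : R -> 'rV[R]_n) (pp qm qp : 'rV[R]_n) (u v : R) :
  'I_n -> open U -> field_cont U f -> kamke U f lm lp ->
  parameter_shift lm lp L -> continuous p -> continuous q ->
  (forall s, U (p s) /\ f (p s, L s) = 0) ->
  (forall s, U (q s) /\ f (q s, L s) = 0) ->
  (forall s, has_expansion f (p s) (L s)) ->
  (forall s, has_contraction f (q s) (L s)) ->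
  q s @[s --> -oo] --> qm -> p s @[s --> +oo] --> pp ->
  U qm -> f (qm, lm) = 0 -> has_contraction f qm lm ->
  U pp -> f (pp, lp) = 0 -> has_expansion f pp lp ->
  vec_ll qp pp -> vec_ll (p v) (q u) ->
  exists2 L', parameter_shift lm lp L' & forall x,
    trajectory U (shifted_field f L' 1) setT x ->
    x t @[t --> -oo] --> qm -> ~ (x t @[t --> +oo] --> qp).
Proof.
move=> i0 oU cf Kam shiftL cp cq Hp Hq Exp Con qlim plim Uqm fqm conm Upp fpp expp qp_pp pv_qu.
have [/real_Ck2P[L1 [L2 [DL _ _]]] Lb [Lm Lp] _] := shiftL.
have lb s : lm <= L s <= lp by have /andP[/ltW-> /ltW->] := Lb s.
have cL : continuous L by move=> s; exact: is_derive_cont (DL s).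
move/cvg_ninfty_epsP : Lm => Lm; move/cvg_pinfty_epsP : Lp => Lp.
move/cvg_ninfty_epsP : qlim => qlim; move/cvg_pinfty_epsP : plim => plim.
pose Sol1 N (y : R -> 'rV[R]_n) := [/\ 0 < N, forall s, s <= u ->
  U (y s) /\ is_derive s (1 : R) y (N *: f (y s, L s)) & y s @[s --> -oo] --> qm].
have fam1 : slow_family U f L [set s | s <= u] Sol1 by move=> N y [].
have track : tracks_below Sol1 q u.
  have [a [d [d0 Ua za fa step]]] := tracking_local oU cf Kam lb fam1 cL Hq Uqm fqm conm.
  have [T1 HT1] := Lm d d0; have [T2 HT2] := qlim d d0.
  pose S := Num.min u (Num.min T1 T2).
  have Sb s : s <= S -> [/\ s <= u, `|L s - lm| < d & `|q s - qm| < d].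
    by rewrite !le_min => /and3P[-> /HT1-> /HT2->].
  have [Su _ qS] := Sb S (lexx S).
  have aq : vec_ll a qm by apply: za; rewrite subrr normr0.
  apply: (tracking_propagates oU cf Kam lb fam1 cL cq Hq Con Su).
    by move=> s /andP[].
  apply: (step (S - 1) S) => //; first by rewrite gtrBl.
  move=> t /andP[_ tS]; have [tu Lt _] := Sb t tS; split=> //.
  exists 0 => N y N0 [_ Hy ylim].
  apply: (past_above_corner (S := S) Kam lb N0 Ua aq _ _ ylim tS) => s sS.
    by apply: fa; have [] := Sb s sS.
  by apply: Hy; have [] := Sb s sS.
have [g4 g40 Hg4] := vec_ll_gap pv_qu.
have [dU dU0 bU] := open_ball_sub oU (Hq u).1.
(* The gap at the jump pays for three times [g]: the tracking error, the fall during the jump, and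
   the margin above [p v]. *)
have [g g0 [gg4 gdU]] : exists2 g, 0 < g & 4 * g <= g4 /\ 4 * g <= dU.
  exists (Num.min g4 dU / 4); first by rewrite divr_gt0// lt_min g40.
  have h1 : Num.min g4 dU <= g4 by rewrite ge_min lexx.
  have h2 : Num.min g4 dU <= dU by rewrite ge_min lexx orbT.
  by split; [move: h1|move: h2]; clear; lra.
pose a0 := q u - const_mx g.
have Us tau : 0 <= tau <= 1 -> U (a0 + tau *: const_mx (- g)).
  move=> /andP[t0 t1]; apply: bU; apply: (@le_lt_trans _ _ (2 * g)); last first.
    by move: g0 gdU; clear; lra.
  apply: norm_le_coord => [|i]; first by rewrite mulr_ge0// ltW.
  have tg : tau * g <= g by rewrite ler_piMl// ltW.
  have tg0 : 0 <= tau * g by rewrite mulr_ge0// ltW.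
  by rewrite !mxE mulrN ler_norml; move: tg tg0 g0; clear; lra.
have [M M0 drop] := drop_barrier Kam cf Us g0.
(* [M] bounds the field for all parameters in [[lm, lp]], so [d] is independent of the jump yet to
   be built. *)
pose d := g / M; have d0 : 0 < d by rewrite divr_gt0.
pose Sol2 N (y : R -> 'rV[R]_n) := [/\ 0 < N, forall s, v <= s ->
  U (y s) /\ is_derive s (1 : R) y (N *: f (y s, L s)) & vec_ll (p v + const_mx g) (y v)].
have fam2 : slow_family U f L [set s | v <= s] Sol2 by move=> N y [].
have [b [db [db0 Ub zb fb step]]] := departure_local oU cf Kam lb fam2 cL Hp Upp fpp expp.
have [T1 HT1] := Lp db db0; have [T2 HT2] := plim db db0.
pose S := Num.max v (Num.max T1 T2).
have Sb s : S <= s -> [/\ v <= s, `|L s - lp| < db & `|p s - pp| < db].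
  by rewrite !ge_max => /and3P[-> /HT1-> /HT2->].
have [vS _ pS] := Sb S (lexx S).
have aboveS : stays_above Sol2 p S.
  apply: (departure_propagates oU cf Kam lb fam2 cL cp Hp Exp vS).
    by move=> s /andP[].
  by exists g => //; exists 0 => N y _ [].
have [//||s3 /andP[Ss3 _] [N2 HN2]] := step S (S + 1) _ pS _ aboveS.
- by rewrite ltrDl.
- by move=> t /andP[/Sb[]].
have [N1 HN1] := track g g0.
pose N := Num.max (Num.max N1 N2) 0 + 1.
have [N0 NN1 NN2] : [/\ 0 < N, N1 < N & N2 < N].
  have h0 : 0 <= Num.max (Num.max N1 N2) 0 by rewrite le_max lexx orbT.
  have h1 : N1 <= Num.max (Num.max N1 N2) 0 by rewrite !le_max lexx.
  have h2 : N2 <= Num.max (Num.max N1 N2) 0 by rewrite !le_max lexx !orbT.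
  by rewrite /N; split; [move: h0|move: h1|move: h2]; clear; lra.
clearbody N.
have e0 : 0 < N^-1 by rewrite invr_gt0.
have [L' [shiftL' L'm L'p]] := shift_with_jump u v shiftL e0 d0.
exists L' => // x tr xm xp.
have tr' t : U (x t) /\ is_derive t (1 : R) x (f (x t, L' t)).
  by have := tr t I; rewrite /shifted_field mul1r.
have [_ L'b _ _] := shiftL'.
(* The time change sends [s = u] to [t = 0], where the jump begins; the one in [Hy2] sends [s = v]
   to [t = d], where it ends. *)
have sol1 : Sol1 N (fun s => x (N * s + - (N * u))).
  split=> //; last exact: cvg_ninfty_affine_time.
  move=> s su; have [Ux Dx] := tr' (N * s + - (N * u)); split=> //.
  have := is_derive_affine_time Dx; rewrite L'm; last first.
    by rewrite subr_le0 ler_pM2l.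
  have -> // : N^-1 * (N * s - N * u) + u = s by field; rewrite gt_eqF.
have x0 : vec_ll a0 (x 0) by have := HN1 N _ NN1 sol1; rewrite subrr.
have xd i : a0 0 i - g < x d 0 i.
  apply: (drop 1 L' x 0 d ltr01 d0) => //.
  - by rewrite mul1r subr0 /d mulrC divfK// gt_eqF.
  - by move=> s _; have /andP[/ltW-> /ltW->] := L'b s.
  - by move=> s _; rewrite scale1r.
have Hy2 s : v <= s -> U (x (N * s + (d - N * v))) /\
    is_derive s (1 : R) (fun s => x (N * s + (d - N * v)))
      (N *: f (x (N * s + (d - N * v)), L s)).
  move=> vs; have [Ux Dx] := tr' (N * s + (d - N * v)); split=> //.
  have := is_derive_affine_time Dx; rewrite L'p; last first.
    by rewrite addrCA lerDl subr_ge0 ler_pM2l.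
  have -> // : N^-1 * (N * s + (d - N * v)) + (v - N^-1 * d) = s by field; rewrite gt_eqF.
have sol2 : Sol2 N (fun s => x (N * s + (d - N * v))).
  split=> // i; rewrite addrCA subrr addr0.
  have := xd i; have := Hg4 i; rewrite /a0 !mxE.
  by move: gg4 g0; clear; lra.
have pb i : pp 0 i < b 0 i.
  have : pp 0 i + db < b 0 i by apply: zb; rewrite subrr normr0.
  by move: db0; clear; lra.
apply: (future_above_corner (S := s3) (b := b) i0 Kam lb N0 Ub _ _ _ (HN2 N _ NN2 sol2)
  (cvg_pinfty_affine_time (d - N * v) N0 xp)).
- by move=> i; exact: lt_trans (qp_pp i) (pb i).
- by move=> s s3s; apply: fb; have [] := Sb s (ltW (lt_le_trans Ss3 s3s)).
- by move=> s s3s; apply: Hy2; have [] := Sb s (ltW (lt_le_trans Ss3 s3s)).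
Qed.

(** * Order reversal and conclusion *)

(** Monotonicity makes the Jacobian a Metzler matrix, and a nonnegative real eigenvalue would be a
    complex one with nonnegative real part; stability thus yields the weight [w]. *)
Lemma attracting_contraction (R : realType) (n : nat) (U : set 'rV[R]_n)
    (f : 'rV[R]_n * R -> 'rV[R]_n) (x : 'rV[R]_n) (l : R) :
  open U -> C1_field U f -> monotone_system U (fun x => f (x, l)) ->
  attracting_equilibrium U f x l -> has_contraction f x l.
Proof.
move=> oU C1 [mono _] [[Ux _] eig].
have od : off_diag_ge0 (dfdx f x l) by move=> i j ij; apply: mono; rewrite // eq_sym.
have noeig t : 0 <= t -> ~~ eigenvalue (dfdx f x l) t.
  move=> t0; apply/negP => /eigenvalueP[v vA v0].
  have : eigenvalue (map_mx (real_complex R) (dfdx f x l)) (real_complex R t).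
    apply/eigenvalueP; exists (map_mx (real_complex R) v); last by rewrite map_mx_eq0.
    by rewrite -map_mxM vA map_mxZ.
  by move=> /eig /=; rewrite ltNge t0.
have [w w0 wA] := metzler_stable od noeig.
by have [c [d [c0 d0 H]]] := contracting_at oU C1 Ux wA; exists w, c, d.
Qed.

Lemma eigenpair_expansion (R : realType) (n : nat) (U : set 'rV[R]_n)
    (f : 'rV[R]_n * R -> 'rV[R]_n) (x : 'rV[R]_n) (l : R) :
  open U -> C1_field U f -> U x -> pos_eigenpair (dfdx f x l) ->
  has_expansion f x l.
Proof.
move=> oU C1 Ux [mu [w [mu0 _ wA w0]]].
have pos : vec_ll 0 (w *m dfdx f x l).
  by move=> i; rewrite wA !mxE mulr_gt0//; have := w0 i; rewrite mxE.
by have [c [d [c0 d0 H]]] := expanding_at oU C1 Ux pos; exists w, c, d.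
Qed.

Definition flip_field (R : realType) (n : nat) (f : 'rV[R]_n * R -> 'rV[R]_n)
    (z : 'rV[R]_n * R) : 'rV[R]_n := - f (- z.1, z.2).

Definition flip_set (R : realType) (n : nat) (U : set 'rV[R]_n) : set 'rV[R]_n :=
  [set x | U (- x)].

Lemma flip_open (R : realType) (n : nat) (U : set 'rV[R]_n) :
  open U -> open (flip_set U).
Proof. by move=> oU; apply: open_comp oU => x _; exact: continuousN. Qed.

Lemma flip_cont (R : realType) (n : nat) (U : set 'rV[R]_n)
    (f : 'rV[R]_n * R -> 'rV[R]_n) :
  field_cont U f -> field_cont (flip_set U) (flip_field f).
Proof.
move=> cf x l Ux; have c1 : (fun z : 'rV[R]_n * R => - z.1) z @[z --> (x, l)] --> - x.
  by apply: cvgN; exact: cvg_fst.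
have c2 : (fun z : 'rV[R]_n * R => z.2) z @[z --> (x, l)] --> l by exact: cvg_snd.
have c3 : (fun z : 'rV[R]_n * R => (- z.1, z.2)) z @[z --> (x, l)] --> (- x, l).
  exact: (cvg_pair c1 c2).
by apply: cvgN; exact: (cvg_comp (fun z : 'rV[R]_n * R => (- z.1, z.2)) f c3 (cf _ _ Ux)).
Qed.

Lemma flip_kamke (R : realType) (n : nat) (U : set 'rV[R]_n)
    (f : 'rV[R]_n * R -> 'rV[R]_n) (lm lp : R) :
  kamke U f lm lp -> kamke (flip_set U) (flip_field f) lm lp.
Proof.
move=> Kam x y l i ll Ux Uy xy xyi; rewrite !mxE lerN2; apply: Kam => //.
  by move=> j; rewrite !mxE lerN2.
by rewrite !mxE xyi.
Qed.

Lemma flip_dist (R : realType) (n : nat) (x y : 'rV[R]_n) :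
  `|- x - y| = `|x - - y|.
Proof. by rewrite -normrN opprD !opprK. Qed.

(** Reflection exchanges the endpoints of a segment along [w], and the sign in front of the field
    restores the inequality, with the same [w], [c] and [d]. *)
Lemma flip_contraction (R : realType) (n : nat) (f : 'rV[R]_n * R -> 'rV[R]_n) x l :
  has_contraction f x l -> has_contraction (flip_field f) (- x) l.
Proof.
move=> [w [c [d [w0 c0 d0 H]]]]; exists w, c, d; split=> // y th l' i th0 yd ywd ld.
have := H (- y - th *: w) th l' i th0.
rewrite subrK -opprD !flip_dist => /(_ ywd yd ld).
by rewrite /flip_field !mxE /=; clear; lra.
Qed.

Lemma flip_expansion (R : realType) (n : nat) (f : 'rV[R]_n * R -> 'rV[R]_n) x l :
  has_expansion f x l -> has_expansion (flip_field f) (- x) l.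
Proof.
move=> [w [c [d [w0 c0 d0 H]]]]; exists w, c, d; split=> // y th l' i th0 yd ywd ld.
have := H (- y - th *: w) th l' i th0.
rewrite subrK -opprD !flip_dist => /(_ ywd yd ld).
by rewrite /flip_field !mxE /=; clear; lra.
Qed.

Lemma flip_trajectory (R : realType) (n : nat) (U : set 'rV[R]_n)
    (f : 'rV[R]_n * R -> 'rV[R]_n) (L : R -> R) (r : R) (I : set R) x :
  trajectory U (shifted_field f L r) I x ->
  trajectory (flip_set U) (shifted_field (flip_field f) L r) I (fun t => - x t).
Proof.
move=> tr t /tr[Ux Dx]; split; first by rewrite /flip_set /= opprK.
by apply: is_derive_eq; rewrite /shifted_field /flip_field /= opprK.
Qed.

Lemma flip_ll (R : realType) (n : nat) (x y : 'rV[R]_n) :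
  vec_ll x y -> vec_ll (- y) (- x).
Proof. by move=> xy i; rewrite !mxE ltrN2. Qed.

Lemma flip_equilibrium (R : realType) (n : nat) (U : set 'rV[R]_n)
    (f : 'rV[R]_n * R -> 'rV[R]_n) x l :
  U x /\ f (x, l) = 0 -> flip_set U (- x) /\ flip_field f (- x, l) = 0.
Proof. by move=> [Ux fx]; rewrite /flip_set /flip_field /= !opprK fx oppr0. Qed.

(** [is_path] places the limits in [U]; that the limit is an equilibrium is recovered by
    continuity. *)
Lemma limit_equilibrium (R : realType) (n : nat) (U : set 'rV[R]_n)
    (f : 'rV[R]_n * R -> 'rV[R]_n) (L : R -> R) (p : R -> 'rV[R]_n) pp lp :
  field_cont U f -> (forall s, f (p s, L s) = 0) -> U pp ->
  p s @[s --> +oo] --> pp -> L s @[s --> +oo] --> lp -> f (pp, lp) = 0.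
Proof.
move=> cf fp Upp plim Llim.
have c3 : (fun s => (p s, L s)) s @[s --> +oo] --> (pp, lp).
  exact: (cvg_pair plim Llim).
have c4 : (fun s => f (p s, L s)) s @[s --> +oo] --> f (pp, lp).
  exact: (cvg_comp (fun s => (p s, L s)) f c3 (cf _ _ Upp)).
have E : (fun s => f (p s, L s)) = cst 0 by apply/funext.
rewrite E in c4; have c0 : cst (0 : 'rV[R]_n) s @[s --> (+oo : set_system R)] --> (0 : 'rV[R]_n).
  exact: cvg_cst.
exact: (cvg_unique _ c4 c0).
Qed.

Theorem proposition5p4 (R : realType) (n : nat) (U : set 'rV[R]_n)
    (f : 'rV[R]_n * R -> 'rV[R]_n) (lm lp : R) (L : R -> R)
    (p q : R -> 'rV[R]_n) (pm pp qm qp : 'rV[R]_n)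
    (openU : open U)
    (f_C2 : Ck 2 (U `*` [set: R]) f)
    (lm_lt_lp : lm < lp)
    (f_monotone : forall l, lm <= l <= lp ->
       monotone_system U (fun x => f (x, l)))
    (L_shift : parameter_shift lm lp L)
    (p_path : is_path U f L p pm pp)
    (q_stable : stable_path U f lm lp L q qm qp)
    (p_eig : forall s, pos_eigenpair (dfdx f (p s) (L s)))
    (pm_eig : pos_eigenpair (dfdx f pm lm))
    (pp_eig : pos_eigenpair (dfdx f pp lp)) :
  let q_below_p :=
    [/\ forall s, vec_ll (q s) (p s), vec_ll qm pm & vec_ll qp pp] in
  let q_above_p :=
    [/\ forall s, vec_ll (p s) (q s), vec_ll pm qm & vec_ll pp qp] in
  let some_shift_tips :=
    exists L', parameter_shift lm lp L' /\ R_tipping U f L' qm qp in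
  let tips_for_large_r :=
    exists r0, 0 < r0 /\ forall r, r0 < r -> tips_at U f L qm qp r in
  (* (1) *)
  ((q_below_p -> (exists u v, u < v /\ vec_ll (p v) (q u)) -> some_shift_tips)
   /\
   (q_above_p -> (exists u v, u < v /\ vec_ll (q u) (p v)) -> some_shift_tips))
  /\
  (* (2) *)
  ((q_below_p -> vec_ll pp qm -> tips_for_large_r)
   /\
   (q_above_p -> vec_ll qm pp -> tips_for_large_r)).
Proof.
have C1 := Ck2_C1_field f_C2.
have cf : field_cont U f by move=> x l Ux; exact: field_continuous C1 Ux.
have Kam := monotone_kamke openU C1 f_monotone.
have [L_C2 Lb [Llim Llimp] _] := L_shift.
have lb s : lm <= L s <= lp by have /andP[/ltW-> /ltW->] := Lb s.
(* The eigenvector at [pp] is nonzero, which excludes [n = 0]. *)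
have i0 : 'I_n.
  case: n U f p q pm pp qm qp {openU f_C2 f_monotone p_path q_stable p_eig pm_eig C1 cf Kam} pp_eig
    => [|n] U f p q pm pp qm qp; last by move=> _; exact: ord0.
  move=> eig; exfalso; case: eig => mu [w [_ /eqP w0 _ _]]; apply: w0.
  by rewrite thinmx0.
have [cp Hp [_ _] [plim Upp]] := p_path.
have [[cq Hq [qlim Uqm] _] q_att qm_att _] := q_stable.
have fqm : f (qm, lm) = 0 by have [[_ ->]] := qm_att.
have fpp : f (pp, lp) = 0 := limit_equilibrium cf (fun s => (Hp s).2) Upp plim Llimp.
have lm_in : lm <= lm <= lp by rewrite lexx ltW.
have conq s : has_contraction f (q s) (L s).
  by apply: attracting_contraction (q_att s) => //; exact: f_monotone.
have conm : has_contraction f qm lm.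
  by apply: attracting_contraction qm_att => //; exact: f_monotone.
have expp s : has_expansion f (p s) (L s).
  exact: eigenpair_expansion openU C1 (Hp s).1 (p_eig s).
have exppp : has_expansion f pp lp by exact: eigenpair_expansion openU C1 Upp pp_eig.
(* An attractor with finite [T] tips by definition, so only global trajectories have to be shown not
   to converge to [qp]. *)
have tips L' r : parameter_shift lm lp L' -> 0 < r ->
    (forall x, trajectory U (shifted_field f L' r) setT x ->
       x t @[t --> -oo] --> qm -> ~ (x t @[t --> +oo] --> qp)) ->
    tips_at U f L' qm qp r.
  move=> [/real_Ck2P[L1 [L2 [DL _ _]]] L'b [L'lim _] _] r0 H.
  have cL' : continuous L' by move=> s; exact: is_derive_cont (DL s).
  have [w [c [d [w0 c0 d0 con]]]] := conm.
  have [T [x pb]] := pullback_attractor_exists openU C1 Kam Uqm fqm w0 c0 d0 con cL' L'b L'lim r0.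
  exists T, x; split=> // -[TE xlim]; have [_ tr xm _] := pb.
  apply: (H x _ xm xlim) => t _; apply: tr.
  by rewrite /= TE ltry.
move=> below above some_shift large_r.
have fE x l := @flip_equilibrium R n U f x l.
have cN (x : R -> 'rV[R]_n) : continuous x -> continuous (fun s => - x s).
  by move=> cx s; apply: cvgN; exact: cx.
have oU' := flip_open openU; have cf' := flip_cont cf; have Kam' := flip_kamke Kam.
split; split.
- move=> [_ _ qp_pp] [u [v [_ pv_qu]]].
  have [L' shiftL' H] := tipping_for_some_shift i0 openU cf Kam L_shift cp cq
    Hp Hq expp conq qlim plim Uqm fqm conm Upp fpp exppp qp_pp pv_qu.
  by exists L'; split=> //; exists 1 => //; exact: tips.
- move=> [_ _ qp_pp] [u [v [_ pv_qu]]].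
  (* The pullback attractor is obtained for the original system through [tips]; only the claim of
     non-convergence is transported to [- x]. *)
  have [Uqm' fqm'] := fE _ _ (conj Uqm fqm); have [Upp' fpp'] := fE _ _ (conj Upp fpp).
  have [L' shiftL' H] := tipping_for_some_shift i0 oU' cf' Kam' L_shift (cN _ cp) (cN _ cq)
    (fun s => fE _ _ (Hp s)) (fun s => fE _ _ (Hq s))
    (fun s => flip_expansion (expp s)) (fun s => flip_contraction (conq s))
    (cvgN qlim) (cvgN plim) Uqm' fqm' (flip_contraction conm)
    Upp' fpp' (flip_expansion exppp) (flip_ll qp_pp) (flip_ll pv_qu).
  exists L'; split=> //; exists 1 => //; apply: tips => // x tr xm xp.
  exact: (H _ (flip_trajectory tr) (cvgN xm) (cvgN xp)).
- move=> [_ _ qp_pp] pp_qm.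
  have [r0 r00 H] := tipping_at_large_rates i0 openU cf Kam lb Llim Llimp
    Uqm fqm conm Upp fpp exppp qp_pp pp_qm.
  exists r0; split=> // r rr; apply: tips => //; first exact: lt_trans rr.
  exact: H.
- move=> [_ _ qp_pp] pp_qm.
  have [Uqm' fqm'] := fE _ _ (conj Uqm fqm); have [Upp' fpp'] := fE _ _ (conj Upp fpp).
  have [r0 r00 H] := tipping_at_large_rates i0 oU' cf' Kam' lb Llim Llimp
    Uqm' fqm' (flip_contraction conm) Upp' fpp' (flip_expansion exppp)
    (flip_ll qp_pp) (flip_ll pp_qm).
  exists r0; split=> // r rr; apply: tips => //; first exact: lt_trans rr.
  by move=> x tr xm xp; exact: (H r rr _ (flip_trajectory tr) (cvgN xm) (cvgN xp)).
Qed.
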